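(* Let $L$ be a finite-dimensional nilpotent Lie algebra over an algebraically closed field $\mathcal{K}$ with $\operatorname{char}(\mathcal{K})\neq 2$. Let $N$ be a non-abelian ideal of $L$, and let $K$ be a non-zero ideal of $L$ with $L=N\oplus K$. Put $n=\dim N$, $m=\dim K$, and define $s(N,L)$ by $\dim \mathcal{M}(N,L)=\frac12(n-1)(n-2)+1+(n-1)m-s(N,L)$. Then $s(N,L)=6$ if and only if the pair $(N,L)$ is isomorphic to one of the following pairs: \begin{itemize} \item $(H(1)\oplus A(4),\ H(1)\oplus H(r)\oplus A(m-2r+3))$ for some $r\ge 1$; \item $(H(1)\oplus A(1),\ H(1)\oplus A(1)\oplus K)$, where $K$ is any nilpotent Lie algebra with $\dim K^2=2$; \item $(H(1),\ H(1)\oplus K)$, where $K$ is any nilpotent Lie algebra with $\dim K^2=3$; \item $(H(2),\ H(2)\oplus H(r)\oplus A(m-2r-1))$ for some $r\ge 1$; \item $(L_{5,8}\oplus A(i),\ L_{5,8}\oplus A(5))$ for some $0\le i\le 4$; \item $(L_{4,3}\oplus A(i),\ L_{4,3}\oplus A(4))$ for some $0\le i\le 3$; \item $(L_{5,5}\oplus A(i),\ L_{5,5}\oplus A(3))$ for some $0\le i\le 2$; \item $(L_{6,22}(\epsilon)\oplus A(i),\ L_{6,22}(\epsilon)\oplus A(3))$ for some $0\le i\le 2$ and some $\epsilon\in\mathcal{K}$; \item $(L_{5,j},\ L_{5,j}\oplus A(1))$ for some $j\in\{6,7,9\}$; \item $(37A,\ 37A\oplus A(1))$; \item $(L_{6,10},\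 L_{6,10}\oplus A(1))$. \end{itemize}
   Context: All Lie algebras are over $\mathcal{K}$, and $X^2=[X,X]$ denotes the derived subalgebra of a Lie algebra $X$. Multiplier of a pair: let $N$ be an ideal of $L$, let $L\cong F/R$ be a free presentation with $F$ a free Lie algebra, and let $S$ be the ideal of $F$ with $R\subseteq S$ and $N\cong S/R$. Then $\mathcal{M}(N,L)=(R\cap[S,F])/[R,F]$. Isomorphism of pairs: $(N,L)\cong(N',L')$ means that there is a Lie algebra isomorphism $L\to L'$ mapping $N$ onto $N'$. In each listed pair, the first algebra is embedded in the second as the evident direct summand, and the complement is the direct sum of the remaining summands. For example, in $(L_{5,8}\oplus A(i),L_{5,8}\oplus A(5))$ the complement is $A(5-i)$, and in $(H(1)\oplus A(4),H(1)\oplus H(r)\oplus A(m-2r+3))$ the complement is $H(r)\oplus A(m-2r-1)$. Whenever $H(r)$ occurs in the complement, it is understood that $m\ge 2r+1$. Notation: $A(k)$ is the $k$-dimensional abelian Lie algebra ($A(0)=0$). $H(r)$ is the Heisenberg Lie algebra of dimension $2r+1$ with basis $x,x_1,\dots,x_{2r}$ and non-zero brackets $[x_{2i-1},x_{2i}]=x$ for $i=1,\dots,r$. The following algebras have basis $e_1,\dots,e_d$, where $d$ is the first subscript ($d=7$ for $37A$). The listed brackets are the only non-zero ones, up to antisymmetry. \begin{itemize} \item $L_{4,3}$: $[e_1,e_2]=e_3,\ [e_1,e_3]=e_4$. \item $L_{5,5}$: $[e_1,e_2]=e_3,\ [e_1,e_3]=[e_2,e_4]=e_5$. \item $L_{5,6}$: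 $[e_1,e_2]=e_3,\ [e_1,e_3]=e_4,\ [e_1,e_4]=[e_2,e_3]=e_5$. \item $L_{5,7}$: $[e_1,e_2]=e_3,\ [e_1,e_3]=e_4,\ [e_1,e_4]=e_5$. \item $L_{5,8}$: $[e_1,e_2]=e_4,\ [e_1,e_3]=e_5$. \item $L_{5,9}$: $[e_1,e_2]=e_3,\ [e_1,e_3]=e_4,\ [e_2,e_3]=e_5$. \item $L_{6,10}$: $[e_1,e_2]=e_3,\ [e_1,e_3]=[e_4,e_5]=e_6$. \item $L_{6,22}(\epsilon)$, $\epsilon\in\mathcal{K}$: $[e_1,e_2]=[e_3,e_4]=e_5,\ [e_1,e_3]=e_6,\ [e_2,e_4]=\epsilon e_6$. \item $37A$: $[e_1,e_2]=e_5,\ [e_2,e_3]=e_6,\ [e_2,e_4]=e_7$. \end{itemize} *)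

(* Defs.v *)
From HB Require Import structures.
From mathcomp Require Import all_boot all_order all_algebra.
From mathcomp Require Import zify ring.

Set Implicit Arguments.
Unset Strict Implicit.
Unset Printing Implicit Defensive.

Import GRing.Theory.
Local Open Scope ring_scope.

HB.mixin Record Lmodule_isLie (k : fieldType) L of GRing.Lmodule k L := {
  lie_br : L -> L -> L;
  lie_brDZl : forall (a : k) (x y z : L),
    lie_br (a *: x + y) z = a *: lie_br x z + lie_br y z;
  lie_brDZr : forall (a : k) (x y z : L),
    lie_br z (a *: x + y) = a *: lie_br z x + lie_br z y;
  lie_brxx : forall x : L, lie_br x x = 0;
  lie_jacobi : forall x y z : L,
    lie_br x (lie_br y z) + lie_br y (lie_br z x) + lie_br z (lie_br x y) = 0
}.

#[short(type="lieType")]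
HB.structure Definition Lie (k : fieldType) :=
  {L of GRing.Lmodule k L & Lmodule_isLie k L}.

#[short(type="finLieType")]
HB.structure Definition FinLie (k : fieldType) :=
  {L of Vector k L & Lmodule_isLie k L}.

Notation "⁅ x , y ⁆" := (lie_br x y) (at level 0, format "⁅ x ,  y ⁆").

Definition lie_morphism (k : fieldType) (A B : lieType k)
    (f : {linear A -> B}) : Prop :=
  forall x y : A, f ⁅x, y⁆ = ⁅f x, f y⁆.

Section DirectSum.
Variables (k : fieldType) (A B : lieType k).
Let br (x y : A * B) : A * B := (⁅x.1, y.1⁆, ⁅x.2, y.2⁆).

Let brDZl a x y z : br (a *: x + y) z = a *: br x z + br y z.
Proof. by congr pair; rewrite /= lie_brDZl. Qed.
Let brDZr a x y z : br z (a *: x + y) = a *: br z x + br z y.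
Proof. by congr pair; rewrite /= lie_brDZr. Qed.
Let brxx x : br x x = 0.
Proof. by congr pair; rewrite /= lie_brxx. Qed.
Let jacobi x y z : br x (br y z) + br y (br z x) + br z (br x y) = 0.
Proof. by congr pair; rewrite /= lie_jacobi. Qed.

HB.instance Definition _ :=
  Lmodule_isLie.Build k (A * B)%type brDZl brDZr brxx jacobi.
End DirectSum.

HB.instance Definition _ (k : fieldType) (A B : finLieType k) :=
  Lie.on (A * B)%type.

Definition lie_dsum (k : fieldType) (A B : finLieType k) : finLieType k :=
  (A * B)%type.

Notation "A ⊕ B" := (lie_dsum A B) (at level 50, left associativity).

Definition summand1 (k : fieldType) (A B : finLieType k) : {vspace A ⊕ B} :=
  limg (linfun (fun a : A => (a, 0) : A ⊕ B)).

Lemma mem_summand1 (k : fieldType) (A B : finLieType k) (p : A ⊕ B) :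
  (p \in summand1 A B) = (p.2 == 0).
Proof.
pose f (a : A) : A ⊕ B := (a, 0).
have lf : linear f.
  by move=> c x y; rewrite /f; congr pair; rewrite /= scaler0 addr0.
pose fL := GRing.isLinear.Build _ _ _ _ f lf.
pose g : {linear A -> A ⊕ B} := HB.pack f fL.
have gE a : linfun f a = (a, 0) by exact: (lfunE g a).
apply/memv_imgP/eqP => [[a _ ->]|]; first by rewrite gE.
by case: p => a b /= ->; exists a; rewrite ?memvf ?gE.
Qed.

Section FiniteDimensional.
Variables (k : fieldType) (L : finLieType k).

Definition lie_ideal (N : {vspace L}) : Prop :=
  forall x y : L, x \in N -> ⁅x, y⁆ \in N.

Definition lie_abelian (N : {vspace L}) : Prop :=
  forall x y : L, x \in N -> y \in N -> ⁅x, y⁆ = 0.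

(* Bases suffice here by bilinearity; see [mem_brv] and [brv_sub]. *)
Definition brv (U V : {vspace L}) : {vspace L} :=
  <<[seq ⁅u, v⁆ | u <- vbasis U, v <- vbasis V]>>%VS.

Definition lower_central (c : nat) : {vspace L} :=
  iter c (fun U => brv U fullv) fullv.

Definition lie_nilpotent : Prop := exists c : nat, lower_central c = 0%VS.

Definition derived : {vspace L} := brv fullv fullv.

Lemma lie_br_suml (I : Type) (r : seq I) (a : I -> k) (f : I -> L) y :
  ⁅\sum_(i <- r) a i *: f i, y⁆ = \sum_(i <- r) a i *: ⁅f i, y⁆.
Proof.
have br0 : ⁅0, y⁆ = 0.
  by have := lie_brDZl (-1) 0 0 y; rewrite scaler0 addr0 scaleN1r addNr.
by elim: r => [|i r IH]; rewrite ?big_nil ?br0 // !big_cons lie_brDZl IH.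
Qed.

Lemma lie_br_sumr (I : Type) (r : seq I) (a : I -> k) (f : I -> L) y :
  ⁅y, \sum_(i <- r) a i *: f i⁆ = \sum_(i <- r) a i *: ⁅y, f i⁆.
Proof.
have br0 : ⁅y, 0⁆ = 0.
  by have := lie_brDZr (-1) 0 0 y; rewrite scaler0 addr0 scaleN1r addNr.
by elim: r => [|i r IH]; rewrite ?big_nil ?br0 // !big_cons lie_brDZr IH.
Qed.

Lemma mem_brv (U V : {vspace L}) x y :
  x \in U -> y \in V -> ⁅x, y⁆ \in brv U V.
Proof.
move=> /coord_vbasis-> /coord_vbasis->; rewrite lie_br_suml memv_suml // => i _.
rewrite memvZ // lie_br_sumr memv_suml // => j _; apply/memvZ/memv_span.
by apply: allpairs_f; apply: mem_nth; rewrite size_tuple.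
Qed.

Lemma brv_sub (U V W : {vspace L}) :
  (forall x y, x \in U -> y \in V -> ⁅x, y⁆ \in W) -> (brv U V <= W)%VS.
Proof.
move=> UVW; apply/span_subvP => _ /allpairsP[[u v] /= [uU vV ->]].
by apply: UVW; apply: vbasis_mem.
Qed.

End FiniteDimensional.

Definition pair_iso (k : fieldType) (L L' : finLieType k)
    (N : {vspace L}) (N' : {vspace L'}) : Prop :=
  exists f : {linear L -> L'},
    [/\ lie_morphism f, bijective f & forall x, (f x \in N') = (x \in N)].

Section Multiplier.
Variable k : fieldType.

Definition free_lie_on (F : lieType k) (X : Type) (i : X -> F) : Prop :=
  forall (M : lieType k) (f : X -> M),
    (exists2 g : {linear F -> M}, lie_morphism g & forall x, g (i x) = f x) /\
    (forall g h : {linear F -> M}, lie_morphism g -> lie_morphism h ->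
       (forall x, g (i x) = h (i x)) -> g =1 h).

Definition free_lie (F : lieType k) : Prop :=
  exists (X : Type) (i : X -> F), free_lie_on i.

Definition free_presentation (F L : lieType k) (pi : {linear F -> L}) : Prop :=
  [/\ free_lie F, lie_morphism pi & forall y : L, exists x : F, pi x = y].

(* Subspaces of a free Lie algebra need be neither finite-dimensional nor
   decidable, so they are Prop-valued predicates. *)
Inductive lie_span (F : lieType k) (U V : F -> Prop) : F -> Prop :=
| LieSpan0 : lie_span U V 0
| LieSpanDZ a x y z : U x -> V y -> lie_span U V z ->
    lie_span U V (a *: ⁅x, y⁆ + z).

(* dim (A / B) = d, for subspaces B <= A: some d vectors of A represent a basis
   of the quotient. *)
Definition quotient_dim (V : lmodType k) (A B : V -> Prop) (d : nat) : Prop :=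
  exists v : 'I_d -> V,
    [/\ forall i, A (v i),
        forall c : 'I_d -> k, B (\sum_i c i *: v i) -> forall i, c i = 0
      & forall x, A x -> exists c : 'I_d -> k, B (x - \sum_i c i *: v i)].

Variables (F : lieType k) (L : finLieType k) (pi : {linear F -> L}).

Definition multiplier_dim (N : {vspace L}) (d : nat) : Prop :=
  let R x := pi x = 0 in
  let S x := pi x \in N in
  let T (_ : F) := True in
  quotient_dim (fun x => R x /\ lie_span S T x) (lie_span R T) d.

(* The equation defining s(N,L), m being the dimension of the complement of N. *)
Definition pair_s (N : {vspace L}) (m : nat) (s : rat) : Prop :=
  let n := \dim N in
  exists2 d : nat, multiplier_dim N d &
    d%:R = 2^-1 * (n%:R - 1) * (n%:R - 2) + 1 + (n%:R - 1) * m%:R - s.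

End Multiplier.

(* The entry (i, j, l, c) stands for the summand c *: e_l of [e_i, e_j] and, up to
   sign, of [e_j, e_i]. *)
Definition entry (k : fieldType) (d : nat) : Type := ('I_d * 'I_d * 'I_d * k)%type.

Definition table_br (k : fieldType) (d : nat) (t : seq (entry k d))
    (u v : 'rV[k]_d) : 'rV[k]_d :=
  \sum_(e <- t) let: (i, j, l, c) := e in
    (c * (u 0 i * v 0 j - u 0 j * v 0 i)) *: delta_mx 0 l.

Record lie_table (k : fieldType) (d : nat) := LieTable {
  entries : seq (entry k d);
  entries_jacobi : forall u v w : 'rV[k]_d,
    table_br entries u (table_br entries v w)
    + table_br entries v (table_br entries w u)
    + table_br entries w (table_br entries u v) = 0
}.

Definition table_lie (k : fieldType) (d : nat) (t : lie_table k d) : Type :=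
  'rV[k]_d.

Section TableLie.
Variables (k : fieldType) (d : nat) (t : lie_table k d).
Implicit Types u v w : 'rV[k]_d.
Let br := table_br (entries t).

Let brDZl a u v w : br (a *: u + v) w = a *: br u w + br v w.
Proof.
rewrite /br /table_br scaler_sumr -big_split /=; apply: eq_bigr => -[[[i j] l] c] _.
by rewrite scalerA -scalerDl !mxE; congr (_ *: _); ring.
Qed.

Let brDZr a u v w : br w (a *: u + v) = a *: br w u + br w v.
Proof.
rewrite /br /table_br scaler_sumr -big_split /=; apply: eq_bigr => -[[[i j] l] c] _.
by rewrite scalerA -scalerDl !mxE; congr (_ *: _); ring.
Qed.

Let brxx u : br u u = 0.
Proof.
rewrite /br /table_br big1 // => -[[[i j] l] c] _.
by rewrite mulrC [u 0 j * _]mulrC subrr mul0r scale0r.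
Qed.

HB.instance Definition _ := Vector.on (table_lie t).
HB.instance Definition _ := Lmodule_isLie.Build k (table_lie t)
  brDZl brDZr brxx (@entries_jacobi _ _ t).
End TableLie.

Section NamedAlgebras.
Variable k : fieldType.

Lemma abelian_jacobi d (u v w : 'rV[k]_d) (br := table_br [::]) :
  br u (br v w) + br v (br w u) + br w (br u v) = 0.
Proof. by rewrite /br /table_br !big_nil !addr0. Qed.

Definition Ab (d : nat) : finLieType k := table_lie (LieTable (@abelian_jacobi d)).

(* Position 0 is the central vector x, and position i > 0 is x_i. *)
Definition heis_entries (r : nat) : seq (entry k (2 * r).+1%N) :=
  [seq (inord (2 * i).-1%N, inord (2 * i)%N, ord0, 1%R) | i <- iota 1 r].

Lemma heis_jacobi r (u v w : 'rV[k]_(2 * r).+1%N) (br := table_br (heis_entries r)) :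
  br u (br v w) + br v (br w u) + br w (br u v) = 0.
Proof.
suff br0 a b c : br a (br b c) = 0 by rewrite !br0 !addr0.
have br_out i y z : (0 < i <= 2 * r)%N -> br y z 0 (inord i) = 0.
  case/andP=> i_gt0 ler; rewrite /br /table_br big_map summxE big1 // => j _.
  by rewrite !mxE -!val_eqE /= inordK ?ltnS // eqn0Ngt i_gt0 mulr0.
rewrite {1}/br /table_br big_map big1_seq //= => j; rewrite mem_iota add1n ltnS.
case/andP=> j_gt0 ler; rewrite !br_out ?mulr0 ?subrr ?mulr0 ?scale0r //.
  all: lia.
Qed.

Definition Heis (r : nat) : finLieType k := table_lie (LieTable (@heis_jacobi r)).

(* The basis vectors e_1, ..., e_(d+1) sit at the positions 0, ..., d. *)
Definition table (d : nat) (t : seq (nat * nat * nat * k)) : seq (entry k d.+1) :=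
  [seq let: (i, j, l, c) := e in (inord i.-1, inord j.-1, inord l.-1, c) | e <- t].

Definition L4_3_entries := table 3 [:: (1, 2, 3, 1%R); (1, 3, 4, 1%R)]%N.
Definition L5_5_entries :=
  table 4 [:: (1, 2, 3, 1%R); (1, 3, 5, 1%R); (2, 4, 5, 1%R)]%N.
Definition L5_6_entries :=
  table 4 [:: (1, 2, 3, 1%R); (1, 3, 4, 1%R); (1, 4, 5, 1%R); (2, 3, 5, 1%R)]%N.
Definition L5_7_entries :=
  table 4 [:: (1, 2, 3, 1%R); (1, 3, 4, 1%R); (1, 4, 5, 1%R)]%N.
Definition L5_8_entries := table 4 [:: (1, 2, 4, 1%R); (1, 3, 5, 1%R)]%N.
Definition L5_9_entries :=
  table 4 [:: (1, 2, 3, 1%R); (1, 3, 4, 1%R); (2, 3, 5, 1%R)]%N.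
Definition L6_10_entries :=
  table 5 [:: (1, 2, 3, 1%R); (1, 3, 6, 1%R); (4, 5, 6, 1%R)]%N.
Definition L6_22_entries (eps : k) :=
  table 5 [:: (1, 2, 5, 1%R); (3, 4, 5, 1%R); (1, 3, 6, 1%R); (2, 4, 6, eps)]%N.
Definition L37A_entries :=
  table 6 [:: (1, 2, 5, 1%R); (2, 3, 6, 1%R); (2, 4, 7, 1%R)]%N.

Let tableE d (t : seq (nat * nat * nat * k)) (u v : 'rV[k]_d.+1) m :
  all (fun e => e.1.2.-1 <= d)%N t -> (m <= d)%N ->
  table_br (table d t) u v 0 (inord m) =
  foldr (fun e a => let: (i, j, l, c) := e in
    if m == l.-1 then
      c * (u 0 (inord i.-1) * v 0 (inord j.-1)
           - u 0 (inord j.-1) * v 0 (inord i.-1)) + a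
    else a) 0 t.
Proof.
move=> + lemd; rewrite /table_br /table big_map summxE.
elim: t => [|[[[i j] l] c] t IH] /=; first by rewrite big_nil.
case/andP=> leld /IH {}IH; rewrite big_cons IH !mxE eqxx -val_eqE /= !inordK //.
by case: eqP => _; rewrite ?mulr1 // mulr0 add0r.
Qed.

Let coordP d (x : 'rV[k]_d.+1) :
  (forall m, (m <= d)%N -> x 0 (inord m) = 0) -> x = 0.
Proof. by move=> x0; apply/rowP => l; rewrite -[l]inord_val x0 ?mxE // -ltnS. Qed.

Local Ltac solve_jacobi :=
  apply: coordP; case=> [|[|[|[|[|[|[|?]]]]]]] //= _;
  rewrite 2!mxE !tableE //= ?tableE //=; ring.

Lemma L4_3_jacobi (u v w : 'rV[k]_4) (br := table_br L4_3_entries) :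
  br u (br v w) + br v (br w u) + br w (br u v) = 0.
Proof. by rewrite /br; solve_jacobi. Qed.

Lemma L5_5_jacobi (u v w : 'rV[k]_5) (br := table_br L5_5_entries) :
  br u (br v w) + br v (br w u) + br w (br u v) = 0.
Proof. by rewrite /br; solve_jacobi. Qed.

Lemma L5_6_jacobi (u v w : 'rV[k]_5) (br := table_br L5_6_entries) :
  br u (br v w) + br v (br w u) + br w (br u v) = 0.
Proof. by rewrite /br; solve_jacobi. Qed.

Lemma L5_7_jacobi (u v w : 'rV[k]_5) (br := table_br L5_7_entries) :
  br u (br v w) + br v (br w u) + br w (br u v) = 0.
Proof. by rewrite /br; solve_jacobi. Qed.

Lemma L5_8_jacobi (u v w : 'rV[k]_5) (br := table_br L5_8_entries) :
  br u (br v w) + br v (br w u) + br w (br u v) = 0.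
Proof. by rewrite /br; solve_jacobi. Qed.

Lemma L5_9_jacobi (u v w : 'rV[k]_5) (br := table_br L5_9_entries) :
  br u (br v w) + br v (br w u) + br w (br u v) = 0.
Proof. by rewrite /br; solve_jacobi. Qed.

Lemma L6_10_jacobi (u v w : 'rV[k]_6) (br := table_br L6_10_entries) :
  br u (br v w) + br v (br w u) + br w (br u v) = 0.
Proof. by rewrite /br; solve_jacobi. Qed.

Lemma L6_22_jacobi (eps : k) (u v w : 'rV[k]_6) (br := table_br (L6_22_entries eps)) :
  br u (br v w) + br v (br w u) + br w (br u v) = 0.
Proof. by rewrite /br; solve_jacobi. Qed.

Lemma L37A_jacobi (u v w : 'rV[k]_7) (br := table_br L37A_entries) :
  br u (br v w) + br v (br w u) + br w (br u v) = 0.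
Proof. by rewrite /br; solve_jacobi. Qed.

Definition L4_3 : finLieType k := table_lie (LieTable L4_3_jacobi).
Definition L5_5 : finLieType k := table_lie (LieTable L5_5_jacobi).
Definition L5_6 : finLieType k := table_lie (LieTable L5_6_jacobi).
Definition L5_7 : finLieType k := table_lie (LieTable L5_7_jacobi).
Definition L5_8 : finLieType k := table_lie (LieTable L5_8_jacobi).
Definition L5_9 : finLieType k := table_lie (LieTable L5_9_jacobi).
Definition L6_10 : finLieType k := table_lie (LieTable L6_10_jacobi).
Definition L6_22 (eps : k) : finLieType k :=
  table_lie (LieTable (@L6_22_jacobi eps)).
Definition L37A : finLieType k := table_lie (LieTable L37A_jacobi).

End NamedAlgebras.

(* Main.v *)
Require Import Defs.
From HB Require Import structures.
From mathcomp Require Import all_boot all_order all_algebra.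
From mathcomp Require Import zify ring.
From Stdlib Require Import Classical ClassicalEpsilon.

Set Implicit Arguments.
Unset Strict Implicit.
Unset Printing Implicit Defensive.

Import GRing.Theory.
Local Open Scope ring_scope.

(* Write L = A (+) B with N = A, and let n, a and m, b be the dimensions of A, A^2 and
   of B, B^2.  The dual of [S,F]/[R,F] consists of the restrictions to N x L of the
   alternating 2-cocycles of L, and ([S,F]/[R,F])/M(N,L) = [N,L] = A^2.  A cocycle of L
   consists of cocycles of A and of B and of a pairing of A/A^2 with B/B^2, so that
     dim M(N,L) + a = z(A) + (n - a)(m - b),
   where z(A) is the dimension of the space of alternating 2-cocycles of A.  Defining s(A)
   by z(A) + s(A) + n = C(n,2) + a + 2, one gets s(N,L) = s(A) + (a - 1) m + b (n - a).

   If z is central in A and in A^2, restricting a cocycle f to f(., z) yields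
   s(A) + e = s(A/z) + n - 1, where e <= n - a is the dimension of the space of the
   functionals f(., z).  Induction gives s(A) >= C(a,2), so only a <= 3 matters.  Central
   direct summands are split off, which reduces to the case Z(A) <= A^2:
   - a = 1: A is a Heisenberg algebra, and s(A) is 0 or 2;
   - a = 2, s(A) <= 5: in class two, forms wedged with the two components of the bracket
     show n <= 6, and the pencil of these components has a degenerate member; in class
     three a slice of dimension at most one forces n <= 6;
   - a = 3, s(A) = 4: A/z has a = 2 and s <= 2, hence is L_{5,8} + A(j) or L_{4,3}, and A
     is recovered from the slice dimension e. *)

(** * Dimensions of spaces of functions *)

(** The cases come from [s(A) + (a - 1) m + b (n - a) = 6] with [m >= 1]: for [a >= 4] the left side
    is at least [6 + 3]; [a = 3] leaves only [b = 0], [m = 1], [s(A) = 4]; [a = 2] leaves [b = 0]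
    and [s(A) + m = 6]; [a = 1] leaves [b (n - 1)] equal to 6 or 4. The obstacle in the formula for
    the multiplier is that [F] and its ideals are infinite-dimensional. No dual space is formed:
    lifting [pi] to the central extension of a cocycle [f] gives a functional on [F] with value
    [f (pi x, pi y)] at [[x, y]], and finitely many such functionals separate [[S, F]] modulo
    [[R, F]]. The slices work because the cocycle identity, evaluated at suitable elements, is a
    linear relation between values [f (., z)] whose coefficients are structure constants of [A]. A
    small [s] means a large slice, which admits few relations and so forces these constants to
    vanish. Algebraic closure supplies an eigenvalue in the pencil of forms. Division by 2 is used
    to recognise the sum of two copies of [H(1)] as [L_{6,22}(1)]; the classification produces only
    the parameters 0 and 1. *)

Lemma linear_ex (k : fieldType) (A B : lmodType k) (f : A -> B) :
  linear f -> exists g : {linear A -> B}, g =1 f.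
Proof.
move=> lf; pose fL := GRing.isLinear.Build _ _ _ _ f lf.
by pose g : {linear A -> B} := HB.pack f fL; exists g.
Qed.

(** Classically, a subspace contained in [P] that cannot be enlarged inside [P] is all of [P]; the
    induction is on a bound [e] for the codimension still available. *)
Lemma vspace_of_prop (k : fieldType) (V : vectType k) (P : V -> Prop) :
  P 0 -> (forall a x y, P x -> P y -> P (a *: x + y)) ->
  exists U : {vspace V}, forall v, v \in U <-> P v.
Proof.
move=> P0 PD.
pose good d := exists2 U : {vspace V}, (forall v, v \in U -> P v) & \dim U = d.
have good0 : good 0%N by exists 0%VS; rewrite ?dimv0 // => v; rewrite memv0 => /eqP ->.
suff: forall e d, (\dim {:V} - d <= e)%N -> good d ->
   exists U : {vspace V}, forall v, v \in U <-> P v by move=> /(_ _ 0%N (leqnn _)); apply.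
elim=> [|e IH] d led [U UP dU].
- exists U => v; split; first exact: UP.
  suff -> : U = fullv by rewrite memvf.
  by apply/eqP; rewrite eqEdim subvf /= dU -subn_eq0 -leqn0.
- case: (classic (exists2 v, P v & v \notin U)) => [[v Pv vU]|H]; last first.
    exists U => v; split=> [|Pv]; first exact: UP.
    by apply: contra_notT H => vU; exists v.
  apply: (IH (d + 1)%N); first lia.
  exists (<[v]> + U)%VS => [x /memv_addP[_ /vlineP[a ->] [u uU ->]]|].
    by apply: PD => //; apply: UP.
  rewrite dimv_disjoint_sum ?dim_vline ?dU; last first.
    apply/eqP; rewrite -subv0; apply/subvP => x /memv_capP[/vlineP[a ->]].
    have [->|a0] := eqVneq a 0; first by rewrite scale0r => _; apply: mem0v.
    by move/(memvZ a^-1); rewrite scalerA mulVf // scale1r (negPf vU).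
  by case: eqP vU => [->|_]; rewrite ?mem0v // addnC.
Qed.

(** [V / U] is modelled by the coordinates of the projection onto a complement of [U]. *)
Lemma quotient_coord (k : fieldType) (V : vectType k) (U : {vspace V}) d :
  (d + \dim U = \dim {:V})%N ->
  exists p : {linear V -> 'rV[k]_d},
    (forall v, (p v == 0) = (v \in U)) /\ (forall r, exists v, p v = r).
Proof.
move=> dU; have -> : d = \dim U^C by rewrite dimv_compl -dU addnK.
have X_free := basis_free (vbasisP U^C).
have UC : (U^C :&: U = 0)%VS by rewrite capvC capv_compl.
pose q := daddv_pi U^C U; pose p v := \row_i coord (vbasis U^C) i (q v).
have [|g gE] := @linear_ex _ _ _ p.
  by move=> a x y; apply/rowP => i; rewrite !mxE !linearP.
have qE v : v = q v + daddv_pi U U^C v.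
  by rewrite daddv_pi_add // addvC addv_complf memvf.
exists g; split=> [v|r]; rewrite ?gE.
- apply/eqP/idP => [p0|vU].
    rewrite (qE v) memvD ?memv_pi // (coord_vbasis (memv_pi _ _ v : q v \in U^C)%VS).
    by rewrite big1 ?mem0v // => i _; move/rowP/(_ i): p0; rewrite !mxE => ->; rewrite scale0r.
  have q0 : q v = 0.
    by apply: (addIr (daddv_pi U U^C v)); rewrite -qE add0r daddv_pi_id // capv_compl.
  by apply/rowP => i; rewrite !mxE q0 linear0.
- exists (\sum_i r 0 i *: (vbasis U^C)`_i); rewrite gE; apply/rowP => i; rewrite mxE.
  rewrite /q daddv_pi_id ?coord_sum_free // memv_suml // => j _.
  by rewrite memvZ // vbasis_mem // mem_nth // size_tuple.
Qed.

Lemma functional_separates (k : fieldType) (V : vectType k) (U : {vspace V}) v :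
  v \notin U -> exists2 g : {scalar V}, forall u, u \in U -> g u = 0 & g v != 0.
Proof.
move=> vU; have [|p [pU _]] := @quotient_coord _ _ U (\dim {:V} - \dim U).
  by rewrite subnK // dimvS // subvf.
have [i pi0] : exists i, p v 0 i != 0.
  apply/existsP; apply: contraNT vU => /existsPn p0; rewrite -pU.
  by apply/eqP/rowP => i; rewrite mxE; apply/eqP; move: (p0 i); rewrite negbK.
have [|g gE] := @linear_ex _ _ k^o (fun x => p x 0 i).
  by move=> a x y; rewrite linearP !mxE.
by exists g => [u|]; rewrite gE // -pU => /eqP ->; rewrite mxE.
Qed.

(** Slices [fun x => f (x, z)] of a form are bare functions, so linearity is stated as a property
    instead of being carried by a structure. *)
Definition flin (k : fieldType) (V : lmodType k) (g : V -> k) : Prop :=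
  forall a x y, g (a *: x + y) = a * g x + g y.

Lemma flin0 (k : fieldType) (L : lmodType k) (g : L -> k) : flin g -> g 0 = 0.
Proof. by move=> lg; have := lg (-1) 0 0; rewrite scaler0 addr0 mulN1r addNr. Qed.
Lemma flinZ (k : fieldType) (L : lmodType k) (g : L -> k) : flin g -> forall a x, g (a *: x) = a * g x.
Proof. by move=> lg a x; have := lg a x 0; rewrite !addr0 flin0 // addr0. Qed.
Lemma flinD (k : fieldType) (L : lmodType k) (g : L -> k) : flin g -> {morph g : x y / x + y}.
Proof. by move=> lg x y; have := lg 1 x y; rewrite scale1r mul1r. Qed.
Lemma flinN (k : fieldType) (L : lmodType k) (g : L -> k) : flin g -> {morph g : x / - x}.
Proof. by move=> lg x; rewrite -scaleN1r flinZ // mulN1r. Qed.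

Section FunctionDimension.
Variables (k : fieldType).

(** Linear relations are tested pointwise, so that neither finite-dimensionality of [T -> k] nor
    functional extensionality enters. *)
Definition fdim (T : Type) (P : (T -> k) -> Prop) (d : nat) : Prop :=
  exists v : 'I_d -> T -> k,
    [/\ forall i, P (v i),
        forall c : 'I_d -> k, (forall t, \sum_i c i * v i t = 0) -> forall i, c i = 0
      & forall f, P f -> exists c : 'I_d -> k, forall t, f t = \sum_i c i * v i t].

Definition fun_closed (T : Type) (P : (T -> k) -> Prop) : Prop :=
  [/\ forall f g, f =1 g -> P f -> P g, P (fun=> 0)
    & forall a f g, P f -> P g -> P (fun t => a * f t + g t)].

Lemma fclosed_sum (T : Type) (P : (T -> k) -> Prop) d (c : 'I_d -> k) (v : 'I_d -> T -> k) :
  fun_closed P -> (forall i, P (v i)) -> P (fun t => \sum_i c i * v i t).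
Proof.
case=> Pe P0 PD Pv; apply: (Pe (fun t => \sum_(i <- index_enum 'I_d) c i * v i t)) => //.
elim: (index_enum _) => [|i r IH]; first by apply: Pe P0 => t; rewrite big_nil.
by apply: Pe (PD (c i) _ _ (Pv i) IH) => t; rewrite big_cons.
Qed.

Lemma fdim_mono (T : Type) (P Q : (T -> k) -> Prop) d e :
  (forall f, P f -> Q f) -> fdim P d -> fdim Q e -> (d <= e)%N.
Proof.
move=> PQ [v [Pv vi _]] [w [_ _ ws]].
have [M ME] := fin_all_exists (fun i => ws _ (PQ _ (Pv i))).
pose A := \matrix_(i, j) M i j.
have : row_free A.
  apply: inj_row_free => u uA; apply/rowP => i; rewrite mxE; apply: vi i => t.
  under eq_bigr => i _ do rewrite ME mulr_sumr.
  rewrite exchange_big big1 // => j _.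
  move/rowP/(_ j): uA; rewrite !mxE => uA.
  under eq_bigr => i _ do rewrite mulrA.
  rewrite -mulr_suml [X in X * _](_ : _ = 0) ?mul0r // -[RHS]uA.
  by apply: eq_bigr => i _; rewrite mxE.
by rewrite /row_free => /eqP <-; apply: rank_leq_col.
Qed.

Lemma fdim_unique (T : Type) (P : (T -> k) -> Prop) d e : fdim P d -> fdim P e -> d = e.
Proof. by move=> Pd Pe; apply/eqP; rewrite eqn_leq !(fdim_mono _ Pd Pe, fdim_mono _ Pe Pd). Qed.

Lemma fdim_ext (T : Type) (P Q : (T -> k) -> Prop) d :
  (forall f, P f <-> Q f) -> fdim P d -> fdim Q d.
Proof.
by move=> PQ [v [Pv vi vs]]; exists v; split=> // [i|f /PQ/vs //]; apply/PQ.
Qed.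

(** The evaluations at [t] form a [d] by [r] matrix, which has a nonzero left kernel as soon as
    [r < d]. *)
Lemma fdim_vanish (T : Type) (P : (T -> k) -> Prop) d r (t : 'I_r -> T) :
  fun_closed P -> fdim P d -> (r < d)%N ->
  exists f, [/\ P f, exists x, f x != 0 & forall i, f (t i) = 0].
Proof.
move=> Pcl [v [Pv vi _]] rd; pose A := \matrix_(i < d, j < r) v i (t j).
have : kermx A != 0.
  rewrite kermx_eq0 /row_free neq_ltn; apply/orP; left.
  exact: leq_ltn_trans (rank_leq_col A) rd.
case/rowV0Pn=> c /sub_kermxP cA c0.
exists (fun x => \sum_i c 0 i * v i x); split; first exact: fclosed_sum.
  apply: NNPP => H; case/negP: c0; apply/eqP/rowP => i; rewrite mxE; apply: vi => x.
  by apply: NNPP => /eqP nz; apply: H; exists x.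
move=> j; move/rowP/(_ j): cA; rewrite !mxE => cA; rewrite -[RHS]cA.
by apply: eq_bigr => i _; rewrite mxE.
Qed.

Lemma fdim_le_points (T : Type) (P : (T -> k) -> Prop) d r (t : 'I_r -> T) :
  fun_closed P -> fdim P d ->
  (forall f, P f -> (forall i, f (t i) = 0) -> forall x, f x = 0) -> (d <= r)%N.
Proof.
move=> Pcl Pd inj; rewrite leqNgt; apply/negP => /(fdim_vanish t Pcl Pd)[f [Pf [x fx] f0]].
by rewrite (inj _ Pf f0) eqxx in fx.
Qed.

(** The functions dual to the points [t] form the basis; injectivity of the evaluation shows that
    they span. *)
Lemma fdim_points (T : Type) (P : (T -> k) -> Prop) r (t : 'I_r -> T) :
  fun_closed P ->
  (forall f, P f -> (forall i, f (t i) = 0) -> forall x, f x = 0) ->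
  (forall c : 'I_r -> k, exists2 f, P f & forall i, f (t i) = c i) -> fdim P r.
Proof.
move=> Pcl inj sur; have /fin_all_exists2[v Pv vE] := fun j => sur (fun i => (i == j)%:R).
have vsum (c : 'I_r -> k) i : \sum_j c j * v j (t i) = c i.
  rewrite (bigD1 i) //= vE eqxx mulr1 big1 ?addr0 // => j /negPf ij.
  by rewrite vE eq_sym ij mulr0.
exists v; split=> // [c c0 i|f Pf]; first by rewrite -vsum c0.
exists (fun i => f (t i)) => x; apply/eqP; rewrite -subr_eq0; apply/eqP.
case: (Pcl) => Pe P0 PD.
have /inj f0 : P (fun x => (-1) * (\sum_i f (t i) * v i x) + f x).
  by apply: PD => //; apply: fclosed_sum.
by rewrite addrC -mulN1r f0 // => i; rewrite vsum mulN1r addNr.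
Qed.

(** Rank and nullity for the restriction of functions along [i]: a basis of the kernel together with
    lifts of a basis of the image. *)
Lemma fdim_exact (S T : Type) (P : (T -> k) -> Prop) (i : S -> T) d0 d1 :
  fun_closed P ->
  fdim (fun f => P f /\ forall s, f (i s) = 0) d0 ->
  fdim (fun g => exists2 f, P f & forall s, g s = f (i s)) d1 -> fdim P (d0 + d1).
Proof.
move=> Pcl [v [Pv vi vs]] [w [Pw wi ws]].
have [u Pu uE] := fin_all_exists2 Pw.
exists (fun j => match split j with inl a => v a | inr b => u b end).
have splitE (c : 'I_(d0 + d1) -> k) t : \sum_j c j * match split j with
   inl a => v a | inr b => u b end t = \sum_a c (lshift _ a) * v a t + \sum_b c (rshift _ b) * u b t.
  rewrite big_split_ord; congr (_ + _); apply: eq_bigr => j _.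
    by rewrite (unsplitK (inl j : 'I_d0 + 'I_d1)).
  by rewrite (unsplitK (inr j : 'I_d0 + 'I_d1)).
split=> [j|c|f Pf].
- by case: split => [a|b]; [case: (Pv a)|].
- move=> c0.
  have cr b : c (rshift d0 b) = 0.
    apply: (wi (fun b => c (rshift d0 b))) => s; rewrite -[RHS](c0 (i s)) splitE.
    rewrite [X in X + _]big1 ?add0r => [|a _]; first by apply: eq_bigr => j _; rewrite uE.
    by case: (Pv a) => _ ->; rewrite mulr0.
  have cl a : c (lshift d1 a) = 0.
    apply: (vi (fun a => c (lshift d1 a))) => t; rewrite -[RHS](c0 t) splitE.
    by rewrite [X in _ + X]big1 ?addr0 // => b _; rewrite cr mul0r.
  by move=> j; rewrite -(splitK j); case: (split j).
- case: (Pcl) => Pe P0 PD.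
  have [|cb cbE] := ws (fun s => f (i s)); first by exists f.
  have Pf' : P (fun t => (-1) * (\sum_b cb b * u b t) + f t).
    by apply: PD => //; apply: fclosed_sum.
  have [|ca caE] := vs _ (conj Pf' _).
    by move=> s; rewrite cbE mulN1r; under eq_bigr => b _ do rewrite -uE; rewrite addNr.
  exists (fun j => match split j with inl a => ca a | inr b => cb b end) => t.
  have -> : f t = \sum_a ca a * v a t + \sum_b cb b * u b t by rewrite -caE mulN1r addrAC addNr add0r.
  rewrite splitE; congr (_ + _); apply: eq_bigr => j _.
    by rewrite (unsplitK (inl j : 'I_d0 + 'I_d1)).
  by rewrite (unsplitK (inr j : 'I_d0 + 'I_d1)).
Qed.

Lemma fdim_pull (S T : Type) (P : (T -> k) -> Prop) (Q : (S -> k) -> Prop) (p : T -> S) d :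
  (forall s, exists t, p t = s) ->
  (forall g, Q g -> P (fun t => g (p t))) ->
  (forall f, P f -> exists2 g, Q g & forall t, f t = g (p t)) ->
  fdim Q d -> fdim P d.
Proof.
move=> ps QP PQ [v [Qv vi vs]]; exists (fun i t => v i (p t)); split=> [i|c c0|f Pf].
- exact: QP.
- by apply: vi => s; have [t <-] := ps s.
- by have [g /vs[c cE] fE] := PQ _ Pf; exists c => t; rewrite fE cE.
Qed.

(** Evaluation at the points [t] embeds the space into [k^r], and a basis of the image is pulled
    back. *)
Lemma fdim_ex (T : Type) (P : (T -> k) -> Prop) r (t : 'I_r -> T) :
  fun_closed P ->
  (forall f, P f -> (forall i, f (t i) = 0) -> forall x, f x = 0) -> exists d, fdim P d.
Proof.
move=> Pcl inj; case: (Pcl) => Pe P0 PD.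
have [||U UE] := @vspace_of_prop k 'rV[k]_r (fun c => exists2 f, P f & forall i, f (t i) = c 0 i).
- by exists (fun=> 0) => // i; rewrite mxE.
- move=> a x y [f Pf fE] [g Pg gE]; exists (fun u => a * f u + g u); first exact: PD.
  by move=> i; rewrite fE gE !mxE.
have X_free := basis_free (vbasisP U); pose X := vbasis U.
have XU (i : 'I_(\dim U)) : exists2 f, P f & forall j, f (t j) = X`_i 0 j.
  by apply/UE; rewrite vbasis_mem // mem_nth // size_tuple.
have [v Pv vE] := fin_all_exists2 XU.
have vsum c j : \sum_i c i * v i (t j) = (\sum_i c i *: X`_i) 0 j.
  by rewrite summxE; apply: eq_bigr => i _; rewrite vE !mxE.
exists (\dim U), v; split=> // [c c0|f Pf].
- have : \sum_i c i *: X`_i = 0 by apply/rowP => j; rewrite -vsum c0 mxE.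
  by move/freeP: X_free; apply.
- have /coord_vbasis fU : \row_j f (t j) \in U by apply/UE; exists f => // j; rewrite mxE.
  exists (fun i => coord X i (\row_j f (t j))) => x.
  have /inj f0 : P (fun x => (-1) * (\sum_i coord X i (\row_j f (t j)) * v i x) + f x).
    by apply: PD => //; apply: fclosed_sum.
  apply/eqP; rewrite -subr_eq0 addrC -mulN1r f0 // => i.
  by rewrite vsum -fU mxE mulN1r addNr.
Qed.

Lemma fdim_functionals (V : vectType k) (W : {vspace V}) d :
  (d + \dim W = \dim {:V})%N -> fdim (fun g => flin g /\ forall x, x \in W -> g x = 0) d.
Proof.
move=> dW; have [p [pW ps]] := quotient_coord dW.
have /fin_all_exists[s sE] := fun j => ps (delta_mx 0 j).
exists (fun i x => p x 0 i); split=> [i|c c0 j|f [lf fW]].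
- split=> [a x y|x]; first by rewrite linearP !mxE.
  by rewrite -pW => /eqP ->; rewrite mxE.
- rewrite -[RHS](c0 (s j)) sE (bigD1 j) //= mxE !eqxx mulr1 big1 ?addr0 // => i /negPf ij.
  by rewrite mxE ij mulr0.
- exists (fun i => f (s i)) => x.
  have f0 := flin0 lf.
  have fsum n (c : 'I_n -> k) (u : 'I_n -> V) : f (\sum_i c i *: u i) = \sum_i c i * f (u i).
    elim/big_rec2: _ => // i a b _ <-; exact: lf.
  under eq_bigr => i _ do rewrite mulrC.
  rewrite -fsum; apply/eqP; rewrite -subr_eq0 -mulN1r addrC -lf; apply/eqP/fW.
  rewrite -pW linearP linear_sum /= scaleN1r.
  have {2}-> : p x = \sum_i p (p x 0 i *: s i); last by rewrite addNr.
  rewrite {1}(row_sum_delta (p x)); apply: eq_bigr => i _.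
  by rewrite linearZ /= sE.
Qed.

End FunctionDimension.

(** * Brackets, quotients and cocycles *)

Section Bracket.
Variables (k : fieldType) (L : lieType k).
Implicit Types x y z : L.

Lemma lie_brDl x y z : ⁅x + y, z⁆ = ⁅x, z⁆ + ⁅y, z⁆.
Proof. by have := lie_brDZl 1 x y z; rewrite !scale1r. Qed.
Lemma lie_brDr x y z : ⁅z, x + y⁆ = ⁅z, x⁆ + ⁅z, y⁆.
Proof. by have := lie_brDZr 1 x y z; rewrite !scale1r. Qed.
Lemma lie_br0l z : ⁅0, z⁆ = 0 :> L.
Proof. by apply: (addrI ⁅0, z⁆); rewrite -lie_brDl !addr0. Qed.
Lemma lie_br0r z : ⁅z, 0⁆ = 0 :> L.
Proof. by apply: (addrI ⁅z, 0⁆); rewrite -lie_brDr !addr0. Qed.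
Lemma lie_brZl a x z : ⁅a *: x, z⁆ = a *: ⁅x, z⁆.
Proof. by rewrite -[a *: x]addr0 lie_brDZl lie_br0l addr0. Qed.
Lemma lie_brZr a x z : ⁅z, a *: x⁆ = a *: ⁅z, x⁆.
Proof. by rewrite -[a *: x]addr0 lie_brDZr lie_br0r addr0. Qed.
Lemma lie_brNl x z : ⁅- x, z⁆ = - ⁅x, z⁆.
Proof. by rewrite -scaleN1r lie_brZl scaleN1r. Qed.
Lemma lie_brNr x z : ⁅z, - x⁆ = - ⁅z, x⁆.
Proof. by rewrite -scaleN1r lie_brZr scaleN1r. Qed.
Lemma lie_brC x y : ⁅x, y⁆ = - ⁅y, x⁆.
Proof.
have := lie_brxx (x + y); rewrite lie_brDl !lie_brDr !lie_brxx addr0 add0r => /eqP.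
by rewrite addr_eq0 => /eqP.
Qed.

Lemma lie_br_lcomb_l (I : Type) (r : seq I) (a : I -> k) (f : I -> L) y :
  ⁅\sum_(i <- r) a i *: f i, y⁆ = \sum_(i <- r) a i *: ⁅f i, y⁆.
Proof. by elim: r => [|i r IH]; rewrite ?big_nil ?lie_br0l // !big_cons lie_brDZl IH. Qed.
Lemma lie_br_lcomb_r (I : Type) (r : seq I) (a : I -> k) (f : I -> L) y :
  ⁅y, \sum_(i <- r) a i *: f i⁆ = \sum_(i <- r) a i *: ⁅y, f i⁆.
Proof. by elim: r => [|i r IH]; rewrite ?big_nil ?lie_br0r // !big_cons lie_brDZr IH. Qed.

Definition lie_central z : Prop := forall x, ⁅z, x⁆ = 0.
Lemma lie_centralr z : lie_central z -> forall x, ⁅x, z⁆ = 0.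
Proof. by move=> zc x; rewrite lie_brC zc oppr0. Qed.
End Bracket.

Definition lie_iso (k : fieldType) (A B : finLieType k) : Prop :=
  exists2 f : {linear A -> B}, lie_morphism f & bijective f.

Lemma lie_morphism_inv (k : fieldType) (A B : finLieType k) (f : {linear A -> B}) :
  lie_morphism f -> bijective f ->
  exists g : {linear B -> A}, [/\ lie_morphism g, cancel f g & cancel g f].
Proof.
move=> fm [h fK hK].
have [|g gE] := @linear_ex _ _ _ h.
  by move=> a x y; apply: (can_inj fK); rewrite linearP !hK.
exists g; split=> [x y|x|x]; rewrite ?gE ?fK ?hK //.
by apply: (can_inj fK); rewrite fm !hK.
Qed.

Lemma lie_iso_sym (k : fieldType) (A B : finLieType k) : lie_iso A B -> lie_iso B A.
Proof.
case=> f fm fb; have [g [gm fK gK]] := lie_morphism_inv fm fb.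
by exists g => //; exists f.
Qed.

Lemma lie_iso_trans (k : fieldType) (A B C : finLieType k) :
  lie_iso A B -> lie_iso B C -> lie_iso A C.
Proof.
case=> f fm fb [g gm gb].
by exists (g \o f : {linear A -> C}); [move=> x y /=; rewrite fm gm | apply: bij_comp].
Qed.

Lemma lie_subalgebra (k : fieldType) (L : finLieType k) (N : {vspace L}) :
  (forall x y, x \in N -> y \in N -> ⁅x, y⁆ \in N) ->
  exists (A : finLieType k) (i : {linear A -> L}),
    [/\ lie_morphism i, injective i & forall x, x \in N <-> exists a, i a = x].
Proof.
move=> idN.
pose br (x y : subvs_of N) : subvs_of N := vsproj N ⁅vsval x, vsval y⁆.
have brE x y : vsval (br x y) = ⁅vsval x, vsval y⁆.
  by rewrite vsprojK // idN // subvsP.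
have brDZl a x y z : br (a *: x + y) z = a *: br x z + br y z.
  by apply: subvs_inj; rewrite linearP /= !brE linearP lie_brDZl.
have brDZr a x y z : br z (a *: x + y) = a *: br z x + br z y.
  by apply: subvs_inj; rewrite linearP /= !brE linearP lie_brDZr.
have brxx x : br x x = 0 by apply: subvs_inj; rewrite brE lie_brxx.
have jac x y z : br x (br y z) + br y (br z x) + br z (br x y) = 0.
  by apply: subvs_inj; rewrite !linearD /= !brE lie_jacobi.
pose m := Lmodule_isLie.Build k (subvs_of N) brDZl brDZr brxx jac.
pose A : finLieType k := HB.pack (subvs_of N) m.
have [|i iE] := @linear_ex _ A L (@vsval _ _ N); first exact: linearP.
exists A, i; split=> [x y|x y|x]; first by rewrite !iE brE.
  by rewrite !iE; apply: subvs_inj.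
split=> [xN|[a <-]]; last by rewrite iE subvsP.
by exists (vsproj N x : A); rewrite iE vsprojK.
Qed.

(** The carrier is a complement of [I], with the bracket followed by the projection along [I];
    finite-dimensionality is thus immediate. *)
Lemma lie_quotient (k : fieldType) (L : finLieType k) (I : {vspace L}) :
  lie_ideal I ->
  exists (Q : finLieType k) (p : {linear L -> Q}),
    [/\ lie_morphism p, forall y, exists x, p x = y & forall x, p x = 0 <-> x \in I].
Proof.
move=> idI; pose C := (I^C)%VS.
have CI : (C :&: I = 0)%VS by rewrite capvC capv_compl.
have CIf v : v = daddv_pi C I v + daddv_pi I C v.
  by rewrite daddv_pi_add // addvC addv_complf memvf.
pose p v : subvs_of C := vsproj C (daddv_pi C I v).
have pE v : vsval (p v) = daddv_pi C I v by rewrite vsprojK // memv_pi.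
have pK x : p (vsval x) = x.
  by apply: subvs_inj; rewrite pE daddv_pi_id ?subvsP.
have p_lin : linear p by move=> a x y; apply: subvs_inj; rewrite linearP /= !pE linearP.
have p_ker x : p x = 0 <-> x \in I.
  split=> [/(congr1 vsval)|xI].
    by rewrite pE linear0 => px; rewrite (CIf x) px add0r memv_pi.
  apply: subvs_inj; rewrite pE linear0; apply: (addIr (daddv_pi I C x)).
  by rewrite -CIf add0r daddv_pi_id // capv_compl.
have p_diff v : v - vsval (p v) \in I.
  by rewrite pE {1}(CIf v) addrAC subrr add0r memv_pi.
have [pL pLE] := linear_ex p_lin.
have p_eq u v : u - v \in I -> p u = p v.
  by move/p_ker; rewrite -!pLE linearB => /eqP; rewrite subr_eq0 => /eqP.
pose br (x y : subvs_of C) : subvs_of C := p ⁅vsval x, vsval y⁆.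
have p_br u v : p ⁅u, v⁆ = br (p u) (p v).
  apply: p_eq; rewrite -[X in X - _](subrK ⁅vsval (p u), v⁆) -addrA.
  rewrite -lie_brNl -lie_brDl -lie_brNr -lie_brDr; apply: memvD; first exact/idI/p_diff.
  by rewrite lie_brC memvN; apply/idI/p_diff.
have brDZl a x y z : br (a *: x + y) z = a *: br x z + br y z.
  by rewrite /br linearP lie_brDZl -!pLE linearP.
have brDZr a x y z : br z (a *: x + y) = a *: br z x + br z y.
  by rewrite /br linearP lie_brDZr -!pLE linearP.
have brxx x : br x x = 0 by rewrite /br lie_brxx -pLE linear0.
have jac x y z : br x (br y z) + br y (br z x) + br z (br x y) = 0.
  rewrite -(pK x) -(pK y) -(pK z) -!p_br -!pLE -!linearD /= lie_jacobi.
  by rewrite linear0.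
pose m := Lmodule_isLie.Build k (subvs_of C) brDZl brDZr brxx jac.
pose Q : finLieType k := HB.pack (subvs_of C) m.
have [i iE] := @linear_ex _ L Q p p_lin.
exists Q, i; split=> [x y|y|x]; rewrite ?iE; [exact: p_br| by exists (vsval y); rewrite iE pK|].
exact: p_ker.
Qed.

(** Alternating 2-cocycles with trivial coefficients, uncurried so that [fdim] applies to them. *)
Record lie_cocycle (k : fieldType) (L : lieType k) (f : L * L -> k) : Prop := Cocycle {
  cocycle_linl : forall z, flin (fun x => f (x, z));
  cocycle_linr : forall z, flin (fun x => f (z, x));
  cocycle_alt : forall x, f (x, x) = 0;
  cocycle_jacobi : forall x y z, f (⁅x, y⁆, z) + f (⁅y, z⁆, x) + f (⁅z, x⁆, y) = 0
}.

Section Cocycle.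
Variables (k : fieldType) (L : lieType k).
Implicit Types (f : L * L -> k) (x y z : L).

Variables (f : L * L -> k) (cf : lie_cocycle f).

Lemma cocycleDl x y z : f (x + y, z) = f (x, z) + f (y, z).
Proof. exact: (flinD (cocycle_linl cf z)). Qed.
Lemma cocycleDr x y z : f (z, x + y) = f (z, x) + f (z, y).
Proof. exact: (flinD (cocycle_linr cf z)). Qed.
Lemma cocycleZl a x z : f (a *: x, z) = a * f (x, z).
Proof. exact: (flinZ (cocycle_linl cf z)). Qed.
Lemma cocycle0l z : f (0, z) = 0.
Proof. exact: (flin0 (cocycle_linl cf z)). Qed.
Lemma cocycle0r z : f (z, 0) = 0.
Proof. exact: (flin0 (cocycle_linr cf z)). Qed.
Lemma cocycleNl x z : f (- x, z) = - f (x, z).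
Proof. exact: (flinN (cocycle_linl cf z)). Qed.
Lemma cocycleC x y : f (x, y) = - f (y, x).
Proof.
have := cocycle_alt cf (x + y).
rewrite cocycleDl !cocycleDr !(cocycle_alt cf) addr0 add0r => /eqP.
by rewrite addr_eq0 => /eqP.
Qed.

(** Two of the three terms of the cocycle identity contain a bracket with [z]. Hence slices at
    central elements factor through [L / L^2]. *)
Lemma cocycle_br_central x y z : lie_central z -> f (⁅x, y⁆, z) = 0.
Proof.
move=> zc; have := cocycle_jacobi cf x y z.
by rewrite (lie_centralr zc) zc !cocycle0l !addr0.
Qed.
End Cocycle.

(** The extension is [L * k] with [f] as second component of the bracket; its Jacobi identity is the
    cocycle identity of [f] up to sign. *)
Lemma central_extension (k : fieldType) (L : lieType k) (f : L * L -> k) :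
  lie_cocycle f ->
  exists (E : lieType k) (q : {linear E -> L}) (h : {scalar E}),
    [/\ lie_morphism q, forall u v, h ⁅u, v⁆ = f (q u, q v)
      & forall x a, exists u, q u = x /\ h u = a].
Proof.
move=> cf; pose br (u v : L * k^o) : L * k^o := (⁅u.1, v.1⁆, f (u.1, v.1)).
have brDZl a x y z : br (a *: x + y) z = a *: br x z + br y z.
  by congr pair; rewrite /= ?lie_brDZl ?(cocycle_linl cf).
have brDZr a x y z : br z (a *: x + y) = a *: br z x + br z y.
  by congr pair; rewrite /= ?lie_brDZr ?(cocycle_linr cf).
have brxx x : br x x = 0 by congr pair; rewrite /= ?lie_brxx ?(cocycle_alt cf).
have jac x y z : br x (br y z) + br y (br z x) + br z (br x y) = 0.
  congr pair; rewrite /= ?lie_jacobi //.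
  rewrite (cocycleC cf x.1) (cocycleC cf y.1) (cocycleC cf z.1).
  have -> : 0 = - (0 : k) by rewrite oppr0.
  rewrite -(cocycle_jacobi cf x.1 y.1 z.1) !opprD.
  by rewrite addrC addrA.
pose m := Lmodule_isLie.Build k (L * k^o)%type brDZl brDZr brxx jac.
pose E : lieType k := HB.pack (L * k^o)%type m.
have [|q qE] := @linear_ex _ E L fst; first by [].
have [|h hE] := @linear_ex _ E k^o snd; first by [].
exists E, q, h; split=> [u v|u v|x a]; rewrite ?qE ?hE //.
by exists (x, a : k^o); rewrite qE hE.
Qed.

Section LinearDimension.
Variables (k : fieldType) (A B : vectType k) (f : {linear A -> B}).

Lemma dim_surj (I : {vspace A}) :
  (forall y, exists x, f x = y) -> (forall x, f x = 0 <-> x \in I) ->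
  (\dim {:B} + \dim I = \dim {:A})%N.
Proof.
move=> fs fI; rewrite -(limg_ker_dim (linfun f) fullv) capfv.
have -> : lker (linfun f) = I.
  by apply/vspaceP => x; rewrite memv_ker lfunE; apply/eqP/idP => /fI.
rewrite addnC; congr (_ + \dim _)%N; apply/vspaceP => y; rewrite memvf; apply/esym/memv_imgP.
by have [x <-] := fs y; exists x; rewrite ?memvf ?lfunE.
Qed.

Lemma dim_inj_img (N : {vspace B}) :
  injective f -> (forall y, y \in N <-> exists x, f x = y) -> \dim N = \dim {:A}.
Proof.
move=> fi fN; rewrite -(limg_ker_dim (linfun f) fullv) capfv.
have -> : lker (linfun f) = 0%VS.
  apply/vspaceP => x; rewrite memv_ker lfunE memv0.
  by apply/eqP/eqP => [|->]; rewrite ?linear0 // => fx; apply: fi; rewrite fx linear0.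
rewrite dimv0; congr (\dim _); apply/vspaceP => y; apply/idP/memv_imgP.
  by case/fN=> x <-; exists x; rewrite ?memvf ?lfunE.
by case=> x _ ->; apply/fN; exists x; rewrite lfunE.
Qed.

Lemma dim_bij : bijective f -> \dim {:A} = \dim {:B}.
Proof.
case=> g fK gK; rewrite -(dim_inj_img (can_inj fK) (N := fullv)) // => y.
by rewrite memvf; split=> // _; exists (g y).
Qed.
End LinearDimension.

Section Derived.
Variables (k : fieldType).

Lemma mem_derived (L : finLieType k) (x y : L) : ⁅x, y⁆ \in derived L.
Proof. by rewrite mem_brv ?memvf. Qed.

Lemma derived_sub (L : finLieType k) (W : {vspace L}) :
  (forall x y, ⁅x, y⁆ \in W) -> (derived L <= W)%VS.
Proof. by move=> LW; apply: brv_sub => x y _ _; apply: LW. Qed.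

Lemma derived_morph (L M : finLieType k) (f : {linear L -> M}) :
  lie_morphism f -> forall x, x \in derived L -> f x \in derived M.
Proof.
move=> fm x xL; rewrite -(lfunE f) memv_preim; apply: subvP xL.
by apply: derived_sub => u v; rewrite -memv_preim lfunE fm mem_derived.
Qed.

Lemma derived_surj (L M : finLieType k) (f : {linear L -> M}) :
  lie_morphism f -> (forall y, exists x, f x = y) ->
  (linfun f @: derived L)%VS = derived M.
Proof.
move=> fm fs; apply/eqP; rewrite eqEsubv; apply/andP; split.
  by apply/subvP => _ /memv_imgP[x xL ->]; rewrite lfunE derived_morph.
apply: derived_sub => x y; have [u <-] := fs x; have [v <-] := fs y.
by rewrite -fm -(lfunE f) memv_img // mem_derived.
Qed.

Lemma lower_central_morph (L M : finLieType k) (f : {linear L -> M}) c :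
  lie_morphism f -> forall x, x \in lower_central L c -> f x \in lower_central M c.
Proof.
move=> fm; elim: c => [|c IH] x; rewrite ?memvf //= => xL.
rewrite -(lfunE f) memv_preim; apply: subvP xL; apply: brv_sub => u v uL _.
by rewrite -memv_preim lfunE fm mem_brv ?memvf ?IH.
Qed.

Lemma lower_central_surj (L M : finLieType k) (f : {linear L -> M}) c :
  lie_morphism f -> (forall y, exists x, f x = y) ->
  (lower_central M c <= linfun f @: lower_central L c)%VS.
Proof.
move=> fm fs; elim: c => [|c IH] /=.
  by apply/subvP => y _; have [x <-] := fs y; rewrite -(lfunE f) memv_img ?memvf.
apply: brv_sub => x y /(subvP IH)/memv_imgP[u uL ->] _; have [v <-] := fs y.
by rewrite lfunE -fm -(lfunE f) memv_img // mem_brv ?memvf.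
Qed.

Lemma nilpotent_inj (L M : finLieType k) (f : {linear L -> M}) :
  lie_morphism f -> injective f -> lie_nilpotent M -> lie_nilpotent L.
Proof.
move=> fm fi [c c0]; exists c; apply/vspaceP => x; rewrite memv0.
apply/idP/eqP => [/(lower_central_morph fm)|->]; rewrite ?mem0v //.
by rewrite c0 memv0 => /eqP fx; apply: fi; rewrite fx linear0.
Qed.

Lemma nilpotent_surj (L M : finLieType k) (f : {linear L -> M}) :
  lie_morphism f -> (forall y, exists x, f x = y) -> lie_nilpotent L -> lie_nilpotent M.
Proof.
move=> fm fs [c c0]; exists c; apply/eqP; rewrite -subv0.
by apply: subv_trans (lower_central_surj c fm fs) _; rewrite c0 limg0.
Qed.

Lemma dim_derived_iso (A B : finLieType k) :
  lie_iso A B -> \dim (derived A) = \dim (derived B).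
Proof.
case=> f fm fb; have [g [gm fK gK]] := lie_morphism_inv fm fb.
rewrite -(derived_surj fm) => [|y]; last by exists (g y).
rewrite limg_dim_eq //; apply/eqP; rewrite -subv0; apply/subvP => x /memv_capP[_].
by rewrite memv_ker lfunE memv0 => /eqP fx; rewrite -(fK x) fx linear0.
Qed.

Lemma dim_iso (A B : finLieType k) : lie_iso A B -> \dim {:A} = \dim {:B}.
Proof. by case=> f _; apply: dim_bij. Qed.

Lemma lower_centralS (L : finLieType k) c : (lower_central L c.+1 <= lower_central L c)%VS.
Proof.
elim: c => [|c IH]; first exact: subvf.
by apply: brv_sub => x y xL yL; apply: mem_brv => //; apply: subvP xL.
Qed.

Lemma lower_central_derived (L : finLieType k) c : (lower_central L c.+1 <= derived L)%VS.
Proof.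
by elim: c => [|c IH] //; apply: subv_trans IH; apply: lower_centralS.
Qed.

(* [z] is taken in the last nonzero term of the lower central series. *)
Lemma nilpotent_central (L : finLieType k) :
  lie_nilpotent L -> derived L != 0%VS ->
  exists z, [/\ z != 0, lie_central z, z \in derived L &
    (forall x, x \in derived L -> lie_central x) \/ z \in brv (derived L) fullv].
Proof.
case=> c c0 dn0; have : exists c, lower_central L c == 0%VS by exists c; rewrite c0.
move/ex_minnP => [[|[|d]] /eqP m0 mmin].
- case/negP: dn0; rewrite -subv0 -m0; exact: subvf.
- by case/negP: dn0; rewrite -m0.
have zn0 : vpick (lower_central L d.+1) != 0.
  by rewrite vpick0; apply: contraTneq isT => /eqP /mmin; rewrite ltnn.
have zL := memv_pick (lower_central L d.+1); move: zn0 zL.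
set z := vpick _ => zn0 zL; exists z; split=> //.
- by move=> x; apply/eqP; rewrite -memv0 -m0; apply: mem_brv; rewrite ?memvf.
- exact: subvP (lower_central_derived L d) _ zL.
case: d {mmin zn0} @z m0 zL => [|d] z m0 zL; [left|right].
  by move=> x xL y; apply/eqP; rewrite -memv0 -m0; apply: mem_brv; rewrite ?memvf.
apply: subvP zL; apply: brv_sub => x y xL yL; apply: mem_brv => //.
exact: subvP (lower_central_derived L d) _ xL.
Qed.
End Derived.

Section CocycleDimension.
Variables (k : fieldType).

Lemma cocycle_closed (L : lieType k) : fun_closed (@lie_cocycle k L).
Proof.
split=> [f g fg cf| |a f g cf cg].
- split=> [z b x y|z b x y|x|x y z]; rewrite -!fg.
  + exact: cocycle_linl.
  + exact: cocycle_linr.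
  + exact: cocycle_alt.
  + exact: cocycle_jacobi.
- by split=> [z b x y|z b x y|x|x y z]; rewrite ?mulr0 ?addr0.
- split=> [z b x y|z b x y|x|x y z].
  + by rewrite (cocycle_linl cf) (cocycle_linl cg); ring.
  + by rewrite (cocycle_linr cf) (cocycle_linr cg); ring.
  + by rewrite (cocycle_alt cf) (cocycle_alt cg); ring.
  + transitivity (a * (f (⁅x, y⁆, z) + f (⁅y, z⁆, x) + f (⁅z, x⁆, y)) +
      (g (⁅x, y⁆, z) + g (⁅y, z⁆, x) + g (⁅z, x⁆, y))); first by ring.
    by rewrite (cocycle_jacobi cf) (cocycle_jacobi cg); ring.
Qed.

Lemma flin_sum (L : lmodType k) (g : L -> k) (I : Type) (r : seq I) (a : I -> k) (f : I -> L) :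
  flin g -> g (\sum_(i <- r) a i *: f i) = \sum_(i <- r) a i * g (f i).
Proof.
move=> lg; elim: r => [|i r IH]; first by rewrite !big_nil flin0.
by rewrite !big_cons lg IH.
Qed.

Lemma cocycle_pull (A B : lieType k) (p : {linear A -> B}) f :
  lie_morphism p -> lie_cocycle f -> lie_cocycle (fun x : A * A => f (p x.1, p x.2)).
Proof.
move=> pm cf; split=> [z b x y|z b x y|x|x y z] /=; rewrite ?linearP ?pm.
- exact: cocycle_linl.
- exact: cocycle_linr.
- exact: cocycle_alt.
- exact: cocycle_jacobi.
Qed.

Lemma cocycle_dim_ex (L : finLieType k) : exists d, fdim (@lie_cocycle k L) d.
Proof.
pose X := vbasis {:L}.
apply: (@fdim_ex _ _ _ #|{: 'I_(\dim {:L}) * 'I_(\dim {:L})}|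
  (fun i => (X`_((enum_val i).1), X`_((enum_val i).2)))); first exact: cocycle_closed.
move=> f cf f0 [x y].
rewrite (coord_vbasis (memvf x)) (flin_sum _ _ _ (cocycle_linl cf _)) big1 // => i _.
rewrite (coord_vbasis (memvf y)) (flin_sum _ _ _ (cocycle_linr cf _)) big1 ?mulr0 // => j _.
by have := f0 (enum_rank (i, j)); rewrite enum_rankK /= => ->; rewrite mulr0.
Qed.

Lemma cocycle_dim_iso (A B : finLieType k) d :
  lie_iso A B -> fdim (@lie_cocycle k A) d -> fdim (@lie_cocycle k B) d.
Proof.
case=> f fm fb; have [g [gm fK gK]] := lie_morphism_inv fm fb.
apply: (@fdim_pull _ _ _ _ _ (fun u : B * B => (g u.1, g u.2))).
- by move=> [x y]; exists (f x, f y); rewrite !fK.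
- by move=> c /(cocycle_pull gm).
- move=> c cc; exists (fun x => c (f x.1, f x.2)); first exact: cocycle_pull.
  by move=> [x y]; rewrite /= !gK.
Qed.

Definition central_slice (L : lieType k) (z : L) (g : L -> k) : Prop :=
  exists2 f, lie_cocycle f & forall x, g x = f (x, z).

Lemma central_slice_closed (L : lieType k) (z : L) : fun_closed (central_slice z).
Proof.
have [Ce C0 CD] := cocycle_closed L; split=> [f g fg [c cc cE]| |a f g [c cc cE] [d dc dE]].
- by exists c => // x; rewrite -fg.
- by exists (fun=> 0).
- by exists (fun u => a * c u + d u) => [|x]; rewrite ?cE ?dE //; apply: CD.
Qed.

Lemma central_slice_lin (L : lieType k) (z : L) g : central_slice z g -> flin g.
Proof. by case=> f cf gE a x y; rewrite !gE (cocycle_linl cf). Qed.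

Lemma flin_derived (L : finLieType k) (g : L -> k) :
  flin g -> (forall x y, g ⁅x, y⁆ = 0) -> forall x, x \in derived L -> g x = 0.
Proof.
move=> lg g0 x; have [gL gE] := @linear_ex _ L k^o g lg.
suff /subvP/[apply] : (derived L <= lker (linfun gL))%VS.
  by rewrite memv_ker lfunE /= gE => /eqP.
by apply: derived_sub => u v; rewrite memv_ker lfunE /= gE g0.
Qed.

Lemma central_slice_derived (L : finLieType k) (z : L) g :
  lie_central z -> central_slice z g -> forall x, x \in derived L -> g x = 0.
Proof.
move=> zc gz; apply: flin_derived; first exact: central_slice_lin gz.
by case: gz => f cf gE x y; rewrite gE cocycle_br_central.
Qed.

Definition central_quotient (A Q : finLieType k) (z : A) (p : {linear A -> Q}) : Prop :=
  [/\ lie_morphism p, forall y, exists x, p x = y & forall x, p x = 0 <-> x \in <[z]>%VS].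

Lemma central_quotient_ex (A : finLieType k) (z : A) : lie_central z ->
  exists (Q : finLieType k) (p : {linear A -> Q}), central_quotient z p.
Proof.
move=> zc; have [|Q [p [pm ps pk]]] := @lie_quotient k A <[z]>%VS.
  by move=> x y /vlineP[a ->]; rewrite lie_brZl zc scaler0 mem0v.
by exists Q, p.
Qed.

Lemma dim_central_quotient (A Q : finLieType k) (z : A) (p : {linear A -> Q}) :
  central_quotient z p -> z != 0 -> (\dim {:Q}).+1 = \dim {:A}.
Proof. by case=> _ ps pk zn0; rewrite -(dim_surj ps pk) dim_vline zn0 addn1. Qed.

Lemma dim_derived_central_quotient (A Q : finLieType k) (z : A) (p : {linear A -> Q}) :
  central_quotient z p -> z != 0 ->
  (\dim (derived Q) + (z \in derived A) = \dim (derived A))%N.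
Proof.
case=> pm ps pk zn0; rewrite -(derived_surj pm ps) addnC -(limg_ker_dim (linfun p) (derived A)).
congr (_ + _)%N; have -> : lker (linfun p) = <[z]>%VS.
  by apply/vspaceP => x; rewrite memv_ker lfunE; apply/eqP/idP => /pk.
case: (boolP (z \in derived A)) => [zA|zA].
  have -> : (derived A :&: <[z]> = <[z]>)%VS by apply/capv_idPr; rewrite -memvE.
  by rewrite dim_vline zn0.
apply/esym/eqP; rewrite dimv_eq0 -subv0; apply/subvP => x /memv_capP[+ /vlineP[a xE]].
rewrite xE; have [->|a0] := eqVneq a 0; first by rewrite scale0r => _; apply: mem0v.
by move/(memvZ a^-1); rewrite scalerA mulVf // scale1r (negPf zA).
Qed.

(** Rank and nullity for [f |-> f (., z)]: its image is the slice, and a cocycle in its kernel is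
    constant on the fibres of [p], hence comes from [Q]. *)
Lemma cocycle_dim_central (A Q : finLieType k) (z : A) (p : {linear A -> Q}) d e :
  lie_central z -> central_quotient z p ->
  fdim (@lie_cocycle k Q) d -> fdim (central_slice z) e -> fdim (@lie_cocycle k A) (d + e).
Proof.
move=> zc [pm ps pk] Qd Ge.
apply: (fdim_exact (i := fun x : A => (x, z)) (cocycle_closed A)) => //.
apply: (@fdim_pull _ _ _ _ _ (fun u : A * A => (p u.1, p u.2))) Qd.
- by move=> [u v]; have [x <-] := ps u; have [y <-] := ps v; exists (x, y).
- move=> g cg; split=> [|x /=]; first exact: cocycle_pull.
  by have /pk -> := memv_line z; apply: cocycle0r.
move=> f [cf fz].
(* A set-theoretic section is enough, since [fE] and [fE'] make [f] independent of the chosen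
   preimages. *)
pose s y := proj1_sig (constructive_indefinite_description _ (ps y)).
have sK y : p (s y) = y by exact: proj2_sig (constructive_indefinite_description _ (ps y)).
have fE x x' y : p x = p x' -> f (x, y) = f (x', y).
  move=> /eqP; rewrite -subr_eq0 -linearB => /eqP/pk/vlineP[a /eqP].
  rewrite subr_eq => /eqP ->.
  by rewrite cocycleDl // cocycleZl // [f (z, y)](cocycleC cf) fz oppr0 mulr0 add0r.
have fE' x y y' : p y = p y' -> f (x, y) = f (x, y').
  by move=> e'; rewrite (cocycleC cf) (fE _ _ _ e') -(cocycleC cf).
exists (fun u => f (s u.1, s u.2)) => [|[x y] /=]; last first.
  by transitivity (f (s (p x), y)); [apply: fE | apply: fE']; rewrite sK.
split=> [w b x y|w b x y|x|x y w] /=.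
- by rewrite -(cocycle_linl cf); apply: fE; rewrite linearP !sK.
- by rewrite -(cocycle_linr cf); apply: fE'; rewrite linearP !sK.
- exact: cocycle_alt.
- rewrite -(cocycle_jacobi cf (s x) (s y) (s w)).
  by congr (_ + _ + _); apply: fE; rewrite pm !sK.
Qed.

Lemma central_slice_dim_ex (L : finLieType k) (z : L) : exists d, fdim (central_slice z) d.
Proof.
apply: (@fdim_ex _ _ _ _ (fun i : 'I_(\dim {:L}) => (vbasis {:L})`_i)).
  exact: central_slice_closed.
move=> g /central_slice_lin lg g0 x.
by rewrite (coord_vbasis (memvf x)) flin_sum // big1 // => i _; rewrite g0 mulr0.
Qed.

Lemma central_slice_dim_le (L : finLieType k) (z : L) e : lie_central z ->
  fdim (central_slice z) e -> (e + \dim (derived L) <= \dim {:L})%N.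
Proof.
move=> zc Ge; have dL := dimvS (subvf (derived L)).
have := @fdim_functionals k L (derived L) (\dim {:L} - \dim (derived L)).
rewrite subnK // => /(_ erefl)/(fdim_mono _ Ge) le; rewrite -(subnK dL) leq_add2r.
apply: le => g gz; split; first exact: central_slice_lin gz.
exact: central_slice_derived.
Qed.

Lemma cocycle_wedge (L : finLieType k) (g h : L -> k) :
  flin g -> flin h -> (forall x y, g ⁅x, y⁆ = 0) -> (forall x y, h ⁅x, y⁆ = 0) ->
  lie_cocycle (fun u : L * L => g u.1 * h u.2 - g u.2 * h u.1).
Proof.
move=> lg lh g0 h0; split=> [w b x y|w b x y|x|x y w] /=; rewrite ?lg ?lh ?g0 ?h0; ring.
Qed.

(** If [h] kills [L^2] but not [z], the wedge of [g] and [h] divided by [h z] has slice [g], for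
    every [g] that kills [L^2] and [z]. Conversely a slice vanishes on [L^2] by centrality and at
    [z] because cocycles are alternating. *)
Lemma central_slice_dim_free (L : finLieType k) (z : L) : lie_central z -> z \notin derived L ->
  fdim (central_slice z) (\dim {:L} - \dim (derived L) - 1).
Proof.
move=> zc zL; have zn0 : z != 0 by apply: contraNneq zL => ->; rewrite mem0v.
have [h hL hz] := functional_separates zL.
have dU : \dim (derived L + <[z]>) = (\dim (derived L) + 1)%N.
  rewrite dimv_disjoint_sum ?dim_vline ?zn0 //.
  apply/eqP; rewrite -subv0; apply/subvP => x /memv_capP[+ /vlineP[a xE]].
  rewrite xE; have [->|a0] := eqVneq a 0; first by rewrite scale0r => _; apply: mem0v.
  by move/(memvZ a^-1); rewrite scalerA mulVf // scale1r (negPf zL).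
apply: (fdim_ext _ (@fdim_functionals k L (derived L + <[z]>)%VS _ _)); last first.
  by rewrite dU; have := dimvS (subvf (derived L + <[z]>)%VS); rewrite dU; lia.
move=> g; split=> [[lg gU]|gz]; last first.
  split=> [|x /memv_addP[u uL [_ /vlineP[a ->] ->]]]; first exact: central_slice_lin gz.
  have lg := central_slice_lin gz.
  rewrite flinD // flinZ // (central_slice_derived zc gz) // add0r.
  by case: gz => f cf ->; rewrite cocycle_alt // mulr0.
exists (fun u => (h z)^-1 * (g u.1 * h u.2 - g u.2 * h u.1) + 0).
  have [_ C0 CD] := cocycle_closed L; apply: (CD _ _ (fun=> 0)) => //.
  apply: cocycle_wedge => // [a x y|x y|x y].
  - by rewrite linearP.
  - by apply: gU; apply: subvP (addvSl _ _) _ _; exact: mem_derived.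
  - by rewrite hL // mem_derived.
move=> x /=; rewrite (gU z); first by field.
by apply: subvP (addvSr _ _) _ _; apply: memv_line.
Qed.

(** Dividing by one vector removes a slice of full dimension, and [C(n + 1, 2) = C(n, 2) + n]. *)
Lemma abelian_cocycle_dim (L : finLieType k) :
  derived L = 0%VS -> fdim (@lie_cocycle k L) 'C(\dim {:L}, 2).
Proof.
move: {2}(\dim {:L}) (erefl (\dim {:L})) => n; elim: n L => [|n IH] L dL L0.
  have [d Ld] := cocycle_dim_ex L; rewrite dL bin0n /=.
  suff : (d <= 0)%N by rewrite leqn0 => /eqP <-.
  apply: (@fdim_le_points _ _ _ _ _ (fun i : 'I_0 => (0, 0)) (cocycle_closed L) Ld).
  move=> f cf _ [x y]; have : x \in {:L}%VS by exact: memvf.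
  by move/eqP: dL; rewrite dimv_eq0 => /eqP ->; rewrite memv0 => /eqP ->; apply: cocycle0l.
have zn0 : vpick {:L} != 0 by rewrite vpick0 -dimv_eq0 dL.
move: zn0; set z := vpick _ => zn0.
have L00 (x y : L) : ⁅x, y⁆ = 0 by apply/eqP; rewrite -memv0 -L0 mem_derived.
have zL : z \notin derived L by rewrite L0 memv0.
have zc : lie_central z by move=> x.
have [Q [p pq]] := central_quotient_ex zc.
have := dim_central_quotient pq zn0; rewrite dL => -[dQ].
have := dim_derived_central_quotient pq zn0; rewrite L0 dimv0 => /eqP.
rewrite addn_eq0 dimv_eq0 => /andP[/eqP Q0 _].
have := cocycle_dim_central zc pq (IH _ dQ Q0) (central_slice_dim_free zc zL).
by rewrite dL dQ L0 dimv0 subn0 subn1 /= binS bin1.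
Qed.

End CocycleDimension.

(* [s] is determined by [dim M(A) = (n - 1)(n - 2)/2 + 1 - s], where [n = dim A]; the
   space of cocycles has dimension [dim M(A) + dim A^2]. *)
Definition lie_s (k : fieldType) (A : finLieType k) (s : nat) : Prop :=
  exists2 d, fdim (@lie_cocycle k A) d &
    (d + s + \dim {:A} = 'C(\dim {:A}, 2) + \dim (derived A) + 2)%N.

Section LieS.
Variables (k : fieldType).

Lemma lie_s_unique (A : finLieType k) s t : lie_s A s -> lie_s A t -> s = t.
Proof. by case=> d Ad ds [e Ae es]; have := fdim_unique Ad Ae; lia. Qed.

Lemma lie_s_iso (A B : finLieType k) s : lie_iso A B -> lie_s A s -> lie_s B s.
Proof.
move=> AB [d Ad ds]; exists d; first exact: cocycle_dim_iso Ad.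
by rewrite -(dim_iso AB) -(dim_derived_iso AB).
Qed.

Lemma lie_s_central (A Q : finLieType k) (z : A) (p : {linear A -> Q}) s t e :
  z != 0 -> lie_central z -> z \in derived A -> central_quotient z p ->
  fdim (central_slice z) e -> lie_s A s -> lie_s Q t -> (s + e + 1 = t + \dim {:A})%N.
Proof.
move=> zn0 zc zA pq Ge [a Aa sE] [b Qb tE].
have := fdim_unique Aa (cocycle_dim_central zc pq Qb Ge).
have := dim_central_quotient pq zn0.
have := dim_derived_central_quotient pq zn0; rewrite zA => dQ nQ.
by move: sE tE; rewrite -nQ -dQ binS bin1; lia.
Qed.

(** Removing a central line outside [A^2] leaves [a] unchanged, while the slice has the largest
    possible dimension [n - a - 1]; comparing the equations for the two values of [s] gives the
    increment [a - 1]. *)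
Lemma lie_s_central_free (A Q : finLieType k) (z : A) (p : {linear A -> Q}) t :
  lie_central z -> z \notin derived A -> central_quotient z p -> derived A != 0%VS ->
  lie_s Q t -> lie_s A (t + \dim (derived A) - 1).
Proof.
move=> zc zA pq A0 [b Qb tE].
have zn0 : z != 0 by apply: contraNneq zA => ->; rewrite mem0v.
have nQ := dim_central_quotient pq zn0.
have := dim_derived_central_quotient pq zn0; rewrite (negPf zA) => dQ.
exists (b + (\dim {:A} - \dim (derived A) - 1))%N.
  exact: cocycle_dim_central zc pq Qb (central_slice_dim_free zc zA).
have dQQ := dimvS (subvf (derived Q)); rewrite -dimv_eq0 in A0.
by move: tE; rewrite -nQ binS bin1; lia.
Qed.

Lemma derived_vline (A : finLieType k) : \dim (derived A) = 1%N ->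
  exists x y, ⁅x, y⁆ != 0 /\ derived A = <[⁅x, y⁆]>%VS.
Proof.
move=> d1; case: (classic (exists x y, ⁅x, y⁆ != 0 :> A)) => [[x [y xy0]]|H]; last first.
  suff A0 : derived A = 0%VS by rewrite A0 dimv0 in d1.
  apply/eqP; rewrite -subv0; apply: derived_sub => x y; rewrite memv0.
  by apply: contra_notT H => xy; exists x, y.
exists x, y; split=> //; apply/esym/eqP; rewrite eqEdim d1 dim_vline xy0 -memvE.
by rewrite mem_derived.
Qed.

(** With [[x, y] = c z] and [c] nonzero, the cocycle identity at [x, y, t] expresses [f (t, z)]
    through [f (x, z)] and [f (y, z)], so two values determine a slice. The quotient by [z] is
    abelian, and its cocycles are already counted. *)
Lemma lie_s_dim1 (A : finLieType k) (z : A) e :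
  \dim (derived A) = 1%N -> z \in derived A -> z != 0 -> lie_central z ->
  fdim (central_slice z) e -> (e <= 2)%N /\ lie_s A (2 - e).
Proof.
move=> d1 zA zn0 zc Ge.
have [x [y [xy0 Axy]]] := derived_vline d1.
have Az : derived A = <[z]>%VS.
  by apply/esym/eqP; rewrite eqEdim d1 dim_vline zn0 -memvE zA.
have le2 : (e <= 2)%N.
  apply: (fdim_le_points (t := fun i : 'I_2 => if i == 0 :> nat then x else y)
    (central_slice_closed _) Ge) => g gz g0 t.
  have gx : g x = 0 := g0 (@Ordinal 2 0 isT); have gy : g y = 0 := g0 (@Ordinal 2 1 isT).
  have lg := central_slice_lin gz; case: (gz) => f cf gE.
  have := cocycle_jacobi cf x y t.
  have := mem_derived y t; rewrite Az => /vlineP[a ->].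
  have := mem_derived t x; rewrite Az => /vlineP[b ->].
  have := mem_derived x y; rewrite Az => /vlineP[c xyE]; rewrite xyE.
  rewrite !(cocycleZl cf) !(cocycleC cf z) -!gE gx gy oppr0 !mulr0 !addr0 => /eqP.
  have [c0|/negPf c0] := eqVneq c 0; first by rewrite xyE c0 scale0r eqxx in xy0.
  by rewrite mulf_eq0 c0 oppr_eq0 => /eqP.
split=> //; have [Q [p pq]] := central_quotient_ex zc.
have nQ := dim_central_quotient pq zn0.
have := dim_derived_central_quotient pq zn0; rewrite zA d1 addn1 => -[/eqP].
rewrite dimv_eq0 => /eqP Q0.
exists ('C(\dim {:Q}, 2) + e)%N.
  exact: cocycle_dim_central zc pq (abelian_cocycle_dim Q0) Ge.
by rewrite d1 -nQ binS bin1; lia.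
Qed.

(** As [s] is a natural number by definition, existence includes a bound. One has
    [s(A) = s(A/z) + n - 1 - e], and [e <= n - a] makes the increment at least [a - 1], which is the
    increment of [C(a, 2)]. *)
Lemma lie_s_ex (A : finLieType k) : lie_nilpotent A -> derived A != 0%VS ->
  exists2 s, lie_s A s & ('C(\dim (derived A), 2) <= s)%N.
Proof.
move: {2}(\dim (derived A)) (erefl (\dim (derived A))) => n.
elim: n A => [|n IH] A dA nilA A0; first by move/eqP: dA; rewrite dimv_eq0 (negPf A0).
have [z [zn0 zc zA _]] := nilpotent_central nilA A0.
have [e Ge] := central_slice_dim_ex z.
case: n IH dA => [|n] IH dA.
  by have [_ As] := lie_s_dim1 dA zA zn0 zc Ge; exists (2 - e)%N; rewrite // dA bin_small.
have [Q [p pq]] := central_quotient_ex zc.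
have nQ := dim_central_quotient pq zn0.
have := dim_derived_central_quotient pq zn0; rewrite zA dA addn1 => -[dQ].
have [pm ps _] := pq.
have [||t [b Qb tE] tle] := IH Q dQ; first exact: nilpotent_surj nilA.
  by rewrite -dimv_eq0 dQ.
have le := central_slice_dim_le zc Ge.
exists (t + \dim {:A} - 1 - e)%N.
  exists (b + e)%N; first exact: cocycle_dim_central zc pq Qb Ge.
  move: tE le; rewrite dA dQ -nQ binS bin1; lia.
rewrite binS bin1; move: tle le; rewrite dQ dA; lia.
Qed.

End LieS.

(** * The multiplier of a direct summand *)

Section QuotientDimension.
Variables (k : fieldType).

Definition sub_closed (V : lmodType k) (P : V -> Prop) : Prop :=
  P 0 /\ forall a x y, P x -> P y -> P (a *: x + y).

Lemma sub_closed_sum (V : lmodType k) (P : V -> Prop) n (c : 'I_n -> k) (v : 'I_n -> V) :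
  sub_closed P -> (forall i, P (v i)) -> P (\sum_i c i *: v i).
Proof. by case=> P0 PD Pv; elim/big_rec: _ => // i x _; apply: PD. Qed.

Lemma sub_closedB (V : lmodType k) (P : V -> Prop) x y : sub_closed P -> P x -> P y -> P (x - y).
Proof. by case=> P0 PD Px Py; rewrite addrC -scaleN1r; apply: PD. Qed.

Lemma quotient_dim_le (V : lmodType k) (P B : V -> Prop) d e :
  sub_closed B -> quotient_dim P B d -> quotient_dim P B e -> (d <= e)%N.
Proof.
move=> Bc [v [Pv vi _]] [w [_ _ ws]].
have [M ME] := fin_all_exists (fun i => ws _ (Pv i)).
pose A := \matrix_(i, j) M i j.
have : row_free A.
  apply: inj_row_free => u uA; apply/rowP => i; rewrite mxE; apply: vi i.
  have -> : \sum_i u 0 i *: v i = \sum_i u 0 i *: (v i - \sum_j M i j *: w j).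
    rewrite -[LHS]subr0; under [RHS]eq_bigr => i _ do rewrite scalerBr scaler_sumr.
    rewrite big_split /= sumrN; congr (_ - _); rewrite exchange_big big1 // => j _.
    under eq_bigr => i _ do rewrite scalerA.
    rewrite -scaler_suml; move/rowP/(_ j): uA; rewrite !mxE.
    under eq_bigr => i _ do rewrite mxE.
    by move=> ->; rewrite scale0r.
  exact: sub_closed_sum.
by rewrite /row_free => /eqP <-; apply: rank_leq_col.
Qed.

Lemma quotient_dim_unique (V : lmodType k) (P B : V -> Prop) d e :
  sub_closed B -> quotient_dim P B d -> quotient_dim P B e -> d = e.
Proof.
by move=> Bc Pd Pe; apply/eqP; rewrite eqn_leq (quotient_dim_le Bc Pd Pe) (quotient_dim_le Bc Pe Pd).
Qed.

(** [Phi] induces an isomorphism of [P / B] with the finite-dimensional [U], so the quotient itself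
    is never formed. *)
Lemma quotient_dim_image (V : lmodType k) (W : vectType k) (Phi : {linear V -> W})
    (P B : V -> Prop) (U : {vspace W}) :
  sub_closed P -> (forall x, P x -> Phi x \in U) ->
  (forall w, w \in U -> exists2 x, P x & Phi x = w) ->
  (forall x, P x -> B x <-> Phi x = 0) -> quotient_dim P B (\dim U).
Proof.
move=> Pc PU UP PB; have X_free := basis_free (vbasisP U); pose X := vbasis U.
have [|v Pv vE] := @fin_all_exists2 _ _ (fun i : 'I_(\dim U) => P) (fun i x => Phi x = X`_i).
  by move=> i; apply: UP; rewrite vbasis_mem // mem_nth // size_tuple.
have Psum c : Phi (\sum_i c i *: v i) = \sum_i c i *: X`_i.
  by rewrite linear_sum; apply: eq_bigr => i _; rewrite linearZ vE.
exists v; split=> // [c /PB-/(_ (sub_closed_sum _ Pc Pv))|x Px].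
  by rewrite Psum; move/freeP: X_free; apply.
exists (fun i => coord X i (Phi x)); apply/PB.
  by apply: sub_closedB => //; apply: sub_closed_sum.
by rewrite linearB Psum -coord_vbasis ?PU // subrr.
Qed.

Lemma quotient_dim_ext (V : lmodType k) (P P' B B' : V -> Prop) d :
  (forall x, P x <-> P' x) -> (forall x, B x <-> B' x) ->
  quotient_dim P B d -> quotient_dim P' B' d.
Proof.
move=> PP BB [v [Pv vi vs]]; exists v; split=> [i|c /BB/vi //|x /PP/vs[c Bc]].
  exact/PP.
by exists c; apply/BB.
Qed.

Lemma lie_span_closed (F : lieType k) (U V : F -> Prop) : sub_closed (lie_span U V).
Proof.
split=> [|a x y]; first exact: LieSpan0.
elim=> [|b u v z Uu Vv _ IH] Sy; first by rewrite scaler0 add0r.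
by rewrite scalerDr scalerA -addrA; apply: LieSpanDZ => //; apply: IH.
Qed.

Lemma lie_span_br (F : lieType k) (U V : F -> Prop) x y : U x -> V y -> lie_span U V ⁅x, y⁆.
Proof.
by move=> Ux Vy; rewrite -[⁅x, y⁆]addr0 -[⁅x, y⁆]scale1r; apply: LieSpanDZ => //; apply: LieSpan0.
Qed.

Lemma lie_span_ext (F : lieType k) (U U' V : F -> Prop) x :
  (forall x, U x -> U' x) -> lie_span U V x -> lie_span U' V x.
Proof.
move=> UU; elim=> [|a u v z Uu Vv _ IH]; first exact: LieSpan0.
by apply: LieSpanDZ => //; apply: UU.
Qed.
End QuotientDimension.

Section Presentation.
Variables (k : fieldType) (F : lieType k).

(** Pulled back to a free algebra, every cocycle is a coboundary: the generators are lifted to the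
    central extension defined by [f], and the extra coordinate of the resulting morphism is [h]. *)
Lemma free_functional (L : lieType k) (pi : {linear F -> L}) (f : L * L -> k) :
  free_lie F -> lie_morphism pi -> lie_cocycle f ->
  exists h : {scalar F}, forall x y, h ⁅x, y⁆ = f (pi x, pi y).
Proof.
move=> [X [i Xfree]] pim cf.
have [E [q [h [qm hE Es]]]] := central_extension cf.
pose lift x := proj1_sig (constructive_indefinite_description _ (Es (pi (i x)) 0)).
have liftE x : q (lift x) = pi (i x).
  by case: (proj2_sig (constructive_indefinite_description _ (Es (pi (i x)) 0))).
have [[g gm gE] _] := Xfree E lift.
have [_ uniq] := Xfree L (fun x => pi (i x)).
have qg x : q (g x) = pi x.
  apply: (uniq (q \o g : {linear F -> L}) pi) => // [u v|u] /=; first by rewrite gm qm.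
  by rewrite gE liftE.
by exists (h \o g : {scalar F}) => x y /=; rewrite gm hE !qg.
Qed.

(* The dual of the commutator quotient [S, F] / [R, F] consists of the restrictions to
   [pi S * L] of the cocycles of [L]; the following is the injectivity half of it. *)
Lemma relation_module_separated (L : finLieType k) (pi : {linear F -> L}) (N : L -> Prop)
    (J : finType) (f : J -> L * L -> k) (h : J -> {scalar F}) :
  lie_morphism pi -> (forall y, exists x, pi x = y) ->
  (forall j x y, h j ⁅x, y⁆ = f j (pi x, pi y)) ->
  (forall g, lie_cocycle g -> exists c : J -> k,
     forall x y, N x -> g (x, y) = \sum_j c j * f j (x, y)) ->
  forall u, lie_span (fun x => N (pi x)) (fun=> True) u -> (forall j, h j u = 0) ->
  lie_span (fun x => pi x = 0) (fun=> True) u.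
Proof.
move=> pim ps hE fspan u Su hu; set RF := lie_span _ _.
have [RF0 RFD] : sub_closed RF by exact: lie_span_closed.
have RFc : sub_closed RF by [].
pose l := \dim {:L}; pose X := vbasis {:L}.
have XE x : x = \sum_i coord X i x *: X`_i by rewrite -coord_vbasis ?memvf.
have [s sE] := fin_all_exists (fun i : 'I_l => ps X`_i).
pose sg x := \sum_i coord X i x *: s i.
have sgD a x y : sg (a *: x + y) = a *: sg x + sg y.
  rewrite /sg scaler_sumr -big_split; apply: eq_bigr => i _.
  by rewrite linearP scalerDl scalerA.
have sgK x : pi (sg x) = x.
  by rewrite linear_sum [RHS]XE; apply: eq_bigr => i _; rewrite linearZ sE.
(* Matrices stand for tensors in [L] with itself: [tens x y] is the tensor of [x] and [y], and [tau]
   sends it to the bracket of the lifts [sg x] and [sg y]. *)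
pose tau (M : 'M[k]_l) := \sum_i \sum_j M i j *: ⁅s i, s j⁆.
pose tens x y : 'M[k]_l := \matrix_(i, j) (coord X i x * coord X j y).
have tauD a M M' : tau (a *: M + M') = a *: tau M + tau M'.
  rewrite /tau scaler_sumr -big_split; apply: eq_bigr => i _.
  rewrite scaler_sumr -big_split; apply: eq_bigr => j _.
  by rewrite !mxE scalerDl scalerA.
have tau0 : tau 0 = 0 by rewrite /tau big1 // => i _; rewrite big1 // => j _; rewrite mxE scale0r.
have tauT x y : tau (tens x y) = ⁅sg x, sg y⁆.
  rewrite lie_br_lcomb_l; apply: eq_bigr => i _; rewrite lie_br_lcomb_r scaler_sumr.
  by apply: eq_bigr => j _; rewrite mxE scalerA.
have tensDl a x y z : tens (a *: x + y) z = a *: tens x z + tens y z.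
  by apply/matrixP => i j; rewrite !mxE linearP mulrDl mulrA.
have tensDr a x y z : tens z (a *: x + y) = a *: tens z x + tens z y.
  by apply/matrixP => i j; rewrite !mxE linearP /= mulrDr mulrCA.
(* [UM] consists of the tensors that [tau] sends into [[R, F]]. *)
have [|a M M' RM RM'|UM UME] := @vspace_of_prop k 'M[k]_l (fun M => RF (tau M)).
- by rewrite tau0.
- by rewrite tauD; apply: RFD.
have approx x y : RF (⁅x, y⁆ - ⁅sg (pi x), sg (pi y)⁆).
  have -> : ⁅x, y⁆ - ⁅sg (pi x), sg (pi y)⁆ =
      ⁅x - sg (pi x), y⁆ - ⁅y - sg (pi y), sg (pi x)⁆.
    rewrite [X in _ = _ - X]lie_brC opprK lie_brDl lie_brDr lie_brNl lie_brNr.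
    by rewrite addrA subrK.
  by apply: sub_closedB => //; apply: lie_span_br; rewrite // linearB sgK subrr.
(* [M] is the tensor read off from an expression of [u] as a combination of brackets. A functional
   [psi] that agrees with a combination of the [f j] on [N * L] then has at [M] the value of the
   same combination of the [h j] at [u]. *)
have : exists2 M, RF (u - tau M) & forall (c : J -> k) (psi : {scalar 'M[k]_l}),
   (forall x y, N x -> psi (tens x y) = \sum_j c j * f j (x, y)) ->
   psi M = \sum_j c j * h j u.
  elim: Su => {u hu} [|a x y u Nx _ _ [M RM ME]].
    exists 0 => [|c psi _]; first by rewrite tau0 subr0.
    by rewrite linear0 big1 // => j _; rewrite linear0 mulr0.
  exists (a *: tens (pi x) (pi y) + M) => [|c psi psiE].
    rewrite tauD tauT opprD addrACA -scalerBr.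
    exact: RFD.
  rewrite linearP /= psiE // (ME c) // mulr_sumr -big_split; apply: eq_bigr => j _.
  by rewrite linearP /= hE; ring.
case=> M RM ME; case: (classic (RF u)) => // nRu.
have MU : M \notin UM.
  apply/negP => /UME RtM; apply: nRu; rewrite -[u](subrK (tau M)).
  by rewrite -[u - _]scale1r; apply: RFD.
have [psi psi0 /eqP[]] := functional_separates MU.
(* Alternating tensors and Jacobi sums lie in [UM], so a functional that kills [UM] defines a
   cocycle. Since all [h j u] vanish, it also kills [M], against its choice. *)
have [|c cE] := fspan (fun x => psi (tens x.1 x.2)).
  split=> [z a x y|z a x y|x|x y z] /=.
  - by rewrite tensDl linearP.
  - by rewrite tensDr linearP.
  - by apply: psi0; apply/UME; rewrite tauT lie_brxx.
  - rewrite -!linearD; apply: psi0; apply/UME.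
    have tauA M1 M2 : tau (M1 + M2) = tau M1 + tau M2.
      by rewrite -[M1]scale1r tauD !scale1r.
    have brE a b c : ⁅sg ⁅a, b⁆, sg c⁆ = ⁅sg ⁅a, b⁆ - ⁅sg a, sg b⁆, sg c⁆ - ⁅sg c, ⁅sg a, sg b⁆⁆.
      by rewrite lie_brDl lie_brNl [X in _ - X]lie_brC opprK subrK.
    have RFb a b c : RF ⁅sg ⁅a, b⁆ - ⁅sg a, sg b⁆, sg c⁆.
      by apply: lie_span_br; rewrite // linearB pim !sgK subrr.
    rewrite !tauA !tauT (brE x y z) (brE y z x) (brE z x y).
    rewrite [X in RF (X + _)]addrACA -opprD addrACA -opprD.
    rewrite lie_jacobi subr0.
    have RFA a b : RF a -> RF b -> RF (a + b) by move=> Ra Rb; rewrite -[a]scale1r; apply: RFD.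
    by apply: (RFA); first apply: (RFA).
by rewrite (ME c) // big1 // => j _; rewrite hu mulr0.
Qed.
End Presentation.

Section DirectSumMaps.
Variables (k : fieldType) (A B : finLieType k).

Lemma dsum_maps : exists (ia : {linear A -> A ⊕ B}) (ib : {linear B -> A ⊕ B})
    (pa : {linear A ⊕ B -> A}) (pb : {linear A ⊕ B -> B}),
  [/\ lie_morphism ia, lie_morphism ib, lie_morphism pa & lie_morphism pb] /\
  [/\ forall a, ia a = (a, 0), forall b, ib b = (0, b), forall x, pa x = x.1 & forall x, pb x = x.2].
Proof.
have [|ia iaE] := @linear_ex _ A (A ⊕ B) (fun a => (a, 0)).
  by move=> c x y; congr pair; rewrite /= scaler0 addr0.
have [|ib ibE] := @linear_ex _ B (A ⊕ B) (fun b => (0, b)).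
  by move=> c x y; congr pair; rewrite /= scaler0 addr0.
have [|pa paE] := @linear_ex _ (A ⊕ B) A fst; first by [].
have [|pb pbE] := @linear_ex _ (A ⊕ B) B snd; first by [].
exists ia, ib, pa, pb; split; split=> // x y; rewrite ?iaE ?ibE ?paE ?pbE //.
  by congr pair; rewrite /= lie_br0l.
by congr pair; rewrite /= lie_br0l.
Qed.

Lemma dim_summand1 : \dim (summand1 A B) = \dim {:A}.
Proof.
have [ia [ib [pa [pb [_ [iaE _ _ _]]]]]] := dsum_maps.
apply: (dim_inj_img (f := ia)) => [x y|[a b]]; first by rewrite !iaE => -[].
rewrite mem_summand1 /=; split=> [/eqP ->|[x]]; first by exists a; rewrite iaE.
by rewrite iaE => -[_ <-].
Qed.

Lemma dim_dsum : \dim {:A ⊕ B} = (\dim {:A} + \dim {:B})%N.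
Proof.
have [ia [ib [pa [pb [_ [_ _ _ pbE]]]]]] := dsum_maps.
rewrite -dim_summand1 addnC (dim_surj (f := pb) (I := summand1 A B)) //.
  by move=> y; exists (0, y); rewrite pbE.
by move=> x; rewrite pbE mem_summand1; split=> /eqP.
Qed.
End DirectSumMaps.

(** Since [[A, B] = 0], the cocycle identity makes the mixed part vanish when one argument is a
    bracket; it is therefore a bilinear form on [A/A^2] and [B/B^2]. *)
Lemma dsum_cocycle_span (k : fieldType) (A B : finLieType k) r q
    (pA : {linear A -> 'rV[k]_r}) (pB : {linear B -> 'rV[k]_q}) :
  (forall a, (pA a == 0) = (a \in derived A)) -> (forall v, exists a, pA a = v) ->
  (forall b, (pB b == 0) = (b \in derived B)) -> (forall v, exists b, pB b = v) ->
  forall g, lie_cocycle g -> exists c : 'I_r * 'I_q -> k,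
    forall x y, g ((x, 0) : A ⊕ B, (0, y) : A ⊕ B) = \sum_j c j * (pA x 0 j.1 * pB y 0 j.2).
Proof.
move=> pAK pAs pBK pBs g cg.
have [ia [ib [_ [_ [[iam ibm _ _] [iaE ibE _ _]]]]]] := dsum_maps A B.
have /fin_all_exists[s sE] := fun i => pAs (delta_mx 0 i).
have /fin_all_exists[t tE] := fun i => pBs (delta_mx 0 i).
pose G x y := g (ia x, ib y).
have Gl y : flin (G^~ y) by move=> a u v; rewrite /G linearP (cocycle_linl cg).
have Gr x : flin (G x) by move=> a u v; rewrite /G linearP (cocycle_linr cg).
have br0 a b : ⁅ia a, ib b⁆ = 0 by rewrite iaE ibE; congr pair; rewrite /= ?lie_br0l ?lie_br0r.
have GA x y : x \in derived A -> G x y = 0.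
  move: x; apply: flin_derived => // u v; have := cocycle_jacobi cg (ia u) (ia v) (ib y).
  by rewrite -iam [⁅ib y, _⁆]lie_brC !br0 oppr0 !(cocycle0l cg) !addr0.
have GB x y : y \in derived B -> G x y = 0.
  move: y; apply: flin_derived => // u v; have := cocycle_jacobi cg (ib u) (ib v) (ia x).
  rewrite -ibm [⁅ib v, _⁆]lie_brC !br0 oppr0 !(cocycle0l cg) !addr0 (cocycleC cg) => /eqP.
  by rewrite oppr_eq0 => /eqP.
have expand (V : vectType k) n (p : {linear V -> 'rV[k]_n}) (w : 'I_n -> V) (W : {vspace V}) (f : V -> k) :
    (forall a, (p a == 0) = (a \in W)) -> (forall i, p (w i) = delta_mx 0 i) ->
    flin f -> (forall x, x \in W -> f x = 0) -> forall x, f x = \sum_i p x 0 i * f (w i).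
  move=> pK pE lf fW x; rewrite -flin_sum //; apply/eqP; rewrite -subr_eq0 -mulN1r addrC -lf.
  apply/eqP/fW; rewrite -pK linearP linear_sum /= scaleN1r {2}(row_sum_delta (p x)).
  by under eq_bigr => i _ do rewrite linearZ /= pE; rewrite addNr.
exists (fun j => G (s j.1) (t j.2)) => x y; rewrite -iaE -ibE -/(G x y).
rewrite (expand _ _ pA s (derived A) (G^~ y)) //; last by move=> u; apply: GA.
rewrite -(pair_bigA _ (fun i j => G (s i) (t j) * (pA x 0 i * pB y 0 j))) /=.
apply: eq_bigr => i _; rewrite (expand _ _ pB t (derived B) (G (s i))) // => [|u].
  by rewrite mulr_sumr; apply: eq_bigr => j _; ring.
exact: GB.
Qed.

Lemma multiplier_dim_dsum (k : fieldType) (A B : finLieType k) (F : lieType k)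
    (pi : {linear F -> A ⊕ B}) d e :
  free_presentation pi -> fdim (@lie_cocycle k A) d ->
  multiplier_dim pi (summand1 A B) e <->
  (e + \dim (derived A) =
   d + (\dim {:A} - \dim (derived A)) * (\dim {:B} - \dim (derived B)))%N.
Proof.
move=> [Ffree pim ps] [v [cv vi vs]].
have [ia [ib [pa [pb [[iam ibm pam pbm] [iaE ibE paE pbE]]]]]] := dsum_maps A B.
set r := (\dim {:A} - \dim (derived A))%N; set q := (\dim {:B} - \dim (derived B))%N.
have [|pA [pAK pAs]] := @quotient_coord k A (derived A) r; first by rewrite subnK // dimvS ?subvf.
have [|pB [pBK pBs]] := @quotient_coord k B (derived B) q; first by rewrite subnK // dimvS ?subvf.
(* [J] indexes a basis of the restrictions of cocycles to [A * L]: the cocycles of [A], and the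
   wedges of a coordinate of [A/A^2] with one of [B/B^2]. *)
pose J : finType := ('I_d + 'I_r * 'I_q)%type.
pose f (j : J) : (A ⊕ B) * (A ⊕ B) -> k := match j with
  | inl i => fun u => v i (pa u.1, pa u.2)
  | inr ij => fun u => pA (pa u.1) 0 ij.1 * pB (pb u.2) 0 ij.2 - pA (pa u.2) 0 ij.1 * pB (pb u.1) 0 ij.2
  end.
have cf j : lie_cocycle (f j).
  case: j => [i|[i j]] /=; first exact: (cocycle_pull pam (cv i)).
  apply: (@cocycle_wedge _ _ (fun x => pA (pa x) 0 i) (fun x => pB (pb x) 0 j)) => [a x y|a x y|x y|x y].
  - by rewrite !linearP !mxE.
  - by rewrite !linearP !mxE.
  - by have /eqP := pAK ⁅pa x, pa y⁆; rewrite mem_derived => /eqP/eqP e0; rewrite pam e0 mxE.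
  - by have /eqP := pBK ⁅pb x, pb y⁆; rewrite mem_derived => /eqP/eqP e0; rewrite pbm e0 mxE.
have findep (c : J -> k) : (forall x y, \sum_j c j * f j (ia x, y) = 0) -> forall j, c j = 0.
  move=> c0; have c0l i : c (inl i) = 0.
    apply: (vi (fun i => c (inl i))) => -[x y]; rewrite -[RHS](c0 x (ia y)).
    rewrite big_sumType /= [X in _ + X]big1 ?addr0 => [|j _]; last first.
      by rewrite !pbE !iaE /= !linear0 !mxE; ring.
    by apply: eq_bigr => j _; rewrite !paE !iaE.
  case=> [i|[i j]]; first exact: c0l.
  have [x xE] := pAs (delta_mx 0 i); have [y yE] := pBs (delta_mx 0 j).
  rewrite -[RHS](c0 x (ib y)) big_sumType /= big1 ?add0r => [|l _]; last by rewrite c0l mul0r.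
  rewrite (bigD1 (i, j)) //= !paE !pbE !iaE !ibE /= xE yE !linear0 !mxE !eqxx.
  rewrite big1 => [|[i' j'] ij]; first by rewrite /=; ring.
  rewrite !mxE !eqxx /=.
  have [i'i|] := eqVneq i' i; last by rewrite !(mul0r, mulr0, subr0).
  have [j'j|] := eqVneq j' j; last by rewrite !(mul0r, mulr0, subr0).
  by rewrite i'i j'j eqxx in ij.
have fspan g : lie_cocycle g -> exists c : J -> k,
    forall x y, x.2 = 0 -> g (x, y) = \sum_j c j * f j (x, y).
  move=> cg; have [c1 c1E] := vs _ (cocycle_pull iam cg).
  have [c2 c2E] := dsum_cocycle_span pAK pAs pBK pBs cg.
  exists (fun j => match j with inl i => c1 i | inr ij => c2 ij end) => -[x x'] y /= ->.
  have yE : y = ia y.1 + ib y.2.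
    by rewrite iaE ibE; case: y => y y'; congr pair; rewrite /= ?addr0 ?add0r.
  rewrite {1}yE (cocycleDr cg) big_sumType /= -[(x, 0)]iaE; congr (_ + _).
    have /= -> := c1E (x, y.1); apply: eq_bigr => i _; by rewrite !paE !iaE.
  rewrite iaE ibE c2E; apply: eq_bigr => j _.
  by rewrite !paE !pbE /= linear0 !mxE; ring.
have [h hE] := fin_all_exists (fun j => free_functional Ffree pim (cf j)).
pose W := 'rV[k]_#|J|.
have [|Phi PhiE] := @linear_ex _ F W (fun u => \row_j h (enum_val j) u).
  by move=> a x y; apply/rowP => j; rewrite !mxE linearP.
pose S x := pi x \in summand1 A B; pose RF := lie_span (fun x => pi x = 0) (fun=> True).
pose SF := lie_span S (fun=> True).
have SFc : sub_closed SF by exact: lie_span_closed.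
have RFc : sub_closed RF by exact: lie_span_closed.
have RF_Phi u : RF u -> Phi u = 0 /\ pi u = 0.
  elim=> [|a x y z xR _ _ [IH1 IH2]]; first by rewrite !linear0.
  rewrite !linearP pim xR lie_br0l IH1 IH2 !addr0 scaler0; split=> //.
  rewrite PhiE; apply/rowP => j; rewrite !mxE hE xR.
  by rewrite (cocycle0l (cf _)) mulr0.
have SF_inj u : SF u -> Phi u = 0 -> RF u.
  move=> Su Pu; apply: (relation_module_separated (N := fun x => x.2 = 0) (f := f) (h := h)) => //.
    by apply: lie_span_ext Su => x; rewrite /S mem_summand1 => /eqP.
  by move=> j; move/rowP/(_ (enum_rank j)): Pu; rewrite PhiE !mxE enum_rankK.
have [|a w w' [u Su <-] [u' Su' <-]|U UE] := @vspace_of_prop k W (fun w => exists2 u, SF u & Phi u = w).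
- by exists 0; rewrite ?linear0; case: SFc.
- by exists (a *: u + u'); rewrite ?linearP //; apply: SFc.2.
(* A functional that kills the image of [[S, F]] under [Phi] is a linear relation among the [f j] on
   [A * L], and [findep] makes it trivial. *)
have SF_surj w : exists2 u, SF u & Phi u = w.
  apply/UE; apply: contraT => wU; have [g gU] := functional_separates wU.
  case/negP; have gE w' : g w' = \sum_j w' 0 j * g (delta_mx 0 j).
    by rewrite {1}(row_sum_delta w') linear_sum; apply: eq_bigr => j _; rewrite linearZ.
  apply/eqP; rewrite gE big1 // => j _.
  rewrite -(enum_valK j) (findep (fun j => g (delta_mx 0 (enum_rank j)))) ?mulr0 // => x y.
  have [s sE] := ps (ia x); have [t tE] := ps y.
  rewrite -sE -tE -[RHS](gU (Phi ⁅s, t⁆)); last first.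
    apply/UE; exists ⁅s, t⁆ => //; apply: lie_span_br => //.
    by rewrite /S sE mem_summand1 iaE.
  rewrite gE (reindex enum_rank) /=; last by exists enum_val => ? _; rewrite (enum_rankK, enum_valK).
  by apply: eq_bigr => i _; rewrite PhiE mxE enum_rankK hE mulrC.
(* [theta] is the map that [pi] induces on [[S, F]/[R, F]], read through [Phi]; its kernel is the
   multiplier and its image is [[N, L]], the copy of [A^2]. *)
have /fin_all_exists2[rho Srho rhoE] := fun j => SF_surj (delta_mx 0 j).
have [|theta thetaE] := @linear_ex _ W (A ⊕ B) (fun w => \sum_j w 0 j *: pi (rho j)).
  move=> a x y; rewrite scaler_sumr -big_split; apply: eq_bigr => j _.
  by rewrite !mxE scalerDl scalerA.
have thetaP u : SF u -> pi u = theta (Phi u).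
  move=> Su; apply/eqP; rewrite -subr_eq0 thetaE.
  have Ssum : SF (\sum_j Phi u 0 j *: rho j) by exact: sub_closed_sum.
  have -> : \sum_j Phi u 0 j *: pi (rho j) = pi (\sum_j Phi u 0 j *: rho j).
    by rewrite linear_sum; apply: eq_bigr => j _; rewrite linearZ.
  rewrite -linearB; apply/eqP; case: (RF_Phi (u - \sum_j Phi u 0 j *: rho j)) => //.
  apply: SF_inj; first exact: sub_closedB.
  rewrite linearB linear_sum {1}(row_sum_delta (Phi u)).
  by under [X in _ - X]eq_bigr => j _ do rewrite linearZ /= rhoE; rewrite subrr.
have limg_theta : (limg (linfun theta) = linfun ia @: derived A)%VS.
  apply/eqP; rewrite eqEsubv; apply/andP; split; apply/subvP.
    move=> _ /memv_imgP[w _ ->]; have [u Su <-] := SF_surj w; rewrite lfunE /= -thetaP //.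
    elim: Su => [|a x y z xS _ _ IH]; first by rewrite linear0 mem0v.
    rewrite linearP /= memvD ?memvZ // pim; apply/memv_imgP.
    exists ⁅(pi x).1, (pi y).1⁆; rewrite ?mem_derived ?lfunE // [X in _ = X]iaE.
    by move: xS; rewrite /S mem_summand1; case: (pi x) => x1 x2 /= /eqP ->; congr pair; rewrite /= lie_br0l.
  move=> _ /memv_imgP[x xA ->]; rewrite memv_preim; apply: subvP xA.
  apply: derived_sub => u w; rewrite -memv_preim lfunE /= iam.
  have [s sE] := ps (ia u); have [t tE] := ps (ia w).
  have Sst : SF ⁅s, t⁆ by apply: lie_span_br => //; rewrite /S sE mem_summand1 iaE.
  by rewrite -sE -tE -pim thetaP // -(lfunE theta) memv_img ?memvf.
have dker : (\dim (lker (linfun theta)) + \dim (derived A) = d + r * q)%N.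
  have := limg_ker_dim (linfun theta) fullv; rewrite capfv limg_theta limg_dim_eq; last first.
    apply/eqP; rewrite -subv0; apply/subvP => x /memv_capP[_].
    by rewrite memv_ker lfunE memv0 /= iaE => /eqP[->].
  have dW : \dim {:W} = #|J| by rewrite dimvf /dim /= mul1n.
  by move=> ->; rewrite dW card_sum card_prod !card_ord.
have Me : multiplier_dim pi (summand1 A B) (\dim (lker (linfun theta))).
  apply: (quotient_dim_image (Phi := Phi)).
  - split; first by split; [rewrite linear0 | case: SFc].
    move=> a x y [Rx Sx] [Ry Sy]; split; last exact: SFc.2.
    by rewrite linearP Rx Ry scaler0 addr0.
  - by move=> x [Rx Sx]; rewrite memv_ker lfunE /= -thetaP // Rx.
  - move=> w; rewrite memv_ker lfunE /= => /eqP tw; have [u Su uE] := SF_surj w.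
    by exists u => //; split=> //; rewrite thetaP // uE.
  - by move=> x [Rx Sx]; split=> [/RF_Phi[]|] //; apply: SF_inj.
split=> [Me'|eE]; first by rewrite (quotient_dim_unique RFc Me' Me).
by have -> : e = \dim (lker (linfun theta)) by apply/eqP; rewrite -(eqn_add2r (\dim (derived A))) dker eE.
Qed.

(** * Bracket tables *)

(* Tables use the one-based numbering of the paper: e_i is [X`_(i.-1)]. *)
Notation table_bracket X s i j := (foldr (fun e a => let: (p, q, l, c) := e in
  if (p.-1 == i) && (q.-1 == j) then c *: X`_(l.-1) + a else a) 0 s).

(** Besides being in range, the first two positions increase, so that no entry contributes to both
    orders of a pair. *)
Definition table_ok (k : fieldType) d (s : seq (nat * nat * nat * k)) : bool :=
  all (fun e => [&& e.1.1.1.-1 < e.1.1.2.-1, e.1.1.2.-1 <= d & e.1.2.-1 <= d])%N s.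

(** * Direct decompositions and isomorphisms of pairs *)

Lemma lie_decomposition (k : fieldType) (L : finLieType k) (N K : {vspace L}) :
  lie_ideal N -> lie_ideal K -> (N + K)%VS = fullv -> (N :&: K = 0)%VS ->
  exists (A B : finLieType k) (f : {linear A ⊕ B -> L}),
    [/\ lie_morphism f, bijective f, forall x, (f x \in N) = (x.2 == 0)
      & forall x, (f x \in K) = (x.1 == 0)].
Proof.
move=> idN idK NKf NK0.
have [A [i [im ii iN]]] := lie_subalgebra (fun x y xN _ => idN x y xN).
have [B [j [jm ji jK]]] := lie_subalgebra (fun x y xK _ => idK x y xK).
have iA a : i a \in N by apply/iN; exists a.
have jB b : j b \in K by apply/jK; exists b.
have br0 a b : ⁅i a, j b⁆ = 0.
  apply/eqP; rewrite -memv0 -NK0; apply/memv_capP; split; first exact: idN.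
  by rewrite lie_brC memvN; apply: idK.
have [|f fE] := @linear_ex _ (A ⊕ B) L (fun x => i x.1 + j x.2).
  by move=> c x y; rewrite !linearP scalerDr addrACA.
have cap0 a b : i a = - j b -> a = 0 /\ b = 0.
  move=> e; have /eqP : i a \in (N :&: K)%VS.
    by apply/memv_capP; split; rewrite // e memvN.
  rewrite NK0 memv0 => /eqP/eqP ia0; have jb0 : j b = 0 by rewrite -[j b]opprK -e ia0 oppr0.
  by split; [apply: ii | apply: ji]; rewrite linear0.
have fm : lie_morphism f.
  move=> x y; rewrite !fE lie_brDl !lie_brDr br0 [⁅j _, i _⁆]lie_brC br0 oppr0 addr0 add0r.
  by rewrite -im -jm.
exists A, B, f; split=> // [|x|x].
- have fi : injective f.
    move=> x y /eqP; rewrite -subr_eq0 -linearB fE addr_eq0 => /eqP/cap0[].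
    case: x y => [x1 x2] [y1 y2] /= /eqP; rewrite subr_eq0 => /eqP -> /eqP.
    by rewrite subr_eq0 => /eqP ->.
  have fs y : exists x, f x = y.
    have : y \in (N + K)%VS by rewrite NKf memvf.
    by case/memv_addP=> _ /iN[a <-] [_ /jK[b <-] ->]; exists (a, b); rewrite fE.
  pose g y := proj1_sig (constructive_indefinite_description _ (fs y)).
  have gK y : f (g y) = y by exact: proj2_sig (constructive_indefinite_description _ (fs y)).
  by exists g => // x; apply: fi; rewrite gK.
- rewrite fE; apply/idP/eqP => [fN|->]; last by rewrite linear0 addr0.
  have : j x.2 \in N by rewrite -[j _](addKr (i x.1)) memvD // memvN.
  by case/iN=> a aE; have [] := cap0 (- a) x.2; rewrite // linearN aE.
- rewrite fE; apply/idP/eqP => [fK|->]; last by rewrite linear0 add0r.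
  have : i x.1 \in K by rewrite -[i _](addrK (j x.2)) memvB.
  by case/jK=> b bE; have [] := cap0 x.1 (- b); rewrite // linearN opprK bE.
Qed.

Section PairIso.
Variables (k : fieldType) (L : finLieType k) (N : {vspace L}).

Lemma pair_iso_ex (K : {vspace L}) :
  lie_ideal N -> lie_ideal K -> (N + K)%VS = fullv -> directv (N + K) ->
  exists A B : finLieType k, pair_iso N (summand1 A B).
Proof.
move=> idN idK NKf /directv_addP NK0.
have [A [B [f [fm fb fN _]]]] := lie_decomposition idN idK NKf NK0.
have [g [gm fK gK]] := lie_morphism_inv fm fb.
exists A, B, g; split=> //; first by exists f.
by move=> x; rewrite mem_summand1 -fN gK.
Qed.

Lemma pair_iso_dsum (A B A' B' : finLieType k) :
  lie_iso A A' -> lie_iso B B' -> pair_iso N (summand1 A B) -> pair_iso N (summand1 A' B').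
Proof.
case=> f fm fb [g gm gb] [h [hm hb hN]].
have [f' [_ fK fK']] := lie_morphism_inv fm fb; have [g' [_ gK gK']] := lie_morphism_inv gm gb.
have [|e eE] := @linear_ex _ (A ⊕ B) (A' ⊕ B') (fun x => (f x.1, g x.2)).
  by move=> c x y; congr pair; rewrite linearP.
exists (e \o h : {linear L -> A' ⊕ B'}); split=> [x y|/=|x /=].
- by rewrite /= hm !eE; congr pair; rewrite (fm, gm).
- apply: bij_comp hb; exists (fun x => (f' x.1, g' x.2)) => -[x y]; rewrite ?eE /= ?fK ?gK //.
  by rewrite fK' gK'.
- rewrite eE -hN !mem_summand1 /=; apply/eqP/eqP => [e0|->]; last exact: linear0.
  by rewrite -(gK (h x).2) e0 linear0.
Qed.

Lemma pair_iso_dim (A B : finLieType k) : pair_iso N (summand1 A B) ->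
  \dim N = \dim {:A} /\ \dim {:L} = (\dim {:A} + \dim {:B})%N.
Proof.
case=> f [fm fb fN]; rewrite -dim_dsum (dim_bij fb); split=> //.
rewrite -(dim_summand1 A B); have [g [gm fK gK]] := lie_morphism_inv fm fb.
have <- : (linfun g @: summand1 A B)%VS = N.
  apply/vspaceP => x; apply/memv_imgP/idP => [[y yS ->]|xN].
    by rewrite lfunE -fN gK.
  by exists (f x); rewrite ?fN // lfunE /= fK.
rewrite limg_dim_eq //; apply/eqP; rewrite -subv0; apply/subvP => x /memv_capP[_].
by rewrite memv_ker lfunE memv0 => /eqP gx; rewrite -(gK x) gx linear0.
Qed.

Lemma pair_iso_nilpotent (A B : finLieType k) : pair_iso N (summand1 A B) ->
  lie_nilpotent L -> lie_nilpotent A /\ lie_nilpotent B.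
Proof.
case=> f [fm fb fN] nL; have [g [gm fK gK]] := lie_morphism_inv fm fb.
have [ia [ib [_ [_ [[iam ibm _ _] [iaE ibE _ _]]]]]] := dsum_maps A B.
have gi : injective g by exact: can_inj gK.
split; [apply: (nilpotent_inj (f := g \o ia : {linear A -> L})) nL
       |apply: (nilpotent_inj (f := g \o ib : {linear B -> L})) nL].
- by move=> x y /=; rewrite iam gm.
- by move=> x y /= /gi; rewrite !iaE => -[].
- by move=> x y /=; rewrite ibm gm.
- by move=> x y /= /gi; rewrite !ibE => -[].
Qed.

Lemma multiplier_dim_pair (A B : finLieType k) (F : lieType k) (pi : {linear F -> L}) d e :
  pair_iso N (summand1 A B) -> free_presentation pi -> fdim (@lie_cocycle k A) d ->
  multiplier_dim pi N e <->
  (e + \dim (derived A) =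
   d + (\dim {:A} - \dim (derived A)) * (\dim {:B} - \dim (derived B)))%N.
Proof.
case=> f [fm fb fN] [Ff pim ps] Ad; have [g [gm fK gK]] := lie_morphism_inv fm fb.
have pres : free_presentation (f \o pi : {linear F -> A ⊕ B}).
  split=> // [x y /=|y /=]; first by rewrite pim fm.
  by have [x xE] := ps (g y); exists x; rewrite xE gK.
rewrite -(multiplier_dim_dsum e pres Ad).
have R0 x : f (pi x) = 0 <-> pi x = 0.
  by split=> [fx|->]; rewrite ?linear0 // -(fK (pi x)) fx linear0.
have S0 x : (f (pi x) \in summand1 A B) = (pi x \in N) by exact: fN.
split; apply: quotient_dim_ext => x /=.
- by rewrite R0; split=> -[Rx Sx]; split=> //; apply: lie_span_ext Sx => y; rewrite S0.
- by split; apply: lie_span_ext => y; rewrite R0.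
- by rewrite R0; split=> -[Rx Sx]; split=> //; apply: lie_span_ext Sx => y; rewrite S0.
- by split; apply: lie_span_ext => y; rewrite R0.
Qed.
End PairIso.

(** * Isomorphisms onto algebras given by tables *)

Section TableIso.
Variables (k : fieldType).

Lemma table_iso d (t : lie_table k d) (A : finLieType k) (X : seq A) :
  size X = d -> <<X>>%VS = fullv -> \dim {:A} = d ->
  (forall i j : 'I_d, ⁅X`_i, X`_j⁆ = \sum_(e <- entries t) let: (a, b, l, c) := e in
     (c * ((a == i)%:R * (b == j)%:R - (b == i)%:R * (a == j)%:R)) *: X`_l) ->
  lie_iso A (table_lie t).
Proof.
move=> Xd Xs dA brE; apply: lie_iso_sym.
have Xt : size X == d by exact/eqP.
pose Y := Tuple Xt.
have Yb : basis_of fullv Y by rewrite basisEdim Xs subvv /= Xd dA.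
have Yf := basis_free Yb.
have [|f fE] := @linear_ex _ (table_lie t) A (fun v => \sum_i v 0 i *: X`_i).
  move=> a x y; rewrite scaler_sumr -big_split; apply: eq_bigr => i _.
  by rewrite !mxE scalerDl scalerA.
exists f; last first.
  exists (fun x => \row_i coord Y i x) => x.
    by apply/rowP => i; rewrite mxE fE (coord_sum_free (X := Y)).
  by rewrite fE [RHS](coord_basis Yb (memvf x)); apply: eq_bigr => i _; rewrite mxE.
have fdelta l : f (delta_mx 0 l) = X`_l.
  rewrite fE (bigD1 l) //= mxE !eqxx scale1r big1 ?addr0 // => j /negPf jl.
  by rewrite mxE jl scale0r.
move=> u v; rewrite [⁅u, v⁆]/(table_br _ u v) /table_br linear_sum !fE.
rewrite lie_br_lcomb_l; under [RHS]eq_bigr => p _ do rewrite lie_br_lcomb_r scaler_sumr.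
under [RHS]eq_bigr => p _ do under eq_bigr => q _ do rewrite brE !scaler_sumr.
under [RHS]eq_bigr => p _ do rewrite exchange_big /=.
rewrite exchange_big /=; apply: eq_bigr => -[[[a b] l] c] _.
rewrite linearZ /= fdelta.
have pick (w : 'I_d) (g : 'I_d -> k) : \sum_i (w == i)%:R * g i = g w.
  rewrite (bigD1 w) //= eqxx mul1r big1 ?addr0 // => i /negPf iw.
  by rewrite eq_sym iw mul0r.
transitivity (\sum_p \sum_q (c * ((a == p)%:R * (u 0 p * ((b == q)%:R * v 0 q)) -
   (b == p)%:R * (u 0 p * ((a == q)%:R * v 0 q)))) *: X`_l).
  under eq_bigr => p _ do rewrite -scaler_suml.
  rewrite -scaler_suml; congr (_ *: _).
  under eq_bigr => p _ do rewrite -mulr_sumr sumrB -!mulr_sumr !pick.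
  by rewrite -mulr_sumr sumrB !pick.
by apply: eq_bigr => p _; apply: eq_bigr => q _; rewrite !scalerA; congr (_ *: _); ring.
Qed.

(** Both sides are alternating, so only increasing pairs of positions have to be compared, and
    [table_ok] removes the reversed terms there. *)
Lemma nat_table_iso d (t : lie_table k d.+1) (s : seq (nat * nat * nat * k)) (A : finLieType k)
    (X : seq A) :
  entries t = table d s ->
  table_ok d s ->
  size X = d.+1 -> <<X>>%VS = fullv -> \dim {:A} = d.+1 ->
  (forall i j, (i < j <= d)%N -> ⁅X`_i, X`_j⁆ = table_bracket X s i j) ->
  lie_iso A (table_lie t).
Proof.
move=> tE sok Xd Xs dA brE; apply: (table_iso Xd Xs dA) => i j; rewrite tE /table big_map.
pose S (i j : nat) := \sum_(e <- s) let: (p, q, l, c) := e in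
   (c * ((p.-1 == i)%:R * (q.-1 == j)%:R - (q.-1 == i)%:R * (p.-1 == j)%:R)) *: X`_(l.-1).
have -> : \sum_(e <- s) (let: (a, b, l, c) := let: (i0, j0, l, c) := e in
     ((inord i0.-1, inord j0.-1, inord l.-1, c) : entry k d.+1) in
     (c * ((a == i)%:R * (b == j)%:R - (b == i)%:R * (a == j)%:R)) *: X`_l) = S i j.
  apply: eq_big_seq => -[[[p q] l] c] /(allP sok)/= /and3P[pq qd ld].
  by rewrite -!val_eqE /= !inordK //; lia.
have SN i' j' : S i' j' = - S j' i'.
  by rewrite /S -sumrN; apply: eq_bigr => -[[[p q] l] c] _; rewrite -scaleNr; congr (_ *: _); ring.
have Slt (i' j' : nat) : (i' < j' <= d)%N -> S i' j' = ⁅X`_i', X`_j'⁆.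
  move=> ij; rewrite brE // /S; elim: s sok {brE tE S SN} => [|[[[p q] l] c] s IH] /=.
    by rewrite big_nil.
  case/andP=> /and3P[pq qd ld] /IH {}IH; rewrite big_cons IH.
  have [pi|pi] := eqVneq p.-1 i'; have [qj|qj] := eqVneq q.-1 j' => /=.
  - have -> : (q.-1 == i') = false by lia.
    by rewrite mulr1 mul0r subr0 mulr1.
  - have -> : (q.-1 == i') = false by lia.
    by rewrite !(mul0r, mulr0) subr0 mulr0 scale0r add0r.
  - have -> : (p.-1 == j') = false by lia.
    by rewrite !(mul0r, mulr0) subr0 mulr0 scale0r add0r.
  - rewrite mul0r sub0r -natrM mulnb.
    have -> : (q.-1 == i') && (p.-1 == j') = false by lia.
    by rewrite oppr0 mulr0 scale0r add0r.
have [ij|ji|/val_inj ->] := ltngtP i j.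
- by rewrite Slt // ij -ltnS ltn_ord.
- rewrite SN Slt; last by rewrite ji /= -ltnS ltn_ord.
  exact: lie_brC.
- rewrite lie_brxx /S big1 // => -[[[p q] l] c] _.
  by rewrite mulrC [_%:R * _]mulrC subrr mul0r scale0r.
Qed.

Lemma abelian_iso (A : finLieType k) : derived A = 0%VS -> lie_iso A (Ab k (\dim {:A})).
Proof.
move=> A0; apply: (table_iso (X := vbasis {:A})); rewrite ?size_tuple //.
  by rewrite (span_basis (vbasisP _)).
move=> i j; rewrite big_nil; apply/eqP; rewrite -memv0 -A0; exact: mem_derived.
Qed.
End TableIso.

Definition lie_stem (k : fieldType) (A : finLieType k) : Prop :=
  forall z : A, lie_central z -> z \in derived A.

(** [C] complements the central part of [A^2] inside the center, and [H] is a complement of [C] that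
    contains [A^2]. Both are ideals, one being central and the other containing all brackets. A
    central element of [H] differs from an element of [A^2] by one of both [C] and [H], which is
    0. *)
Lemma lie_stem_split (k : fieldType) (A : finLieType k) :
  exists (B : finLieType k) (i : nat), lie_iso A (B ⊕ Ab k i) /\ lie_stem B.
Proof.
have [|a x y xc yc|Z ZE] := @vspace_of_prop k A (@lie_central k A).
- by move=> x; rewrite lie_br0l.
- by move=> z; rewrite lie_brDZl xc yc scaler0 addr0.
pose C := (Z :\: derived A)%VS; pose H := (derived A + (Z + derived A)^C)%VS.
have CZ x : x \in C -> lie_central x by move=> xC; apply/ZE; apply: subvP xC; apply: diffvSl.
have idH : lie_ideal H.
  by move=> x y _; apply: subvP (addvSl _ _) _ _; apply: mem_derived.
have idC : lie_ideal C by move=> x y /CZ ->; rewrite mem0v.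
have HC : (H + C = fullv)%VS.
  by rewrite addvC addvA addv_diff addv_complf.
have capHC : (H :&: C = 0)%VS.
  apply/eqP; rewrite -subv0; apply/subvP => x /memv_capP[/memv_addP[d dD [e eE ->]] xC].
  have e0 : e = 0.
    apply/eqP; rewrite -memv0 -(capv_compl (Z + derived A)); apply/memv_capP; split=> //.
    rewrite -[e](addKr d) addrC memvB //; last exact: subvP (addvSr _ _) _ dD.
    by rewrite -addv_diff; apply: subvP (addvSl _ _) _ xC.
  move: xC; rewrite e0 addr0 => dC.
  by rewrite -(capv_diff Z (derived A)); apply/memv_capP.
have [B [D [f [fm fb fH fC]]]] := lie_decomposition idH idC HC capHC.
have [g [gm fK gK]] := lie_morphism_inv fm fb.
have [ia [ib [pa [pb [[iam ibm pam pbm] [iaE ibE paE pbE]]]]]] := dsum_maps B D.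
have D0 : derived D = 0%VS.
  apply/eqP; rewrite -subv0; apply: derived_sub => x y; rewrite memv0; apply/eqP.
  have := CZ (f (ib x)); rewrite fC ibE eqxx => /(_ isT (f (ib y))).
  rewrite -ibE -fm -ibm => /(congr1 g); rewrite fK linear0 ibE.
  by case.
have pi : pair_iso H (summand1 B D).
  exists g; split=> //; first by exists f.
  by move=> x; rewrite mem_summand1 -fH gK.
exists B, (\dim {:D}); split.
  have idB : lie_iso B B by exists idfun => //; exists idfun.
  by have [h [hm hb _]] := pair_iso_dsum idB (abelian_iso D0) pi; exists h.
move=> z zc; have fzc : lie_central (f (ia z)).
  move=> y; rewrite -(gK y) -fm (_ : ⁅ia z, g y⁆ = 0) ?linear0 // iaE.
  by congr pair; rewrite /= ?zc ?lie_br0l.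
have fzD : f (ia z) \in derived A.
  have : f (ia z) \in (C + derived A)%VS.
    by rewrite addv_diff; apply: subvP (addvSl _ _) _ _; apply/ZE.
  case/memv_addP=> c cC [d dD cd].
  have cH : c \in H.
    rewrite -[c](addrK d) -cd memvB //; last exact: subvP (addvSl _ _) _ dD.
    by rewrite fH iaE.
  have c0 : c = 0 by apply/eqP; rewrite -memv0 -capHC; apply/memv_capP.
  by rewrite cd c0 add0r.
have -> : z = pa (g (f (ia z))) by rewrite fK paE iaE.
by apply: derived_morph => //; apply: derived_morph.
Qed.

Lemma dim_derived_dsum (k : fieldType) (A B : finLieType k) :
  \dim (derived (A ⊕ B)) = (\dim (derived A) + \dim (derived B))%N.
Proof.
have [ia [ib [pa [pb [[iam ibm pam pbm] [iaE ibE paE pbE]]]]]] := dsum_maps A B.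
have -> : derived (A ⊕ B) = (linfun ia @: derived A + linfun ib @: derived B)%VS.
  apply/eqP; rewrite eqEsubv subv_add; apply/and3P; split.
  - apply: derived_sub => x y.
    have -> : ⁅x, y⁆ = ia ⁅x.1, y.1⁆ + ib ⁅x.2, y.2⁆.
      by rewrite iaE ibE; congr pair; rewrite /= ?addr0 ?add0r.
    by rewrite memv_add // -lfunE memv_img // mem_derived.
  - by apply/subvP => _ /memv_imgP[x xA ->]; rewrite lfunE derived_morph.
  - by apply/subvP => _ /memv_imgP[x xA ->]; rewrite lfunE derived_morph.
rewrite dimv_disjoint_sum; last first.
  apply/eqP; rewrite -subv0; apply/subvP => x /memv_capP[/memv_imgP[a _ ->] /memv_imgP[b _]].
  by rewrite !lfunE /= iaE ibE => -[-> _]; apply: mem0v.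
by congr (_ + _)%N; rewrite limg_dim_eq //; apply/eqP; rewrite -subv0; apply/subvP => x
   /memv_capP[_]; rewrite memv_ker lfunE memv0 /= ?iaE ?ibE => /eqP[->].
Qed.

Lemma dsum_Ab0 (k : fieldType) (A : finLieType k) : lie_iso (A ⊕ Ab k 0) A.
Proof.
have [ia [ib [pa [pb [[_ _ pam _] [iaE _ paE _]]]]]] := dsum_maps A (Ab k 0).
exists pa => //; exists ia => x; rewrite iaE ?paE //.
by case: x => a b /=; congr pair; apply/rowP => -[].
Qed.

(** * Cocycles of an algebra given by a table *)

Section Tables.
Variables (k : fieldType).

Lemma dim_table d (t : lie_table k d) : \dim {: table_lie t} = d.
Proof. by rewrite dimvf /dim /= mul1n. Qed.

Lemma dim_Ab n : \dim {: Ab k n} = n.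
Proof. exact: dim_table. Qed.

Lemma dim_derived_Ab n : \dim (derived (Ab k n)) = 0%N.
Proof.
apply/eqP; rewrite dimv_eq0 -subv0; apply: derived_sub => u v; rewrite memv0.
by rewrite [⁅_, _⁆]/(table_br _ _ _) /table_br big_nil.
Qed.

(** Each central line outside the derived subalgebra costs [a - 1]; the last coordinate of the
    abelian summand is the one removed. *)
Lemma lie_s_dsum_Ab (A : finLieType k) s i :
  derived A != 0%VS -> lie_s A s -> lie_s (A ⊕ Ab k i) (s + (\dim (derived A) - 1) * i).
Proof.
move=> A0 As; elim: i => [|i IH].
  by rewrite muln0 addn0; apply: lie_s_iso As; apply/lie_iso_sym/dsum_Ab0.
pose z : A ⊕ Ab k i.+1 := (0, delta_mx 0 ord_max).
have brAb n (u v : Ab k n) : ⁅u, v⁆ = 0.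
  by apply/eqP; rewrite -memv0 -(_ : derived (Ab k n) = 0%VS) ?mem_derived //;
     apply/eqP; rewrite -dimv_eq0 dim_derived_Ab.
have zc : lie_central z by move=> x; congr pair; rewrite /= ?lie_br0l ?brAb.
have [|p pE] := @linear_ex _ (A ⊕ Ab k i.+1) (A ⊕ Ab k i)
    (fun x => (x.1, \row_j x.2 0 (widen_ord (leqnSn i) j))).
  by move=> a x y; congr pair; apply/rowP => j; rewrite !mxE.
have pq : central_quotient z p.
  split=> [x y|[x v]|[x v]]; rewrite ?pE /=.
  - by congr pair; rewrite /= ?brAb //; apply/rowP => j; rewrite !mxE.
  - exists (x, \row_j oapp (v 0) 0 (insub (val j))); rewrite pE /=; congr pair.
    by apply/rowP => j; rewrite !mxE /= insubT //= => lt; congr (v 0 _); apply: val_inj.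
  - split=> [[-> v0]|/vlineP[a [-> ->]]].
      apply/vlineP; exists (v 0 ord_max); congr pair; first by rewrite scaler0.
      apply/rowP => j; rewrite !mxE eqxx /=; case: (unliftP ord_max j) => [j'|] ->;
        last by rewrite eqxx mulr1.
      rewrite eq_sym (negPf (neq_lift _ _)) mulr0; move/rowP/(_ j'): v0; rewrite !mxE => <-.
      by congr (v 0 _); apply: val_inj => /=; rewrite /bump leqNgt ltn_ord.
    congr pair; first by rewrite scaler0.
    apply/rowP => j; rewrite !mxE.
    have -> : (widen_ord (leqnSn i) j == ord_max) = false by rewrite -val_eqE /= ltn_eqF.
    by rewrite andbF mulr0.
have dA : \dim (derived (A ⊕ Ab k i.+1)) = \dim (derived A).
  by rewrite dim_derived_dsum dim_derived_Ab addn0.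
have zA : z \notin derived (A ⊕ Ab k i.+1).
  apply/negP => zD; have [ia [ib [pa [pb [[_ _ _ pbm] [_ _ _ pbE]]]]]] := dsum_maps A (Ab k i.+1).
  have := derived_morph pbm zD; rewrite pbE.
  have /eqP -> : derived (Ab k i.+1) == 0%VS by rewrite -dimv_eq0 dim_derived_Ab.
  rewrite memv0 => /eqP/rowP/(_ ord_max); rewrite !mxE !eqxx /= => /eqP.
  by rewrite oner_eq0.
have AA0 : derived (A ⊕ Ab k i.+1) != 0%VS by rewrite -dimv_eq0 dA dimv_eq0.
have := lie_s_central_free zc zA pq AA0 IH; rewrite dA.
by congr (lie_s _ _); move: A0; rewrite -dimv_eq0; case: (\dim _) => // a _; lia.
Qed.

Definition upper (F : nat -> nat -> k) i j : k :=
  if (i < j)%N then F i j else if (j < i)%N then - F j i else 0.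

(* For i < j, the value on ([e_i, e_j], e_m) of the alternating form with entries F. *)
Definition table_val (s : seq (nat * nat * nat * k)) (F : nat -> nat -> k) (i j m : nat) : k :=
  foldr (fun e a => let: (p, q, l, c) := e in
    if (p.-1 == i) && (q.-1 == j) then c * upper F l.-1 m + a else a) 0 s.

(** The last term is subtracted because [[e_l, e_i]] is read as [- [e_i, e_l]]: the table is indexed
    by increasing pairs. *)
Definition table_jac s F i j l := table_val s F i j l + table_val s F j l i - table_val s F i l j.

Lemma table_basis_br d (t : lie_table k d.+1) s (e := fun i => delta_mx 0 (inord i) : table_lie t) :
  entries t = table d s -> table_ok d s -> forall i j, (i < j <= d)%N ->
  ⁅e i, e j⁆ = foldr (fun x a => let: (p, q, l, c) := x in
    if (p.-1 == i) && (q.-1 == j) then c *: e l.-1 + a else a) 0 s.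
Proof.
move=> tE sok i j ij; rewrite [⁅_, _⁆]/(table_br _ _ _) tE /table_br /table big_map.
elim: s sok {tE} => [|[[[p q] l] c] s IH] /=; first by rewrite big_nil.
case/andP=> /and3P[/= pq qd ld] /IH {}IH; rewrite big_cons IH !mxE -!val_eqE /= !inordK; try lia.
have -> : (q.-1 == i)%:R * (p.-1 == j)%:R = 0 :> k.
  by rewrite -natrM mulnb; have -> : (q.-1 == i) && (p.-1 == j) = false by lia.
by rewrite subr0 -natrM mulnb; case: (_ && _); rewrite ?mulr1 // mulr0 scale0r add0r.
Qed.

(* An alternating form is a cocycle as soon as the Jacobi sums vanish on increasing
   triples of basis vectors; [P] lists the positions of the entries that are free. *)
Lemma table_cocycle_dim d (A : finLieType k) s (X : seq A) z (P : nat -> nat * nat) :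
  table_ok d s -> size X = d.+1 -> <<X>>%VS = fullv -> \dim {:A} = d.+1 ->
  (forall i j, (i < j <= d)%N -> ⁅X`_i, X`_j⁆ = table_bracket X s i j) ->
  (forall n, (n < z)%N -> ((P n).1 < (P n).2 <= d)%N) ->
  (forall F, (forall i j l, (i < j < l)%N -> (l <= d)%N -> table_jac s F i j l = 0) ->
     (forall n, (n < z)%N -> F (P n).1 (P n).2 = 0) ->
     forall i j, (i < j <= d)%N -> F i j = 0) ->
  (forall c : nat -> k, exists F,
     (forall i j l, (i < j < l)%N -> (l <= d)%N -> table_jac s F i j l = 0) /\
     (forall n, (n < z)%N -> F (P n).1 (P n).2 = c n)) ->
  fdim (@lie_cocycle k A) z.
Proof.
move=> sok Xd Xs dA brE Pok inj sur; pose e i := X`_i.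
have Xt : size X == d.+1 by exact/eqP.
pose Y := Tuple Xt.
have Yb : basis_of fullv Y by rewrite basisEdim Xs subvv /= Xd dA.
pose co := coord Y.
have eE u : u = \sum_(i < d.+1) co i u *: e i by rewrite [LHS](coord_basis Yb (memvf u)).
have coe i j : (j <= d)%N -> co i (e j) = (i == inord j)%:R.
  move=> jd; have -> : e j = Y`_(inord j : 'I_d.+1) by rewrite inordK.
  by rewrite /co coord_free ?(basis_free Yb) // eq_sym.
have valE (f : A * A -> k) F i j m :
    (forall y, flin (fun x => f (x, y))) -> (i < j <= d)%N -> (m <= d)%N ->
    (forall i j, (i <= d)%N -> (j <= d)%N -> f (e i, e j) = upper F i j) ->
    f (⁅e i, e j⁆, e m) = table_val s F i j m.
  move=> lf ij md fE; rewrite brE // /table_val.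
  elim: s sok {brE inj sur} => [|[[[p q] l] c] s IH] /=; first by rewrite (flin0 (lf _)).
  case/andP=> /and3P[/= pq qd ld] /IH {}IH; case: ifP => // _.
  by rewrite (lf _ _ _ _) IH fE.
apply: (fdim_points (t := fun i : 'I_z => (e (P i).1, e (P i).2)) (cocycle_closed _)).
- move=> f cf f0; pose F i j := f (e i, e j).
  have FE i j : f (e i, e j) = upper F i j.
    rewrite /upper; case: ltngtP => // [_|->]; last exact: cocycle_alt.
    exact: cocycleC.
  have F0 : forall i j, (i < j <= d)%N -> F i j = 0.
    apply: inj => [i j l ijl ld|n nz]; last exact: (f0 (Ordinal nz)).
    have := cocycle_jacobi cf (e i) (e j) (e l).
    rewrite [⁅e l, e i⁆]lie_brC (cocycleNl cf).
    by rewrite !(valE f F) //; try exact: (cocycle_linl cf); lia.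
  case=> x y; rewrite (eE x) (flin_sum _ _ _ (cocycle_linl cf _)) big1 // => i _.
  rewrite (eE y) (flin_sum _ _ _ (cocycle_linr cf _)) big1 ?mulr0 // => j _.
  have ib := ltn_ord i; have jb := ltn_ord j.
  by rewrite FE /upper; case: ltngtP => [ij|ij|]; rewrite ?F0 ?oppr0 ?mulr0 //; lia.
- move=> c; have [F [FJ FP]] := sur (fun n => oapp c 0 (insub n)).
  pose f (u : A * A) : k :=
     \sum_(i < d.+1) \sum_(j < d.+1) (if (i < j)%N then F i j else 0) *
        (co i u.1 * co j u.2 - co i u.2 * co j u.1).
  have lfl y : flin (fun x => f (x, y)).
    move=> a u v; rewrite /f mulr_sumr -big_split; apply: eq_bigr => i _.
    rewrite mulr_sumr -big_split; apply: eq_bigr => j _; rewrite /co !linearP /=; ring.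
  have lfr y : flin (fun x => f (y, x)).
    move=> a u v; rewrite /f mulr_sumr -big_split; apply: eq_bigr => i _.
    rewrite mulr_sumr -big_split; apply: eq_bigr => j _; rewrite /co !linearP /=; ring.
  have falt u : f (u, u) = 0.
    by rewrite /f big1 // => i _; rewrite big1 // => j _; rewrite subrr mulr0.
  have fC u v : f (u, v) = - f (v, u).
    by rewrite /f -sumrN; apply: eq_bigr => i _; rewrite -sumrN; apply: eq_bigr => j _ /=; ring.
  have fE i j : (i <= d)%N -> (j <= d)%N -> f (e i, e j) = upper F i j.
    move=> id jd; have sumE (a b : 'I_d.+1) : \sum_(i < d.+1) \sum_(j < d.+1)
       (if (i < j)%N then F i j else 0) * ((i == a)%:R * (j == b)%:R) = if (a < b)%N then F a b else 0.
      rewrite (bigD1 a) //= (bigD1 b) //= !eqxx mulr1 mulr1 big1 ?addr0 => [|j' /negPf ->];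
        last by rewrite !mulr0.
      by rewrite big1 ?addr0 // => i' /negPf ->; rewrite big1 // => j' _; rewrite mul0r mulr0.
    transitivity ((if (i < j)%N then F i j else 0) - (if (j < i)%N then F j i else 0)).
      have := sumE (inord i) (inord j); have := sumE (inord j) (inord i).
      rewrite !inordK // => <- <-; rewrite -sumrB; apply: eq_bigr => p _.
      rewrite -sumrB; apply: eq_bigr => q _; rewrite /= !coe //; ring.
    by rewrite /upper; case: ltngtP; rewrite ?subr0 ?sub0r ?oppr0.
  (* The Jacobi sum is linear, cyclic and alternating, so its vanishing on increasing triples of
     basis vectors suffices. *)
  pose J x y w := f (⁅x, y⁆, w) + f (⁅y, w⁆, x) + f (⁅w, x⁆, y).
  have JC x y w : J x y w = - J y x w.
    rewrite /J ![⁅y, x⁆]lie_brC ![⁅x, w⁆]lie_brC ![⁅w, y⁆]lie_brC.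
    rewrite !(flinN (lfl _)); ring.
  have Jcyc x y w : J x y w = J y w x by rewrite /J; ring.
  have Jxx x w : J x x w = 0.
    by rewrite /J lie_brxx (flin0 (lfl _)) [⁅w, x⁆]lie_brC (flinN (lfl _)); ring.
  have Jlin y w : flin (fun x => J x y w).
    move=> a u v; rewrite /J lie_brDZl lie_brDZr !(lfl _ _ _ _) (lfr _ _ _ _); ring.
  have Jlt i j l : (i < j < l)%N -> (l <= d)%N -> J (e i) (e j) (e l) = 0.
    move=> ijl ld; rewrite -(FJ i j l ijl ld) /J /table_jac [⁅e l, e i⁆]lie_brC (flinN (lfl _)).
    by rewrite !(valE f F) //; lia.
  have Je i j l : (i <= d)%N -> (j <= d)%N -> (l <= d)%N -> J (e i) (e j) (e l) = 0.
    move=> id jd ld.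
    have [->|ij] := eqVneq i j; first exact: Jxx.
    have [->|jl] := eqVneq j l; first by rewrite Jcyc Jxx.
    have [->|il] := eqVneq i l; first by rewrite -Jcyc Jxx.
    have [lt1|le1] := ltnP i j; have [lt2|le2] := ltnP j l; have [lt3|le3] := ltnP i l; try lia.
    - by apply: Jlt; rewrite ?lt1.
    - by rewrite JC Jcyc Jlt ?oppr0 ?lt3 //; lia.
    - by rewrite Jcyc Jcyc Jlt //; lia.
    - by rewrite JC Jlt ?oppr0 //; lia.
    - by rewrite Jcyc Jlt //; lia.
    - by rewrite JC Jcyc Jcyc Jlt ?oppr0 //; lia.
  exists f => [|n]; last first.
    have /andP[lt le] := Pok n (ltn_ord n).
    rewrite fE /upper ?lt; [|lia|lia].
    by rewrite FP // valK.
  split=> // x y w; rewrite -/(J x y w) (eE x) (flin_sum _ _ _ (Jlin _ _)) big1 // => i _.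
  rewrite Jcyc (eE y) (flin_sum _ _ _ (Jlin _ _)) big1 ?mulr0 // => j _.
  rewrite Jcyc (eE w) (flin_sum _ _ _ (Jlin _ _)) big1 ?mulr0 // => l _.
  by rewrite Je ?mulr0 // -ltnS.
Qed.

Lemma table_derived_dim d (A : finLieType k) s (X : seq A) (T : seq nat) :
  table_ok d s -> size X = d.+1 -> <<X>>%VS = fullv -> \dim {:A} = d.+1 ->
  (forall i j, (i < j <= d)%N -> ⁅X`_i, X`_j⁆ = table_bracket X s i j) ->
  uniq T -> all (fun l => l <= d)%N T -> all (fun e => e.1.2.-1 \in T) s ->
  (forall l, l \in T -> exists i j, (i < j <= d)%N /\ ⁅X`_i, X`_j⁆ = X`_l) ->
  \dim (derived A) = size T.
Proof.
move=> sok Xd Xs dA brE Tu Td sT Tbr.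
have Xt : size X == d.+1 by exact/eqP.
pose Y := Tuple Xt.
have Yb : basis_of fullv Y by rewrite basisEdim Xs subvv /= Xd dA.
have Yf := basis_free Yb.
pose U := <<[seq X`_l | l <- T]>>%VS.
have brU i j : (i < j <= d)%N -> ⁅X`_i, X`_j⁆ \in U.
  move=> ij; rewrite brE //; elim: s sT {brE sok} => [|[[[p q] l] c] s IH] /=; first by rewrite mem0v.
  case/andP=> lT /IH {}IH; case: ifP => // _; apply: memvD => //; apply/memvZ/memv_span.
  by apply: map_f.
have -> : derived A = U.
  apply/eqP; rewrite eqEsubv; apply/andP; split; last first.
    apply/span_subvP => _ /mapP[l /Tbr[i [j [_ ijl]]] ->]; rewrite -ijl; exact: mem_derived.
  apply: derived_sub => x y.
  rewrite (coord_basis Yb (memvf x)) (coord_basis Yb (memvf y)) lie_br_lcomb_l memv_suml // => i _.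
  rewrite memvZ // lie_br_lcomb_r memv_suml // => j _; rewrite memvZ //=.
  have [ij|ji|->] := ltngtP i j; last by rewrite lie_brxx mem0v.
    by apply: brU; rewrite ij -ltnS ltn_ord.
  by rewrite lie_brC memvN; apply: brU; rewrite ji -ltnS ltn_ord.
have : free [seq X`_l | l <- T].
  have st : size [seq X`_l | l <- T] == size T by rewrite size_map.
  apply/(freeP (X := Tuple st)) => c /= c0 i.
  have iT : (nth 0%N T i) \in T by apply: mem_nth.
  have lt : ((nth 0%N T i) < d.+1)%N by rewrite ltnS; move/allP: Td; apply.
  have := congr1 (coord Y (Ordinal lt)) c0.
  rewrite linear0 linear_sum (bigD1 i) //= big1 ?addr0 => [|j ji].
    rewrite (nth_map 0%N) // linearZ /= (coord_free (Ordinal lt) (X := Y)) // eqxx mulr1.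
    by [].
  rewrite (nth_map 0%N) // linearZ /=.
  have jT : ((nth 0%N T j) < d.+1)%N by rewrite ltnS; move/allP: Td; apply; apply: mem_nth.
  rewrite (coord_free (Ordinal jT) (X := Y)) // -val_eqE /= (nth_uniq _ _ _ Tu) //.
  by rewrite [_ == _ :> nat](negPf ji) mulr0.
by rewrite /free size_map => /eqP.
Qed.

Lemma table_basis d (t : lie_table k d.+1) s
    (X := [seq delta_mx 0 (inord i) : table_lie t | i <- iota 0 d.+1]) :
  entries t = table d s -> table_ok d s ->
  [/\ size X = d.+1, <<X>>%VS = fullv, \dim {: table_lie t} = d.+1 &
    forall i j, (i < j <= d)%N -> ⁅X`_i, X`_j⁆ = table_bracket X s i j].
Proof.
move=> tE sok; have XE i : (i <= d)%N -> X`_i = delta_mx 0 (inord i).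
  by move=> id; rewrite (nth_map 0%N) ?size_iota // nth_iota.
split=> [||| i j ij]; rewrite ?size_map ?size_iota ?dim_table //.
  apply/vspaceP => u; rewrite memvf [u]row_sum_delta; apply: memv_suml => i _.
  apply/memvZ/memv_span; apply/mapP; exists (val i); last by rewrite inord_val.
  by rewrite mem_iota /= add0n.
rewrite !XE; [|lia|lia]; rewrite (table_basis_br tE sok) //.
elim: s sok {tE} => [|[[[p q] l] c] s IH] //= /andP[/and3P[/= pq qd ld] /IH ->].
by rewrite XE.
Qed.

(** [T] lists the positions of a basis of the derived subalgebra, and the numerical hypothesis is
    the equation that defines [s]. *)
Lemma table_lie_s d (A : finLieType k) s (X : seq A) z (P : nat -> nat * nat) (T : seq nat) r :
  table_ok d s -> [/\ size X = d.+1, <<X>>%VS = fullv, \dim {:A} = d.+1 &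
    forall i j, (i < j <= d)%N -> ⁅X`_i, X`_j⁆ = table_bracket X s i j] ->
  (z + r + d.+1 = 'C(d.+1, 2) + size T + 2)%N ->
  [&& uniq T, all (fun l => l <= d)%N T & all (fun e => e.1.2.-1 \in T) s] ->
  (forall l, l \in T -> exists i j, (i < j <= d)%N /\
    table_bracket X s i j = X`_l) ->
  (forall n, (n < z)%N -> ((P n).1 < (P n).2 <= d)%N) ->
  (forall F, (forall i j l, (i < j < l)%N -> (l <= d)%N -> table_jac s F i j l = 0) ->
     (forall n, (n < z)%N -> F (P n).1 (P n).2 = 0) ->
     forall i j, (i < j <= d)%N -> F i j = 0) ->
  (forall c : nat -> k, exists F,
     (forall i j l, (i < j < l)%N -> (l <= d)%N -> table_jac s F i j l = 0) /\
     (forall n, (n < z)%N -> F (P n).1 (P n).2 = c n)) ->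
  lie_s A r /\ \dim (derived A) = size T.
Proof.
move=> sok [Xd Xs dA brE] zr /and3P[Tu Td sT] Tbr Pok inj sur.
have dD : \dim (derived A) = size T.
  apply: (table_derived_dim sok Xd Xs dA brE Tu Td sT) => l /Tbr[i [j [ij ijl]]].
  by exists i, j; rewrite brE.
split=> //; exists z; last by rewrite dA dD.
exact: (table_cocycle_dim sok Xd Xs dA brE Pok inj sur).
Qed.

End Tables.

Lemma scale_unit (k : fieldType) (V : lmodType k) (v : V) : 1 *: v + 0 = v.
Proof. by rewrite addr0 scale1r. Qed.

(** * The values of [s] for the named algebras *)

Section NamedTables.
Variable k : fieldType.

Let table_form (l : seq (nat * nat * k)) (i j : nat) : k :=
  foldr (fun x a => if (x.1.1 == i) && (x.1.2 == j) then x.2 else a) 0 l.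

(** Replaces the right-hand 0 by [c] times a vanishing Jacobi sum. The sign [c] is that of the
    wanted entry in this sum, so [ring] concludes once the other entries are known to be 0. *)
Local Ltac jacobi J c :=
  let J0 := fresh in
  have J0 := J; rewrite /table_jac /table_val /upper /= in J0; rewrite -[RHS](mulr0 c) -J0.

Let heis_E1 : heis_entries k 1 = table 2 [:: (2, 3, 1, 1%R)]%N.
Proof.
by rewrite /heis_entries /table /=; congr [:: (_, _, _, _)]; apply: val_inj; rewrite /= inordK.
Qed.

(** The pattern of all these computations: [P] lists independent entries of a cocycle. When they
    vanish, the Jacobi sums kill the other entries; conversely, arbitrary values at [P] are
    completed by the entries that the Jacobi sums prescribe. *)
Lemma Heis1_s : lie_s (Heis k 1) 0 /\ \dim (derived (Heis k 1)) = 1%N.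
Proof.
have tE := @table_basis _ 2 (LieTable (@heis_jacobi k 1)) _ heis_E1 isT.
apply: (table_lie_s (z := 3) (P := nth (0, 0)%N [:: (0, 1); (0, 2); (1, 2)]%N) (T := [:: 0]%N) _ tE) => //.
- move=> l; rewrite inE => /eqP ->; exists 1%N, 2%N; split=> //=; exact: scale_unit.
- by move=> n; do 3 (case: n => [|n] //=).
- move=> F FJ F0.
  have Z := (F0 0%N isT, F0 1%N isT, F0 2%N isT).
  by case=> [|[|[|i]]] [|[|[|j]]] //=; rewrite ?andbF ?Z.
move=> c; exists (table_form [:: (0%N, 1%N, c 0%N); (0%N, 2%N, c 1%N); (1%N, 2%N, c 2%N)]); split;
  last first.
  by move=> n; do 3 (case: n => [|n] //=).
by case=> [|[|[|i]]] [|[|[|j]]] [|[|[|l]]] //=; rewrite ?andbF // => _ _;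
  rewrite /table_jac /table_val /upper /=; ring.
Qed.

Lemma L4_3_s : lie_s (L4_3 k) 2 /\ \dim (derived (L4_3 k)) = 2%N.
Proof.
have tE := @table_basis _ 3 (LieTable (@L4_3_jacobi k)) _ erefl isT.
apply: (table_lie_s (z := 4) (P := nth (0, 0)%N [:: (0, 1); (0, 2); (0, 3); (1, 2)]%N) (T := [:: 2;
  3]%N) _ tE) => //.
- move=> l; rewrite !inE => /orP[] /eqP ->; [exists 0%N, 1%N | exists 0%N, 2%N]; split=> //=;
  exact: scale_unit.
- by move=> n; do 4 (case: n => [|n] //=).
- move=> F FJ F0.
  have Z := (F0 0%N isT, F0 1%N isT, F0 2%N isT, F0 3%N isT).
  have F13 : F 1%N 3%N = 0 by jacobi (FJ 0 1 2 isT isT)%N (1 : k); rewrite ?Z ; ring.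
  have F23 : F 2%N 3%N = 0 by jacobi (FJ 0 1 3 isT isT)%N (1 : k); rewrite ?Z ; ring.
  by case=> [|[|[|[|i]]]] [|[|[|[|j]]]] //=; rewrite ?andbF ?Z.
move=> c; exists (table_form [:: (0%N, 1%N, c 0%N); (0%N, 2%N, c 1%N); (0%N, 3%N, c 2%N);
  (1%N, 2%N, c 3%N)]); split; last first.
  by move=> n; do 4 (case: n => [|n] //=).
by case=> [|[|[|[|i]]]] [|[|[|[|j]]]] [|[|[|[|l]]]] //=; rewrite ?andbF // => _ _;
  rewrite /table_jac /table_val /upper /=; ring.
Qed.

Lemma L5_5_s : lie_s (L5_5 k) 3 /\ \dim (derived (L5_5 k)) = 2%N.
Proof.
have tE := @table_basis _ 4 (LieTable (@L5_5_jacobi k)) _ erefl isT.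
apply: (table_lie_s (z := 6) (P := nth (0, 0)%N [:: (0, 1); (0, 2); (0, 3); (0, 4); (1, 2);
  (1, 3)]%N) (T := [:: 2; 4]%N) _ tE) => //.
- move=> l; rewrite !inE => /orP[] /eqP ->; [exists 0%N, 1%N | exists 0%N, 2%N]; split=> //=;
  exact: scale_unit.
- by move=> n; do 6 (case: n => [|n] //=).
- move=> F FJ F0.
  have Z := (F0 0%N isT, F0 1%N isT, F0 2%N isT, F0 3%N isT, F0 4%N isT, F0 5%N isT).
  have F14 : F 1%N 4%N = 0 by jacobi (FJ 0 1 2 isT isT)%N (1 : k); rewrite ?Z ; ring.
  have F24 : F 2%N 4%N = 0 by jacobi (FJ 0 1 4 isT isT)%N (1 : k); rewrite ?Z ; ring.
  have F34 : F 3%N 4%N = 0 by jacobi (FJ 0 2 3 isT isT)%N ((-1) : k); rewrite ?Z ; ring.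
  have F23 : F 2%N 3%N = 0 by jacobi (FJ 0 1 3 isT isT)%N (1 : k); rewrite ?Z ; ring.
  by case=> [|[|[|[|[|i]]]]] [|[|[|[|[|j]]]]] //=; rewrite ?andbF ?Z.
move=> c; exists (table_form [:: (0%N, 1%N, c 0%N); (0%N, 2%N, c 1%N); (0%N, 3%N, c 2%N);
  (0%N, 4%N, c 3%N); (1%N, 2%N, c 4%N); (1%N, 3%N, c 5%N); (2%N, 3%N, c 3%N)]); split; last first.
  by move=> n; do 6 (case: n => [|n] //=).
by case=> [|[|[|[|[|i]]]]] [|[|[|[|[|j]]]]] [|[|[|[|[|l]]]]] //=; rewrite ?andbF // => _ _;
  rewrite /table_jac /table_val /upper /=; ring.
Qed.

Lemma L5_6_s : lie_s (L5_6 k) 4 /\ \dim (derived (L5_6 k)) = 3%N.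
Proof.
have tE := @table_basis _ 4 (LieTable (@L5_6_jacobi k)) _ erefl isT.
apply: (table_lie_s (z := 6) (P := nth (0, 0)%N [:: (0, 1); (0, 2); (0, 3); (0, 4); (1, 2);
  (1, 4)]%N) (T := [:: 2; 3; 4]%N) _ tE) => //.
- move=> l; rewrite !inE => /or3P[] /eqP ->; [exists 0%N, 1%N | exists 0%N, 2%N | exists 0%N, 3%N];
  split=> //=; exact: scale_unit.
- by move=> n; do 6 (case: n => [|n] //=).
- move=> F FJ F0.
  have Z := (F0 0%N isT, F0 1%N isT, F0 2%N isT, F0 3%N isT, F0 4%N isT, F0 5%N isT).
  have F24 : F 2%N 4%N = 0 by jacobi (FJ 0 1 4 isT isT)%N (1 : k); rewrite ?Z ; ring.
  have F34 : F 3%N 4%N = 0 by jacobi (FJ 0 2 4 isT isT)%N (1 : k); rewrite ?Z ; ring.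
  have F13 : F 1%N 3%N = 0 by jacobi (FJ 0 1 2 isT isT)%N (1 : k); rewrite ?Z ; ring.
  have F23 : F 2%N 3%N = 0 by jacobi (FJ 0 1 3 isT isT)%N (1 : k); rewrite ?Z ; ring.
  by case=> [|[|[|[|[|i]]]]] [|[|[|[|[|j]]]]] //=; rewrite ?andbF ?Z.
move=> c; exists (table_form [:: (0%N, 1%N, c 0%N); (0%N, 2%N, c 1%N); (0%N, 3%N, c 2%N);
  (0%N, 4%N, c 3%N); (1%N, 2%N, c 4%N); (1%N, 3%N, c 3%N); (1%N, 4%N, c 5%N);
    (2%N, 3%N, - c 5%N)]); split; last first.
  by move=> n; do 6 (case: n => [|n] //=).
by case=> [|[|[|[|[|i]]]]] [|[|[|[|[|j]]]]] [|[|[|[|[|l]]]]] //=; rewrite ?andbF // => _ _;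
  rewrite /table_jac /table_val /upper /=; ring.
Qed.

Lemma L5_7_s : lie_s (L5_7 k) 4 /\ \dim (derived (L5_7 k)) = 3%N.
Proof.
have tE := @table_basis _ 4 (LieTable (@L5_7_jacobi k)) _ erefl isT.
apply: (table_lie_s (z := 6) (P := nth (0, 0)%N [:: (0, 1); (0, 2); (0, 3); (0, 4); (1, 2);
  (1, 4)]%N) (T := [:: 2; 3; 4]%N) _ tE) => //.
- move=> l; rewrite !inE => /or3P[] /eqP ->; [exists 0%N, 1%N | exists 0%N, 2%N | exists 0%N, 3%N];
  split=> //=; exact: scale_unit.
- by move=> n; do 6 (case: n => [|n] //=).
- move=> F FJ F0.
  have Z := (F0 0%N isT, F0 1%N isT, F0 2%N isT, F0 3%N isT, F0 4%N isT, F0 5%N isT).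
  have F13 : F 1%N 3%N = 0 by jacobi (FJ 0 1 2 isT isT)%N (1 : k); rewrite ?Z ; ring.
  have F24 : F 2%N 4%N = 0 by jacobi (FJ 0 1 4 isT isT)%N (1 : k); rewrite ?Z ; ring.
  have F34 : F 3%N 4%N = 0 by jacobi (FJ 0 2 4 isT isT)%N (1 : k); rewrite ?Z ; ring.
  have F23 : F 2%N 3%N = 0 by jacobi (FJ 0 1 3 isT isT)%N (1 : k); rewrite ?Z ; ring.
  by case=> [|[|[|[|[|i]]]]] [|[|[|[|[|j]]]]] //=; rewrite ?andbF ?Z.
move=> c; exists (table_form [:: (0%N, 1%N, c 0%N); (0%N, 2%N, c 1%N); (0%N, 3%N, c 2%N);
  (0%N, 4%N, c 3%N); (1%N, 2%N, c 4%N); (1%N, 4%N, c 5%N); (2%N, 3%N, - c 5%N)]); split; last first.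
  by move=> n; do 6 (case: n => [|n] //=).
by case=> [|[|[|[|[|i]]]]] [|[|[|[|[|j]]]]] [|[|[|[|[|l]]]]] //=; rewrite ?andbF // => _ _;
  rewrite /table_jac /table_val /upper /=; ring.
Qed.

Lemma L5_8_s : lie_s (L5_8 k) 1 /\ \dim (derived (L5_8 k)) = 2%N.
Proof.
have tE := @table_basis _ 4 (LieTable (@L5_8_jacobi k)) _ erefl isT.
apply: (table_lie_s (z := 8) (P := nth (0, 0)%N [:: (0, 1); (0, 2); (0, 3); (0, 4); (1, 2); (1, 3);
  (1, 4); (2, 4)]%N) (T := [:: 3; 4]%N) _ tE) => //.
- move=> l; rewrite !inE => /orP[] /eqP ->; [exists 0%N, 1%N | exists 0%N, 2%N]; split=> //=;
  exact: scale_unit.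
- by move=> n; do 8 (case: n => [|n] //=).
- move=> F FJ F0.
  have Z := (F0 0%N isT, F0 1%N isT, F0 2%N isT, F0 3%N isT, F0 4%N isT, F0 5%N isT, F0 6%N isT, F0
    7%N isT).
  have F34 : F 3%N 4%N = 0 by jacobi (FJ 0 1 4 isT isT)%N (1 : k); rewrite ?Z ; ring.
  have F23 : F 2%N 3%N = 0 by jacobi (FJ 0 1 2 isT isT)%N ((-1) : k); rewrite ?Z ; ring.
  by case=> [|[|[|[|[|i]]]]] [|[|[|[|[|j]]]]] //=; rewrite ?andbF ?Z.
move=> c; exists (table_form [:: (0%N, 1%N, c 0%N); (0%N, 2%N, c 1%N); (0%N, 3%N, c 2%N);
  (0%N, 4%N, c 3%N); (1%N, 2%N, c 4%N); (1%N, 3%N, c 5%N); (1%N, 4%N, c 6%N); (2%N, 3%N, c 6%N);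
    (2%N, 4%N, c 7%N)]); split; last first.
  by move=> n; do 8 (case: n => [|n] //=).
by case=> [|[|[|[|[|i]]]]] [|[|[|[|[|j]]]]] [|[|[|[|[|l]]]]] //=; rewrite ?andbF // => _ _;
  rewrite /table_jac /table_val /upper /=; ring.
Qed.

Lemma L5_9_s : lie_s (L5_9 k) 4 /\ \dim (derived (L5_9 k)) = 3%N.
Proof.
have tE := @table_basis _ 4 (LieTable (@L5_9_jacobi k)) _ erefl isT.
apply: (table_lie_s (z := 6) (P := nth (0, 0)%N [:: (0, 1); (0, 2); (0, 3); (0, 4); (1, 2);
  (1, 4)]%N) (T := [:: 2; 3; 4]%N) _ tE) => //.
- move=> l; rewrite !inE => /or3P[] /eqP ->; [exists 0%N, 1%N | exists 0%N, 2%N | exists 1%N, 2%N];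
  split=> //=; exact: scale_unit.
- by move=> n; do 6 (case: n => [|n] //=).
- move=> F FJ F0.
  have Z := (F0 0%N isT, F0 1%N isT, F0 2%N isT, F0 3%N isT, F0 4%N isT, F0 5%N isT).
  have F23 : F 2%N 3%N = 0 by jacobi (FJ 0 1 3 isT isT)%N (1 : k); rewrite ?Z ; ring.
  have F24 : F 2%N 4%N = 0 by jacobi (FJ 0 1 4 isT isT)%N (1 : k); rewrite ?Z ; ring.
  have F34 : F 3%N 4%N = 0 by jacobi (FJ 0 2 4 isT isT)%N (1 : k); rewrite ?Z ; ring.
  have F13 : F 1%N 3%N = 0 by jacobi (FJ 0 1 2 isT isT)%N (1 : k); rewrite ?Z ; ring.
  by case=> [|[|[|[|[|i]]]]] [|[|[|[|[|j]]]]] //=; rewrite ?andbF ?Z.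
move=> c; exists (table_form [:: (0%N, 1%N, c 0%N); (0%N, 2%N, c 1%N); (0%N, 3%N, c 2%N);
  (0%N, 4%N, c 3%N); (1%N, 2%N, c 4%N); (1%N, 3%N, c 3%N); (1%N, 4%N, c 5%N)]); split; last first.
  by move=> n; do 6 (case: n => [|n] //=).
by case=> [|[|[|[|[|i]]]]] [|[|[|[|[|j]]]]] [|[|[|[|[|l]]]]] //=; rewrite ?andbF // => _ _;
  rewrite /table_jac /table_val /upper /=; ring.
Qed.

Lemma L6_10_s : lie_s (L6_10 k) 5 /\ \dim (derived (L6_10 k)) = 2%N.
Proof.
have tE := @table_basis _ 5 (LieTable (@L6_10_jacobi k)) _ erefl isT.
apply: (table_lie_s (z := 8) (P := nth (0, 0)%N [:: (0, 1); (0, 2); (0, 3); (0, 4); (1, 2); (1, 3);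
  (1, 4); (3, 4)]%N) (T := [:: 2; 5]%N) _ tE) => //.
- move=> l; rewrite !inE => /orP[] /eqP ->; [exists 0%N, 1%N | exists 0%N, 2%N]; split=> //=;
  exact: scale_unit.
- by move=> n; do 8 (case: n => [|n] //=).
- move=> F FJ F0.
  have Z := (F0 0%N isT, F0 1%N isT, F0 2%N isT, F0 3%N isT, F0 4%N isT, F0 5%N isT, F0 6%N isT, F0
    7%N isT).
  have F15 : F 1%N 5%N = 0 by jacobi (FJ 0 1 2 isT isT)%N (1 : k); rewrite ?Z ; ring.
  have F23 : F 2%N 3%N = 0 by jacobi (FJ 0 1 3 isT isT)%N (1 : k); rewrite ?Z ; ring.
  have F24 : F 2%N 4%N = 0 by jacobi (FJ 0 1 4 isT isT)%N (1 : k); rewrite ?Z ; ring.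
  have F25 : F 2%N 5%N = 0 by jacobi (FJ 0 1 5 isT isT)%N (1 : k); rewrite ?Z ; ring.
  have F35 : F 3%N 5%N = 0 by jacobi (FJ 0 2 3 isT isT)%N ((-1) : k); rewrite ?Z ; ring.
  have F45 : F 4%N 5%N = 0 by jacobi (FJ 0 2 4 isT isT)%N ((-1) : k); rewrite ?Z ; ring.
  have F05 : F 0%N 5%N = 0 by jacobi (FJ 0 3 4 isT isT)%N ((-1) : k); rewrite ?Z ; ring.
  by case=> [|[|[|[|[|[|i]]]]]] [|[|[|[|[|[|j]]]]]] //=; rewrite ?andbF ?Z.
move=> c; exists (table_form [:: (0%N, 1%N, c 0%N); (0%N, 2%N, c 1%N); (0%N, 3%N, c 2%N);
  (0%N, 4%N, c 3%N); (1%N, 2%N, c 4%N); (1%N, 3%N, c 5%N); (1%N, 4%N, c 6%N); (3%N, 4%N, c 7%N)]);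
    split; last first.
  by move=> n; do 8 (case: n => [|n] //=).
by case=> [|[|[|[|[|[|i]]]]]] [|[|[|[|[|[|j]]]]]] [|[|[|[|[|[|l]]]]]] //=;
  rewrite ?andbF // => _ _; rewrite /table_jac /table_val /upper /=; ring.
Qed.

(** Of the 15 entries, 10 are free for every [eps], zero included, so [s] is constant on the
    family. *)
Lemma L6_22_s (eps : k) : lie_s (L6_22 eps) 3 /\ \dim (derived (L6_22 eps)) = 2%N.
Proof.
have tE := @table_basis _ 5 (LieTable (@L6_22_jacobi k eps)) _ erefl isT.
apply: (table_lie_s (z := 10) (P := nth (0, 0)%N [:: (0, 1); (0, 2); (0, 3); (0, 4); (0, 5);
  (1, 2); (1, 3); (1, 5); (2, 3); (2, 5)]%N) (T := [:: 4; 5]%N) _ tE) => //.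
- move=> l; rewrite !inE => /orP[] /eqP ->; [exists 0%N, 1%N | exists 0%N, 2%N]; split=> //=;
  exact: scale_unit.
- by move=> n; do 10 (case: n => [|n] //=).
- move=> F FJ F0.
  have Z := (F0 0%N isT, F0 1%N isT, F0 2%N isT, F0 3%N isT, F0 4%N isT, F0 5%N isT, F0 6%N isT, F0
    7%N isT, F0 8%N isT, F0 9%N isT).
  have F45 : F 4%N 5%N = 0 by jacobi (FJ 0 1 5 isT isT)%N (1 : k); rewrite ?Z ; ring.
  have F24 : F 2%N 4%N = 0 by jacobi (FJ 0 1 2 isT isT)%N ((-1) : k); rewrite ?Z ; ring.
  have F34 : F 3%N 4%N = 0 by jacobi (FJ 0 1 3 isT isT)%N ((-1) : k); rewrite ?Z ; ring.
  have F35 : F 3%N 5%N = 0 by jacobi (FJ 0 2 3 isT isT)%N ((-1) : k); rewrite ?Z ; ring.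
  have F14 : F 1%N 4%N = 0 by jacobi (FJ 1 2 3 isT isT)%N ((-1) : k); rewrite ?Z ; ring.
  by case=> [|[|[|[|[|[|i]]]]]] [|[|[|[|[|[|j]]]]]] //=; rewrite ?andbF ?Z.
move=> c; exists (table_form [:: (0%N, 1%N, c 0%N); (0%N, 2%N, c 1%N); (0%N, 3%N, c 2%N);
  (0%N, 4%N, c 3%N); (0%N, 5%N, c 4%N); (1%N, 2%N, c 5%N); (1%N, 3%N, c 6%N);
    (1%N, 4%N, eps * c 9%N); (1%N, 5%N, c 7%N); (2%N, 3%N, c 8%N); (2%N, 4%N, c 7%N);
      (2%N, 5%N, c 9%N); (3%N, 4%N, - eps * c 4%N); (3%N, 5%N, - c 3%N)]); split; last first.
  by move=> n; do 10 (case: n => [|n] //=).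
by case=> [|[|[|[|[|[|i]]]]]] [|[|[|[|[|[|j]]]]]] [|[|[|[|[|[|l]]]]]] //=;
  rewrite ?andbF // => _ _; rewrite /table_jac /table_val /upper /=; ring.
Qed.

Lemma L37A_s : lie_s (L37A k) 4 /\ \dim (derived (L37A k)) = 3%N.
Proof.
have tE := @table_basis _ 6 (LieTable (@L37A_jacobi k)) _ erefl isT.
apply: (table_lie_s (z := 15) (P := nth (0, 0)%N [:: (0, 1); (0, 2); (0, 3); (0, 4); (0, 5);
  (0, 6); (1, 2); (1, 3); (1, 4); (1, 5); (1, 6); (2, 3); (2, 5); (2, 6); (3, 6)]%N) (T := [:: 4;
    5; 6]%N) _ tE) => //.
- move=> l; rewrite !inE => /or3P[] /eqP ->; [exists 0%N, 1%N | exists 1%N, 2%N | exists 1%N, 3%N];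
  split=> //=; exact: scale_unit.
- by move=> n; do 15 (case: n => [|n] //=).
- move=> F FJ F0.
  have Z := (F0 0%N isT, F0 1%N isT, F0 2%N isT, F0 3%N isT, F0 4%N isT, F0 5%N isT, F0 6%N isT, F0
    7%N isT, F0 8%N isT, F0 9%N isT, F0 10%N isT, F0 11%N isT, F0 12%N isT, F0 13%N isT, F0 14%N isT).
  have F45 : F 4%N 5%N = 0 by jacobi (FJ 0 1 5 isT isT)%N (1 : k); rewrite ?Z ; ring.
  have F46 : F 4%N 6%N = 0 by jacobi (FJ 0 1 6 isT isT)%N (1 : k); rewrite ?Z ; ring.
  have F56 : F 5%N 6%N = 0 by jacobi (FJ 1 2 6 isT isT)%N (1 : k); rewrite ?Z ; ring.
  have F24 : F 2%N 4%N = 0 by jacobi (FJ 0 1 2 isT isT)%N ((-1) : k); rewrite ?Z ; ring.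
  have F34 : F 3%N 4%N = 0 by jacobi (FJ 0 1 3 isT isT)%N ((-1) : k); rewrite ?Z ; ring.
  have F35 : F 3%N 5%N = 0 by jacobi (FJ 1 2 3 isT isT)%N ((-1) : k); rewrite ?Z ; ring.
  by case=> [|[|[|[|[|[|[|i]]]]]]] [|[|[|[|[|[|[|j]]]]]]] //=; rewrite ?andbF ?Z.
move=> c; exists (table_form [:: (0%N, 1%N, c 0%N); (0%N, 2%N, c 1%N); (0%N, 3%N, c 2%N);
  (0%N, 4%N, c 3%N); (0%N, 5%N, c 4%N); (0%N, 6%N, c 5%N); (1%N, 2%N, c 6%N); (1%N, 3%N, c 7%N);
    (1%N, 4%N, c 8%N); (1%N, 5%N, c 9%N); (1%N, 6%N, c 10%N); (2%N, 3%N, c 11%N);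
      (2%N, 4%N, - c 4%N); (2%N, 5%N, c 12%N); (2%N, 6%N, c 13%N); (3%N, 4%N, - c 5%N);
        (3%N, 5%N, c 13%N); (3%N, 6%N, c 14%N)]); split; last first.
  by move=> n; do 15 (case: n => [|n] //=).
by case=> [|[|[|[|[|[|[|i]]]]]]] [|[|[|[|[|[|[|j]]]]]]] [|[|[|[|[|[|[|l]]]]]]] //=;
  rewrite ?andbF // => _ _; rewrite /table_jac /table_val /upper /=; ring.
Qed.

(** The free nilpotent algebra of class two on three generators. It is a candidate in the case
    [a = 3], where [s = 4] is required and [s = 3] rules it out. *)
Lemma free_class2_rank3_s (A : finLieType k) (X : seq A) :
  [/\ size X = 6, <<X>>%VS = fullv, \dim {:A} = 6%N &
    forall i j, (i < j <= 5)%N -> ⁅X`_i, X`_j⁆ =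
      table_bracket X ([:: (1, 2, 4, 1%R); (1, 3, 5, 1%R);
        (2, 3, 6, 1%R)]%N : seq (nat * nat * nat * k)) i j] ->
  lie_s A 3 /\ \dim (derived A) = 3%N.
Proof.
move=> XB; apply: (@table_lie_s _ _ _ _ _ 11 (nth (0, 0)%N [:: (0, 1); (0, 2); (0, 3); (0, 4);
  (0, 5); (1, 2); (1, 3); (1, 4); (1, 5); (2, 4); (2, 5)]%N) [:: 3; 4; 5]%N 3 _ XB) => //.
- move=> l; rewrite !inE => /or3P[] /eqP ->; [exists 0%N, 1%N | exists 0%N, 2%N | exists 1%N, 2%N];
  split=> //=; exact: scale_unit.
- by move=> n; do 11 (case: n => [|n] //=).
- move=> F FJ F0.
  have Z := (F0 0%N isT, F0 1%N isT, F0 2%N isT, F0 3%N isT, F0 4%N isT, F0 5%N isT, F0 6%N isT, F0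
    7%N isT, F0 8%N isT, F0 9%N isT, F0 10%N isT).
  have F34 : F 3%N 4%N = 0 by jacobi (FJ 0 1 4 isT isT)%N (1 : k); rewrite ?Z ; ring.
  have F35 : F 3%N 5%N = 0 by jacobi (FJ 0 1 5 isT isT)%N (1 : k); rewrite ?Z ; ring.
  have F45 : F 4%N 5%N = 0 by jacobi (FJ 0 2 5 isT isT)%N (1 : k); rewrite ?Z ; ring.
  have F23 : F 2%N 3%N = 0 by jacobi (FJ 0 1 2 isT isT)%N ((-1) : k); rewrite ?Z ; ring.
  by case=> [|[|[|[|[|[|i]]]]]] [|[|[|[|[|[|j]]]]]] //=; rewrite ?andbF ?Z.
move=> c; exists (table_form [:: (0%N, 1%N, c 0%N); (0%N, 2%N, c 1%N); (0%N, 3%N, c 2%N);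
  (0%N, 4%N, c 3%N); (0%N, 5%N, c 4%N); (1%N, 2%N, c 5%N); (1%N, 3%N, c 6%N); (1%N, 4%N, c 7%N);
    (1%N, 5%N, c 8%N); (2%N, 3%N, - c 4%N + c 7%N); (2%N, 4%N, c 9%N); (2%N, 5%N, c 10%N)]); split;
      last first.
  by move=> n; do 11 (case: n => [|n] //=).
by case=> [|[|[|[|[|[|i]]]]]] [|[|[|[|[|[|j]]]]]] [|[|[|[|[|[|l]]]]]] //=;
  rewrite ?andbF // => _ _; rewrite /table_jac /table_val /upper /=; ring.
Qed.

End NamedTables.

(** * Derived subalgebra of dimension one *)

Section Heisenberg.
Variables (k : fieldType).

(** Up to the factor [z] the bracket is an alternating form on [U]. A pair with [[x, y] = z] is
    split off, the induction continues in its orthogonal space [U'], and [W] is the radical. *)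
Lemma symplectic_basis (A : finLieType k) (z : A) (U : {vspace A}) :
  lie_central z -> (forall x y, ⁅x, y⁆ \in <[z]>%VS) ->
  exists (r : nat) (X : seq A) (W : {vspace A}),
    [/\ size X = r.*2, U = (<<X>> + W)%VS, (r.*2 + \dim W <= \dim U)%N,
        forall w u, w \in W -> u \in U -> ⁅w, u⁆ = 0 &
        forall i j, (i < r.*2)%N -> (j < r.*2)%N -> ⁅X`_i, X`_j⁆ =
          ((~~ odd i && (j == i.+1))%:R - (~~ odd j && (i == j.+1))%:R) *: z].
Proof.
move=> zc Az; move: {2}(\dim U).+1 (ltnSn (\dim U)) => n; elim: n U => // n IH U dU.
case: (classic (exists x y, [/\ x \in U, y \in U & ⁅x, y⁆ != 0])); last first.
  move=> H; exists 0%N, [::], U; split=> //; first by rewrite span_nil add0v.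
  move=> w u wU uU; apply/eqP; apply: contra_notT H => wu; by exists w, u.
case=> x0 [y [xU0 yU xy0]]; have /vlineP[c xyE] := Az x0 y.
have c0 : c != 0 by apply: contra_neq xy0 => c0; rewrite xyE c0 scale0r.
have [x xU xy] : exists2 x, x \in U & ⁅x, y⁆ = z.
  by exists (c^-1 *: x0); rewrite ?memvZ // lie_brZl xyE scalerA mulVf // scale1r.
have z0 : z != 0 by apply: contra_neq xy0 => z0; rewrite xyE z0 scaler0.
have yx : ⁅y, x⁆ = - z by rewrite lie_brC xy.
have [||U' UE'] := @vspace_of_prop k A (fun u => [/\ u \in U, ⁅u, x⁆ = 0 & ⁅u, y⁆ = 0]).
- by split; rewrite ?mem0v ?lie_br0l.
- move=> a u v [uU ux uy] [vU vx vy]; split; rewrite ?memvD ?memvZ //.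
    by rewrite lie_brDZl ux vx scaler0 addr0.
  by rewrite lie_brDZl uy vy scaler0 addr0.
have UE : U = (<<[:: x; y]>> + U')%VS.
  apply/eqP; rewrite eqEsubv; apply/andP; split; apply/subvP => u; last first.
    case/memv_addP=> v vX [w /UE'[wU _ _] ->]; apply: memvD => //.
    apply: subvP vX; apply/span_subvP => v'.
    by rewrite !inE => /orP[] /eqP ->.
  move=> uU; have /vlineP[a ua] := Az u x; have /vlineP[b ub] := Az u y.
  rewrite -[u](subrK (b *: x - a *: y)) addrC memv_add //.
    by rewrite memvB // memvZ // memv_span // !inE eqxx ?orbT.
  apply/UE'; split; first by rewrite !(memvB, memvZ).
    rewrite lie_brDl lie_brNl lie_brDl lie_brNl !lie_brZl ua lie_brxx yx.
    by rewrite scaler0 add0r scalerN opprK subrr.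
  rewrite lie_brDl lie_brNl lie_brDl lie_brNl !lie_brZl ub lie_brxx xy.
  by rewrite scaler0 subr0 subrr.
have xyU' a b : a *: x + b *: y \in U' -> a = 0 /\ b = 0.
  case/UE' => _; rewrite !lie_brDl !lie_brZl !lie_brxx xy yx !scaler0 add0r addr0 scalerN.
  by move=> /eqP; rewrite oppr_eq0 !scaler_eq0 (negPf z0) orbF => /eqP -> /eqP;
     rewrite scaler_eq0 (negPf z0) orbF => /eqP ->.
have capU' : (<<[:: x; y]>> :&: U' = 0)%VS.
  apply/eqP; rewrite -subv0; apply/subvP => u /memv_capP[].
  rewrite span_cons span_seq1 => /memv_addP[_ /vlineP[a ->] [_ /vlineP[b ->] ->]].
  by case/xyU' => -> ->; rewrite !scale0r addr0 mem0v.
have dxy : \dim <<[:: x; y]>> = 2%N.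
  suff : free [:: x; y] by rewrite /free => /eqP.
  rewrite free_cons seq1_free span_seq1; apply/andP; split.
    apply/vlineP => -[a xa]; have [] := xyU' 1 (- a).
      by rewrite scale1r {1}xa scaleNr subrr mem0v.
    by move/eqP; rewrite oner_eq0.
  by apply: contra_neq z0 => y0; rewrite -xy y0 lie_br0r.
have dUE : (\dim U = 2 + \dim U')%N by rewrite {1}UE dimv_disjoint_sum // dxy.
have [|r [X [W [Xr XW dW Wc Xbr]]]] := IH U'; first by lia.
have XU' i : (i < r.*2)%N -> X`_i \in U'.
  move=> ir; rewrite XW; apply: subvP (addvSl _ _) _ _; apply: memv_span; apply: mem_nth.
  by rewrite Xr.
have WU' w : w \in W -> w \in U' by move=> wW; rewrite XW; apply: subvP (addvSr _ _) _ wW.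
exists r.+1, [:: x, y & X], W; split=> /=; rewrite ?Xr ?doubleS //.
- by rewrite UE XW addvA -span_cat.
- by rewrite dUE; lia.
- move=> w u wW; rewrite {1}UE => /memv_addP[v vxy [u' uU' ->]].
  rewrite lie_brDr (Wc _ _ wW uU') addr0.
  have /UE'[_ wx wy] := WU' _ wW.
  move: vxy; rewrite span_cons span_seq1 => /memv_addP[_ /vlineP[a ->] [_ /vlineP[b ->] ->]].
  by rewrite lie_brDr !lie_brZr wx wy !scaler0 addr0.
- have X0 i : (i < r.*2)%N -> ⁅X`_i, x⁆ = 0 /\ ⁅X`_i, y⁆ = 0 by move=> /XU'/UE'[].
  case=> [|[|i]] [|[|j]] //=; rewrite ?ltnS ?eqSS ?negbK => ir jr.
  + by rewrite lie_brxx subrr scale0r.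
  + by rewrite xy subr0 scale1r.
  + by rewrite lie_brC (X0 j jr).1 andbF subrr scale0r oppr0.
  + by rewrite yx sub0r scaleN1r.
  + by rewrite lie_brxx subrr scale0r.
  + by rewrite lie_brC (X0 j jr).2 !andbF subrr scale0r oppr0.
  + by rewrite (X0 i ir).1 andbF subrr scale0r.
  + by rewrite (X0 i ir).2 !andbF subrr scale0r.
  + by rewrite Xbr.
Qed.

(** The radical on a complement of [z] is central, hence lies in [A^2 = <z>] and is 0. The
    symplectic basis together with [z] then satisfies the Heisenberg relations. *)
Lemma heis_stem (A : finLieType k) : lie_nilpotent A -> lie_stem A ->
  \dim (derived A) = 1%N -> exists r, [/\ (0 < r)%N, lie_iso A (Heis k r) & \dim {:A} = (2 * r).+1].
Proof.
move=> nA sA d1; have A0 : derived A != 0%VS by rewrite -dimv_eq0 d1.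
have [z [z0 zc zA _]] := nilpotent_central nA A0.
have Az : derived A = <[z]>%VS.
  by apply/esym/eqP; rewrite eqEdim d1 dim_vline z0 -memvE zA.
have brz x y : ⁅x, y⁆ \in <[z]>%VS by rewrite -Az mem_derived.
have [r [X [W [Xr XW dW Wc Xbr]]]] := symplectic_basis (<[z]>^C)%VS zc brz.
have W0 : W = 0%VS.
  apply/eqP; rewrite -subv0 -(capv_compl <[z]>); apply/subvP => w wW.
  apply/memv_capP; split; last by rewrite XW; apply: subvP (addvSr _ _) _ wW.
  rewrite -Az; apply: sA => x; have : x \in (<[z]> + <[z]>^C)%VS by rewrite addv_complf memvf.
  case/memv_addP=> _ /vlineP[a ->] [u uU ->].
  by rewrite lie_brDr lie_brZr (lie_centralr zc) scaler0 add0r (Wc _ _ wW).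
have dA : \dim {:A} = (2 * r).+1.
  have := dimv_compl <[z]>; rewrite dim_vline z0 subn1 => dC.
  have n1 : (1 <= \dim {:A})%N by rewrite -(_ : \dim <[z]> = 1%N) ?dimvS ?subvf // dim_vline z0.
  have : (\dim <[z]>^C <= r.*2)%N by rewrite XW W0 addv0 -Xr dim_span.
  move: dW; rewrite W0 dimv0 addn0 dC -[\dim {:A}]prednK // mul2n => le1 le2.
  by apply/eqP; rewrite eqSS eqn_leq le1 le2.
have r0 : (0 < r)%N.
  rewrite lt0n; apply/eqP => r0; case/eqP: A0; apply/eqP; rewrite -subv0.
  have A1 : \dim {:A} = 1%N by rewrite dA r0.
  have Af : fullv = <[z]>%VS.
    by apply/esym/eqP; rewrite eqEdim A1 dim_vline z0 -memvE memvf.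
  apply: derived_sub => x y; have : x \in {:A}%VS by exact: memvf.
  by rewrite Af => /vlineP[a ->]; rewrite lie_brZl zc scaler0 mem0v.
exists r; split=> //.
apply: (table_iso (X := z :: X)) => //; first by rewrite /= Xr mul2n.
  by rewrite span_cons -[RHS](addv_complf <[z]>) XW W0 addv0.
(* At most one pair [(2p - 1, 2p)] equals [(i, j)]; position 0 is the center, so the pairs start at
   odd positions. *)
have sumE i j : \sum_(p <- iota 1 r) (((2 * p).-1 == i) && (2 * p == j))%N%:R =
    (odd i && (j == i.+1) && (j <= r.*2)%N)%:R :> k.
  elim: r {Xr XW dW Xbr dA r0} => [|r IH].
    rewrite big_nil; case: j => [|j]; rewrite ?andbF //=.
  have -> : iota 1 r.+1 = iota 1 r ++ [:: r.+1] by rewrite -(addn1 r) iotaD add1n addn1.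
  rewrite big_cat /= IH big_seq1.
  rewrite -natrD; congr (_ %:R).
  have [->|ji] := eqVneq j i.+1; last first.
    by rewrite andbF /=; have -> : ((2 * r.+1).-1 == i) && (2 * r.+1 == j) = false by lia.
  have -> : ((2 * r.+1).-1 == i) && (2 * r.+1 == i.+1) = (i == r.*2.+1) by lia.
  have -> : (i < r.+1.*2)%N = (i < r.*2)%N || (i == r.*2) || (i == r.*2.+1) by lia.
  rewrite !andbT; have [->|_] := eqVneq i r.*2.+1.
    by rewrite /= odd_double /= (_ : (r.*2.+1 < r.*2)%N = false) ?orbT //; lia.
  rewrite orbF addn0; have [->|_] := eqVneq i r.*2; first by rewrite odd_double.
  by rewrite orbF.
have hE (i j : 'I_(2 * r).+1) : \sum_(e <- heis_entries k r) (let: (a, b, l, c) := e in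
     (c * ((a == i)%:R * (b == j)%:R - (b == i)%:R * (a == j)%:R)) *: (z :: X)`_l) =
    ((odd i && (j == i.+1 :> nat))%:R - (odd j && (i == j.+1 :> nat))%:R) *: z.
  have := sumE i j; rewrite -ltnS -mul2n ltn_ord andbT => <-.
  have := sumE j i; rewrite -[X in _ && _ && X]ltnS -mul2n ltn_ord andbT => <-.
  rewrite -sumrB scaler_suml /heis_entries big_map big_seq [RHS]big_seq.
  apply: eq_bigr => p; rewrite mem_iota => pr /=.
  rewrite -!val_eqE /= !inordK; [|lia|lia]; rewrite mul1r -!natrM !mulnb.
  by congr ((_ - _%:R) *: _); rewrite andbC.
move=> i j; rewrite hE.
have ib : (i < (2 * r).+1)%N by exact: ltn_ord.
have jb : (j < (2 * r).+1)%N by exact: ltn_ord.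
case: (i : nat) ib => [|i'] ib; case: (j : nat) jb => [|j'] jb /=.
- by rewrite lie_brxx subrr scale0r.
- by rewrite zc andbF subrr scale0r.
- by rewrite (lie_centralr zc) andbF subrr scale0r.
- by rewrite !eqSS Xbr //; lia.
Qed.

End Heisenberg.

(** * Derived subalgebra of dimension two *)

Section JointFunctionals.
Variables (k : fieldType) (V : vectType k).

Lemma joint_map r (f : 'I_r -> V -> k) : (forall i, flin (f i)) ->
  exists p : {linear V -> 'rV[k]_r}, forall x i, p x 0 i = f i x.
Proof.
move=> lf; have [|p pE] := @linear_ex _ V 'rV[k]_r (fun x => \row_i f i x).
  by move=> a x y; apply/rowP => i; rewrite !mxE lf.
by exists p => x i; rewrite pE mxE.
Qed.

(** Rank and nullity for the joint map to [k^r]; equality in the bound leaves no room for a proper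
    image. *)
Lemma joint_kernel_dim r (f : 'I_r -> V -> k) (W : {vspace V}) :
  (forall i, flin (f i)) -> (forall x, (forall i, f i x = 0) -> x \in W) ->
  (\dim {:V} <= r + \dim W)%N /\
  ((\dim {:V} = r + \dim W)%N -> forall c : 'I_r -> k, exists x, forall i, f i x = c i).
Proof.
move=> lf fW; have [p pE] := joint_map lf.
have kW : (lker (linfun p) <= W)%VS.
  apply/subvP => x; rewrite memv_ker lfunE => /eqP/= px; apply: fW => i.
  by rewrite -pE px mxE.
have := limg_ker_dim (linfun p) fullv; rewrite capfv => dE.
have dr : \dim {:'rV[k]_r} = r by rewrite dimvf /dim /= mul1n.
have := dimvS (subvf (limg (linfun p))); rewrite dr => le1.
have le2 := dimvS kW; split=> [|dV c]; first by lia.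
have : limg (linfun p) = fullv by apply/eqP; rewrite eqEdim subvf /= dr; lia.
move/vspaceP/(_ (\row_i c i)); rewrite memvf => /memv_imgP[x _ xE].
by exists x => i; rewrite -pE -[p x](lfunE p) -xE mxE.
Qed.

(** A functional that kills the joint image is a linear relation among the [f i]. *)
Lemma joint_surj r (f : 'I_r -> V -> k) :
  (forall i, flin (f i)) ->
  (forall c : 'I_r -> k, (forall x, \sum_i c i * f i x = 0) -> forall i, c i = 0) ->
  forall c : 'I_r -> k, exists x, forall i, f i x = c i.
Proof.
move=> lf find c; have [p pE] := joint_map lf.
have : \row_i c i \in limg (linfun p).
  apply: contraT => cU; have [g gU] := functional_separates cU.
  have gE w : g w = \sum_j g (delta_mx 0 j) * w 0 j.
    rewrite {1}(row_sum_delta w) linear_sum; apply: eq_bigr => j _.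
    by rewrite linearZ /= mulrC.
  case/negP; rewrite gE big1 // => j _; rewrite (find (fun j => g (delta_mx 0 j))) ?mul0r // => x.
  under eq_bigr => i _ do rewrite -pE.
  by rewrite -gE gU // -(lfunE p) memv_img ?memvf.
by case/memv_imgP => x _ xE; exists x => i; rewrite -pE -[p x](lfunE p) -xE mxE.
Qed.

Lemma complement_seq (U W : {vspace V}) : (U <= W)%VS ->
  exists Y : seq V, size Y = (\dim W - \dim U)%N /\ W = (<<Y>> + U)%VS.
Proof.
move=> UW; exists (vbasis (W :\: U)); rewrite size_tuple (span_basis (vbasisP _)) addv_diff.
split; last by apply/esym/addv_idPl.
by have := dimv_cap_compl W U; have /capv_idPr -> := UW; lia.
Qed.

End JointFunctionals.

Section Brackets.
Variables (k : fieldType) (A : finLieType k).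

Lemma br_span (U V : seq A) (W : {vspace A}) :
  (forall u v, u \in U -> v \in V -> ⁅u, v⁆ \in W) ->
  forall x y, x \in <<U>>%VS -> y \in <<V>>%VS -> ⁅x, y⁆ \in W.
Proof.
move=> UV x y; rewrite -[U]in_tupleE => /coord_span ->; rewrite -[V]in_tupleE => /coord_span ->.
rewrite lie_br_lcomb_l memv_suml // => i _; rewrite memvZ // lie_br_lcomb_r memv_suml // => j _.
by apply/memvZ/UV; apply: mem_nth.
Qed.

(** In class two, summands from [A^2] do not change a bracket, so generators modulo [A^2] decide. *)
Lemma derived_gen (U : seq A) (W : {vspace A}) :
  (<<U>> + derived A)%VS = fullv -> (forall x, x \in derived A -> lie_central x) ->
  (forall u v, u \in U -> v \in U -> ⁅u, v⁆ \in W) -> (derived A <= W)%VS.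
Proof.
move=> UA dc UW; apply: derived_sub => x y.
have : x \in (<<U>> + derived A)%VS by rewrite UA memvf.
have : y \in (<<U>> + derived A)%VS by rewrite UA memvf.
case/memv_addP=> y1 yU [y2 /dc y2c ->] /memv_addP[x1 xU [x2 /dc x2c ->]].
by rewrite lie_brDl x2c addr0 lie_brDr (lie_centralr y2c) addr0; exact: (br_span UW).
Qed.

Lemma central_gen (U : seq A) z :
  (<<U>> + derived A)%VS = fullv -> (forall x, x \in derived A -> lie_central x) ->
  (forall u, u \in U -> ⁅z, u⁆ = 0) -> lie_central z.
Proof.
move=> UA dc zU x; have : x \in (<<U>> + derived A)%VS by rewrite UA memvf.
case/memv_addP=> x1 xU [x2 /dc x2c ->]; rewrite lie_brDr (lie_centralr x2c) addr0.
apply/eqP; rewrite -memv0; apply: (@br_span [:: z] U _ _ z x1) => // [u v|]; last first.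
  by rewrite memv_span // mem_head.
by rewrite inE => /eqP -> /zU ->; rewrite mem0v.
Qed.

Lemma derived2_coord : \dim (derived A) = 2%N ->
  exists (w1 w2 : A) (c1 c2 : {scalar A}),
    [/\ w1 \in derived A, w2 \in derived A,
      forall x, x \in derived A -> x = c1 x *: w1 + c2 x *: w2,
      c1 w1 = 1 /\ c1 w2 = 0 & c2 w1 = 0 /\ c2 w2 = 1].
Proof.
move=> d2; have Xf := basis_free (vbasisP (derived A)).
have : exists X : 2.-tuple A, basis_of (derived A) X.
  have st : size (vbasis (derived A)) == 2 by rewrite size_tuple d2.
  by exists (Tuple st); apply: vbasisP.
case=> X Xb; have {}Xf := basis_free Xb.
exists X`_0, X`_1, (coord X ord0), (coord X (lift ord0 ord0)); split.
- by apply: (basis_mem Xb); rewrite mem_nth ?size_tuple.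
- by apply: (basis_mem Xb); rewrite mem_nth ?size_tuple.
- by move=> x xA; rewrite {1}(coord_basis Xb xA) !big_ord_recl big_ord0 addr0.
- split; first exact: (coord_free ord0 ord0 Xf).
  exact: (coord_free (lift ord0 ord0) ord0 Xf).
- split; first exact: (coord_free ord0 (lift ord0 ord0) Xf).
  exact: (coord_free (lift ord0 ord0) (lift ord0 ord0) Xf).
Qed.

End Brackets.

(* [alt_wedge b g]: the 3-form b /\ g vanishes. *)
Definition alt_wedge (k : fieldType) (V : lmodType k) (b : V -> V -> k) (g : V -> k) : Prop :=
  forall x y t, b x y * g t + b y t * g x + b t x * g y = 0.

(** A form divisible by two independent functionals is a multiple of their wedge, and a third
    independent functional divides such a multiple only if it is 0. The proof evaluates at vectors
    dual to the [g i]. *)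
Lemma alt_wedge3 (k : fieldType) (V : vectType k) (b : V -> V -> k) (g : 'I_3 -> V -> k) :
  (forall x, b x x = 0) -> (forall x y, b x y = - b y x) -> (forall i, flin (g i)) ->
  (forall c : 'I_3 -> k, (forall x, \sum_i c i * g i x = 0) -> forall i, c i = 0) ->
  (forall i, alt_wedge b (g i)) -> forall x y, b x y = 0.
Proof.
move=> b0 bC lg gi bg.
have [t1 t1E] := joint_surj lg gi (fun i => (i == 0 :> nat)%:R).
have [t2 t2E] := joint_surj lg gi (fun i => (i == 1%N :> nat)%:R).
have [t3 t3E] := joint_surj lg gi (fun i => (i == 2%N :> nat)%:R).
pose i0 : 'I_3 := @Ordinal 3 0 isT; pose i1 : 'I_3 := @Ordinal 3 1 isT; pose i2 : 'I_3 := @Ordinal 3 2 isT.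
have b12 : b t1 t2 = 0.
  have := bg i2 t1 t2 t3; rewrite t1E t2E t3E /= mulr1 !mulr0 !addr0; exact.
have b1 y : b t1 y = 0.
  have := bg i1 t1 y t2; rewrite t1E t2E /= mulr1 mulr0 addr0 [b t2 t1]bC b12 oppr0 mul0r addr0; exact.
move=> x y; have := bg i0 x y t1; rewrite t1E /= mulr1 [b y t1]bC !b1 oppr0 !mul0r !addr0; exact.
Qed.

(** * Class two in dimension at least seven *)

Section ClassTwoLarge.
Variables (k : fieldType) (A : finLieType k).
Hypotheses (stA : lie_stem A) (dc : forall x, x \in derived A -> lie_central x).

(** A 2-form that is divisible by a nonzero functional has rank at most two; the condition excludes
    this for the component [c] of the bracket. *)
Definition wedge_free (c : A -> k) : Prop := forall g, flin g ->
  (forall x, x \in derived A -> g x = 0) -> alt_wedge (fun x y => c ⁅x, y⁆) g -> forall x, g x = 0.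

(** A form divisible by [g], with [g t] nonzero, is up to a scalar the wedge of [g] and [c [t, .]],
    so the common kernel of these two functionals lies in its radical. *)
Lemma not_wedge_free (c : {scalar A}) : ~ wedge_free c ->
  exists (g : A -> k) (t : A), flin g /\
    forall x, g x = 0 -> c ⁅t, x⁆ = 0 -> forall y, c ⁅x, y⁆ = 0.
Proof.
move=> nw; apply: NNPP => H; apply: nw => g lg gD gw x0; apply: NNPP => gx0.
have gx0' : g x0 != 0 by exact/eqP.
apply: H; exists g, x0; split=> // x gx cx y.
have := gw x y x0; rewrite gx mulr0 addr0 cx mul0r addr0 => /eqP.
by rewrite mulf_eq0 (negPf gx0') orbF => /eqP.
Qed.

Variables (w1 w2 : A) (c1 c2 : {scalar A}).
Hypotheses (w1A : w1 \in derived A) (w2A : w2 \in derived A)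
  (cE : forall x, x \in derived A -> x = c1 x *: w1 + c2 x *: w2)
  (c11 : c1 w1 = 1) (c12 : c1 w2 = 0) (c21 : c2 w1 = 0) (c22 : c2 w2 = 1).

Lemma br_coord x y : ⁅x, y⁆ = c1 ⁅x, y⁆ *: w1 + c2 ⁅x, y⁆ *: w2.
Proof. by rewrite -cE ?mem_derived. Qed.

(** If both components had rank at most two, the common kernel of four functionals would be central,
    hence contained in [A^2] by [stA]; this gives [n <= 4 + 2]. *)
Lemma wedge_free_ex : \dim (derived A) = 2%N -> (7 <= \dim {:A})%N ->
  wedge_free c1 \/ wedge_free c2.
Proof.
move=> d2 n7; apply: NNPP => /not_or_and[/not_wedge_free[g1 [t1 [lg1 g1P]]]].
case/not_wedge_free=> g2 [t2 [lg2 g2P]].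
pose f (i : 'I_4) x := match val i with 0 => g1 x | 1 => c1 ⁅t1, x⁆ | 2 => g2 x | _ => c2 ⁅t2, x⁆ end.
have [||le _] := @joint_kernel_dim k A 4 f (derived A).
- by case=> [[|[|[|i]]] ?] a x y /=; rewrite /f /= ?lg1 ?lg2 ?lie_brDZr ?linearP.
- move=> x fx; apply: stA => y; rewrite br_coord.
  rewrite (g1P _ (fx (@Ordinal 4 0 isT)) (fx (@Ordinal 4 1 isT))).
  by rewrite (g2P _ (fx (@Ordinal 4 2 isT)) (fx (@Ordinal 4 3 isT))) !scale0r addr0.
- by rewrite d2 in le; lia.
Qed.

(** The cocycle identity in class two, read as a relation of 3-forms: the wedges of the component
    [c1] with [f (., w1)] and of [c2] with [f (., w2)] cancel. *)
Lemma slice_wedge f : lie_cocycle f ->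
  forall x y t, (c1 ⁅x, y⁆ * f (t, w1) + c2 ⁅x, y⁆ * f (t, w2)) +
    (c1 ⁅y, t⁆ * f (x, w1) + c2 ⁅y, t⁆ * f (x, w2)) +
    (c1 ⁅t, x⁆ * f (y, w1) + c2 ⁅t, x⁆ * f (y, w2)) = 0.
Proof.
move=> cf x y t; have lf := cocycle_linl cf.
have E u v z : f (⁅u, v⁆, z) = - (c1 ⁅u, v⁆ * f (z, w1) + c2 ⁅u, v⁆ * f (z, w2)).
  rewrite {1}br_coord (flinD (lf _)) !(flinZ (lf _)) [f (w1, z)](cocycleC cf) [f (w2, z)](cocycleC cf).
  ring.
have := cocycle_jacobi cf x y t; rewrite !E => /eqP; rewrite -!opprD oppr_eq0 => /eqP; exact.
Qed.

(** Modulo [w2] only the component [c1] of the bracket survives. Being wedge-free, it makes the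
    slice at [p w1] zero, so the quotient has [s = 2]. *)
Lemma class_two_quotient_s s : \dim (derived A) = 2%N -> wedge_free c1 -> lie_s A s ->
  exists2 e, fdim (central_slice w2) e & (s + e = 1 + \dim {:A})%N.
Proof.
move=> d2 wf As; have w2c := dc w2A.
have w20 : w2 != 0 by apply: contra_eq_neq c22 => ->; rewrite linear0 eq_sym oner_eq0.
have [Q [p pq]] := central_quotient_ex w2c; have [pm ps pk] := pq.
have pw2 : p w2 = 0 by apply/pk/memv_line.
have := dim_derived_central_quotient pq w20; rewrite w2A d2 addn1 => -[dQ].
have pw1 : p w1 != 0.
  apply/negP => /eqP/pk/vlineP[a w1E]; move: c11; rewrite w1E linearZ /= c12 mulr0 => /eqP.
  by rewrite eq_sym oner_eq0.
have pw1c : lie_central (p w1) by move=> y; have [x <-] := ps y; rewrite -pm dc ?linear0.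
have [e Ge] := central_slice_dim_ex w2; exists e => //.
have [e' Ge'] := central_slice_dim_ex (p w1).
have e'0 : (e' <= 0)%N.
  apply: (fdim_le_points (t := fun i : 'I_0 => 0) (central_slice_closed _) Ge') => g gs _ y.
  have [x <-] := ps y; have lg := central_slice_lin gs.
  have gD := central_slice_derived pw1c gs; have [f cf gE] := gs.
  apply: (wf (fun x => g (p x))) => [a u v|u uA|u v t].
  - by rewrite linearP lg.
  - by apply: gD; apply: derived_morph.
  - have E u' v' z : f (⁅p u', p v'⁆, p z) = - (c1 ⁅u', v'⁆ * g (p z)).
      rewrite -pm {1}br_coord linearD !linearZ /= pw2 scaler0 addr0 (flinZ (cocycle_linl cf _)).
      by rewrite (cocycleC cf) -gE mulrN.
    have := cocycle_jacobi cf (p u) (p v) (p t); rewrite !E -!opprD => /eqP.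
    by rewrite oppr_eq0 => /eqP.
have [_] := lie_s_dim1 dQ (derived_morph pm w1A) pw1 pw1c Ge'.
move: e'0; rewrite leqn0 => /eqP ->; rewrite subn0 => Qs.
by have := lie_s_central w20 w2c w2A pq Ge As Qs; lia.
Qed.

(** Such a cocycle pins down the bracket: it vanishes on the common kernel of [g] and [g'], and
    three functionals describe the brackets of this kernel with [t1] and [t2]. Together with [g] and
    [g'] these five have their common kernel in [A^2], so [n = 7] and they are independent. *)
Lemma class_two_case_independent f e : lie_cocycle f -> \dim (derived A) = 2%N ->
  (7 <= \dim {:A})%N ->
  (forall a b, (forall x, a * f (x, w2) + b * f (x, w1) = 0) -> a = 0 /\ b = 0) ->
  fdim (central_slice w2) e -> (e <= 2)%N.
Proof.
move=> cf d2 n7 find Ge; have lf := cocycle_linl cf.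
pose g x := f (x, w2); pose g' x := f (x, w1).
have gD x : x \in derived A -> g x = 0.
  by apply: (central_slice_derived (dc w2A)); exists f.
have g'D x : x \in derived A -> g' x = 0.
  by apply: (central_slice_derived (dc w1A)); exists f.
pose gg (i : 'I_2) := if i == 0 :> nat then g else g'.
have lgg i : flin (gg i) by rewrite /gg; case: ifP => _ a x y; rewrite /g /g' lf.
have ggi (c : 'I_2 -> k) : (forall x, \sum_i c i * gg i x = 0) -> forall i, c i = 0.
  move=> c0; have [|ca cb] := find (c ord0) (c (lift ord0 ord0)).
    by move=> x; rewrite -[RHS](c0 x) !big_ord_recl big_ord0 addr0.
  by case=> [[|[|i]] hi] //; [rewrite -[RHS]ca | rewrite -[RHS]cb]; congr c; apply: val_inj.
have [t1 t1E] := joint_surj lgg ggi (fun i => (i == 0 :> nat)%:R).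
have [t2 t2E] := joint_surj lgg ggi (fun i => (i == 1%N :> nat)%:R).
have g1 : g t1 = 1 := t1E ord0; have g'1 : g' t1 = 0 := t1E (lift ord0 ord0).
have g2 : g t2 = 0 := t2E ord0; have g'2 : g' t2 = 1 := t2E (lift ord0 ord0).
have lg : flin g := lgg ord0; have lg' : flin g' := lgg (lift ord0 ord0).
have cC (c : {scalar A}) x y : c ⁅x, y⁆ = - c ⁅y, x⁆ by rewrite lie_brC linearN.
have sw := slice_wedge cf; rewrite -/g -/g' in sw.
have HH x y : g x = 0 -> g' x = 0 -> g y = 0 -> g' y = 0 -> ⁅x, y⁆ = 0.
  move=> gx g'x gy g'y; rewrite br_coord.
  have := sw x y t1; rewrite -/(g _) -/(g' _) -/(g _) -/(g' _) -/(g _) -/(g' _).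
  rewrite g1 g'1 gx g'x gy g'y !mulr0 !addr0 add0r mulr1 => ->.
  have := sw x y t2; rewrite -/(g _) -/(g' _) -/(g _) -/(g' _) -/(g _) -/(g' _).
  rewrite g2 g'2 gx g'x gy g'y !mulr0 !addr0 mulr1 => ->.
  by rewrite !scale0r addr0.
have PE x : g x = 0 -> g' x = 0 -> c2 ⁅x, t2⁆ = c1 ⁅x, t1⁆.
  move=> gx g'x; have := sw x t1 t2; rewrite -/(g _) -/(g' _) -/(g _) -/(g' _) -/(g _) -/(g' _).
  rewrite g1 g'1 g2 g'2 gx g'x !mulr0 !addr0 add0r !mulr1 [c2 ⁅t2, x⁆]cC => /eqP.
  by rewrite subr_eq0 => /eqP.
pose th (i : 'I_5) x := match val i with
  0 => g x | 1 => g' x | 2 => c1 ⁅x, t1⁆ | 3 => c1 ⁅x, t2⁆ | _ => c2 ⁅x, t1⁆ end.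
have lth i : flin (th i).
  by case: i => [[|[|[|[|i]]]] hi] a x y; rewrite /th /= ?lg ?lg' // lie_brDZl linearP.
have expand y : exists2 y', g y' = 0 /\ g' y' = 0 & y = g y *: t1 + g' y *: t2 + y'.
  exists (y - (g y *: t1 + g' y *: t2)); last by rewrite addrC subrK.
  by split; rewrite (flinD lg, flinD lg') (flinN lg, flinN lg') (flinD lg, flinD lg')
     !(flinZ lg, flinZ lg') ?g1 ?g2 ?g'1 ?g'2; ring.
have thW x : (forall i, th i x = 0) -> x \in derived A.
  move=> x0; apply: stA => y; have [y' [gy gy'] ->] := expand y.
  have gx : g x = 0 := x0 (@Ordinal 5 0 isT); have g'x : g' x = 0 := x0 (@Ordinal 5 1 isT).
  have p0 : c1 ⁅x, t1⁆ = 0 := x0 (@Ordinal 5 2 isT); have q0 : c1 ⁅x, t2⁆ = 0 := x0 (@Ordinal 5 3 isT).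
  have r0 : c2 ⁅x, t1⁆ = 0 := x0 (@Ordinal 5 4 isT).
  rewrite !lie_brDr !lie_brZr (HH x y') // (br_coord x t1) (br_coord x t2) (PE x gx g'x) p0 q0 r0.
  by rewrite !(scale0r, addr0, scaler0).
have [le eqn] := joint_kernel_dim lth thW.
have n5 : \dim {:A} = (5 + \dim (derived A))%N by apply/eqP; rewrite eqn_leq le d2.
rewrite leqNgt; apply/negP => e3.
have [hP hPE] := eqn n5 (fun i => (i == 2%N :> nat)%:R).
have [hQ hQE] := eqn n5 (fun i => (i == 3%N :> nat)%:R).
have [hR hRE] := eqn n5 (fun i => (i == 4%N :> nat)%:R).
(* If [e >= 3], some nonzero slice [G] vanishes at [t1] and [t2]. The relations [Ea] and [Eb] at the
   dual vectors [hP], [hQ], [hR] make it vanish everywhere. *)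
have [G [[F cF GE] [x0 Gx0] Gt]] := fdim_vanish (fun i : 'I_2 => if i == 0 :> nat then t1 else t2)
  (central_slice_closed w2) Ge e3.
have Gt1 : G t1 = 0 := Gt ord0; have Gt2 : G t2 = 0 := Gt (lift ord0 ord0).
pose G' x := F (x, w1).
have swF := slice_wedge cF.
have Ea x y : g x = 0 -> g' x = 0 -> g y = 0 -> g' y = 0 ->
    c1 ⁅y, t1⁆ * G' x + c2 ⁅y, t1⁆ * G x = c1 ⁅x, t1⁆ * G' y + c2 ⁅x, t1⁆ * G y.
  move=> gx g'x gy g'y; have := swF x y t1; rewrite (HH x y) // !linear0 !mul0r !add0r -!GE.
  rewrite [c1 ⁅t1, x⁆]cC [c2 ⁅t1, x⁆]cC !mulNr -opprD => /eqP; rewrite subr_eq0 => /eqP; exact.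
have Eb x y : g x = 0 -> g' x = 0 -> g y = 0 -> g' y = 0 ->
    c1 ⁅y, t2⁆ * G' x + c1 ⁅y, t1⁆ * G x = c1 ⁅x, t2⁆ * G' y + c1 ⁅x, t1⁆ * G y.
  move=> gx g'x gy g'y; have := swF x y t2; rewrite (HH x y) // !linear0 !mul0r !add0r -!GE.
  rewrite [c1 ⁅t2, x⁆]cC [c2 ⁅t2, x⁆]cC !mulNr -opprD => /eqP; rewrite subr_eq0 => /eqP.
  by rewrite !PE.
have P0 : g hP = 0 := hPE (@Ordinal 5 0 isT); have P1 : g' hP = 0 := hPE (@Ordinal 5 1 isT).
have P2 : c1 ⁅hP, t1⁆ = 1 := hPE (@Ordinal 5 2 isT); have P3 : c1 ⁅hP, t2⁆ = 0 := hPE (@Ordinal 5 3 isT).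
have P4 : c2 ⁅hP, t1⁆ = 0 := hPE (@Ordinal 5 4 isT).
have Q0 : g hQ = 0 := hQE (@Ordinal 5 0 isT); have Q1 : g' hQ = 0 := hQE (@Ordinal 5 1 isT).
have Q2 : c1 ⁅hQ, t1⁆ = 0 := hQE (@Ordinal 5 2 isT); have Q3 : c1 ⁅hQ, t2⁆ = 1 := hQE (@Ordinal 5 3 isT).
have Q4 : c2 ⁅hQ, t1⁆ = 0 := hQE (@Ordinal 5 4 isT).
have R0 : g hR = 0 := hRE (@Ordinal 5 0 isT); have R1 : g' hR = 0 := hRE (@Ordinal 5 1 isT).
have R2 : c1 ⁅hR, t1⁆ = 0 := hRE (@Ordinal 5 2 isT); have R3 : c1 ⁅hR, t2⁆ = 0 := hRE (@Ordinal 5 3 isT).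
have R4 : c2 ⁅hR, t1⁆ = 1 := hRE (@Ordinal 5 4 isT).
have GQ : G hQ = 0.
  by have := Ea _ _ Q0 Q1 R0 R1; rewrite Q2 Q4 R2 R4 !(mul0r, mul1r, add0r, addr0).
have G'R : G' hR = 0.
  by have := Eb _ _ R0 R1 Q0 Q1; rewrite Q2 Q3 R2 R3 !(mul0r, mul1r, add0r, addr0).
have GP : G hP = 0.
  by have := Ea _ _ R0 R1 P0 P1; rewrite P2 P4 R2 R4 G'R !(mul0r, mul1r, add0r, addr0).
have GR : G hR = 0.
  by have := Eb _ _ R0 R1 P0 P1; rewrite P2 P3 R2 R3 !(mul0r, mul1r, add0r, addr0).
have Gs : central_slice w2 G by exists F.
have lG := central_slice_lin Gs.
case/negP: Gx0; have [y [gy g'y] ->] := expand x0.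
rewrite !(flinD lG) !(flinZ lG) Gt1 Gt2 !mulr0 !add0r.
pose y' := c1 ⁅y, t1⁆ *: hP + c1 ⁅y, t2⁆ *: hQ + c2 ⁅y, t1⁆ *: hR.
have Gy' : G y' = 0 by rewrite !(flinD lG) !(flinZ lG) GP GQ GR !mulr0 !addr0.
rewrite -[y](subrK y') (flinD lG) Gy' addr0; apply/eqP.
apply: (central_slice_derived (dc w2A) Gs); apply: thW => i.
rewrite (flinD (lth i)) (flinN (lth i)) !(flinD (lth i)) !(flinZ (lth i)) hPE hQE hRE.
case: i => [[|[|[|[|[|i]]]]] hi] //; rewrite /th /= ?gy ?g'y; ring.
Qed.

(** If [s <= 5], then [e = n + 1 - s >= 3], so no cocycle has independent slices at [w1] and [w2].
    The slice at [w1] is then a multiple of that at [w2], with the same factor [m] for three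
    independent slices. These divide the form [m c1 + c2] of the bracket, which must vanish although
    it is 1 at [w2]. *)
Lemma class_two_large s : \dim (derived A) = 2%N -> (7 <= \dim {:A})%N -> wedge_free c1 ->
  lie_s A s -> (6 <= s)%N.
Proof.
move=> d2 n7 wf As; have [e Ge sE] := class_two_quotient_s d2 wf As.
rewrite leqNgt; apply/negP => s5; have e3 : (3 <= e)%N by lia.
case: (classic (exists2 f, lie_cocycle f & forall a b,
    (forall x, a * f (x, w2) + b * f (x, w1) = 0) -> a = 0 /\ b = 0)) => [[f cf find]|H].
  by have := class_two_case_independent cf d2 n7 find Ge; lia.
have dep f : lie_cocycle f -> exists l, forall x, f (x, w1) = l * f (x, w2).
  move=> cf; apply: NNPP => nl; apply: H; exists f => // a b ab.
  have b0 : b = 0.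
    apply: NNPP => /eqP b0; apply: nl; exists (- a / b) => x.
    have /eqP := ab x; rewrite addrC addr_eq0 => /eqP bE.
    by rewrite mulrAC mulNr -bE mulrAC mulfV // mul1r.
  split=> //; apply: NNPP => /eqP a0; have f2 x : f (x, w2) = 0.
    by have /eqP := ab x; rewrite b0 mul0r addr0 mulf_eq0 (negPf a0) => /eqP.
  apply: nl; exists 0 => x; rewrite mul0r.
  have lf := cocycle_linl cf; apply: (wf (fun x => f (x, w1))) => // [u uA|u v t].
    have sl : central_slice w1 (fun x => f (x, w1)) by exists f.
    exact: (central_slice_derived (dc w1A) sl uA).
  by have := slice_wedge cf u v t; rewrite !f2 !mulr0 !addr0.
have [v [vs vi _]] := Ge; have [f cf vE] := fin_all_exists2 vs.
have [l lE] := fin_all_exists (fun i => dep _ (cf i)).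
have e0 : (0 < e)%N by lia. have e1 : (1 < e)%N by lia. have e2 : (2 < e)%N by lia.
pose h (i : 'I_3) : 'I_e := widen_ord e3 i.
have hinj : injective h by move=> i j /(congr1 val)/= ij; apply: val_inj.
have hi (c : 'I_3 -> k) : (forall x, \sum_i c i * v (h i) x = 0) -> forall i, c i = 0.
  move=> c0 i; pose c' j := \sum_i c i * (h i == j)%:R.
  have -> : c i = c' (h i).
    rewrite /c' (bigD1 i) //= eqxx mulr1 big1 ?addr0 // => j /negPf ji.
    by rewrite (inj_eq hinj) ji mulr0.
  apply: vi => x; rewrite -[RHS](c0 x); under eq_bigr => j _ do rewrite mulr_suml.
  rewrite exchange_big; apply: eq_bigr => j _ /=; rewrite (bigD1 (h j)) //= eqxx mulr1.
  by rewrite big1 ?addr0 // => j' /negPf jj; rewrite eq_sym jj mulr0 mul0r.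
(* The sum of two cocycles also has proportional slices; independence of the two slices at [w2]
   makes the factors agree. *)
have leq i j : i != j -> l i = l j.
  move=> ij; have [_ _ CD] := cocycle_closed A.
  have [m mE] := dep _ (CD 1 _ _ (cf i) (cf j)).
  have eq0 x : (l i - m) * v i x + (l j - m) * v j x = 0.
    have /eqP := mE x; rewrite !mul1r !lE -!vE mulrDr -subr_eq0 => /eqP <-; ring.
  pose c' n := (l i - m) * (n == i)%:R + (l j - m) * (n == j)%:R.
  have c'0 : forall n, c' n = 0.
    apply: vi => x; rewrite -[RHS](eq0 x); under eq_bigr => n _ do rewrite mulrDl.
    rewrite big_split /=; congr (_ + _).
      rewrite (bigD1 i) //= eqxx mulr1 big1 ?addr0 // => n /negPf ->; by rewrite mulr0 mul0r.
    rewrite (bigD1 j) //= eqxx mulr1 big1 ?addr0 // => n /negPf ->; by rewrite mulr0 mul0r.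
  have := c'0 i; rewrite /c' eqxx (negPf ij) mulr1 mulr0 addr0 => /eqP; rewrite subr_eq0 => /eqP ->.
  have := c'0 j; rewrite /c' eqxx eq_sym (negPf ij) mulr1 mulr0 add0r => /eqP.
  by rewrite subr_eq0 => /eqP ->.
pose m := l (h ord0).
have lm i : l (h i) = m.
  have [->|ne] := eqVneq i ord0; first by [].
  by apply: leq; rewrite (inj_eq hinj).
pose b x y := m * c1 ⁅x, y⁆ + c2 ⁅x, y⁆.
have b0 x y : b x y = 0.
  apply: (@alt_wedge3 k A b (fun i => v (h i))) => // [u|u u'|i|i u u' t].
  - by rewrite /b lie_brxx !linear0 mulr0 addr0.
  - by rewrite /b lie_brC !linearN /= mulrN -opprD.
  - exact: central_slice_lin (vs _).
  - have := slice_wedge (cf (h i)) u u' t; rewrite !lE lm -!vE => <-; rewrite /b; ring.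
have /eqP : m * c1 w2 + c2 w2 = 0.
  have lc : flin (fun x => m * c1 x + c2 x) by move=> a x y; rewrite !linearP /=; ring.
  exact: (flin_derived lc b0).
by rewrite c12 c22 mulr0 add0r oner_eq0.
Qed.

End ClassTwoLarge.

Lemma class_two_stem_large (k : fieldType) (A : finLieType k) s : lie_stem A ->
  (forall x, x \in derived A -> lie_central x) -> \dim (derived A) = 2%N ->
  (7 <= \dim {:A})%N -> lie_s A s -> (6 <= s)%N.
Proof.
move=> stA dc d2 n7 As; have [w1 [w2 [c1 [c2 [w1A w2A cE [c11 c12] [c21 c22]]]]]] := derived2_coord d2.
case: (wedge_free_ex stA w1A w2A cE d2 n7) => wf.
  exact: (class_two_large stA dc w1A w2A cE).
apply: (class_two_large stA dc w2A w1A (c1 := c2) (c2 := c1)) As => //.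
by move=> x xA; rewrite addrC -cE.
Qed.

(** * Class two in dimension five *)

Section ClassTwoSmall.
Variables (k : fieldType) (A : finLieType k).
Hypothesis dc : forall x, x \in derived A -> lie_central x.

Lemma gen_change (U V : seq A) (W : {vspace A}) : (<<U>> + W)%VS = fullv ->
  (forall u, u \in U -> u \in (<<V>> + W)%VS) -> (<<V>> + W)%VS = fullv.
Proof.
move=> UW UV; apply/eqP; rewrite eqEsubv subvf -UW subv_add addvSr andbT.
by apply/span_subvP => u /UV.
Qed.

Lemma mem_gen (V : seq A) (W : {vspace A}) u : u \in V -> u \in (<<V>> + W)%VS.
Proof. by move=> uV; apply: subvP (addvSl _ _) _ _; apply: memv_span. Qed.

Lemma gen_span (U X : seq A) : (<<U>> + derived A)%VS = fullv ->
  {subset U <= X} -> (derived A <= <<X>>)%VS -> <<X>>%VS = fullv.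
Proof.
move=> UA UX DX; apply/eqP; rewrite eqEsubv subvf -UA subv_add DX andbT.
exact: sub_span.
Qed.

Lemma class_two_rank_three (u1 u2 u3 : A) : (<<[:: u1; u2; u3]>> + derived A)%VS = fullv ->
  ⁅u2, u3⁆ = 0 -> \dim {:A} = 5%N -> lie_iso A (L5_8 k).
Proof.
move=> UA u23 n5; pose X := [:: u1; u2; u3; ⁅u1, u2⁆; ⁅u1, u3⁆].
have c1 x : ⁅x, ⁅u1, u2⁆⁆ = 0 by apply/lie_centralr/dc/mem_derived.
have c2 x : ⁅x, ⁅u1, u3⁆⁆ = 0 by apply/lie_centralr/dc/mem_derived.
have DX : (derived A <= <<X>>)%VS.
  have m12 : ⁅u1, u2⁆ \in <<X>>%VS by rewrite memv_span // !inE eqxx !orbT.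
  have m13 : ⁅u1, u3⁆ \in <<X>>%VS by rewrite memv_span // !inE eqxx !orbT.
  apply: (derived_gen UA dc) => u v; rewrite !inE => /or3P[] /eqP -> /or3P[] /eqP ->;
   by rewrite ?lie_brxx ?u23 ?mem0v // lie_brC memvN ?u23 ?mem0v.
have Xs : <<X>>%VS = fullv.
  by apply: (gen_span UA _ DX) => u; rewrite !inE => /or3P[] ->; rewrite ?orbT.
apply: (@nat_table_iso _ 4 (LieTable (@L5_8_jacobi k)) _ _ X erefl) => //.
by case=> [|[|[|[|[|i]]]]] [|[|[|[|[|j]]]]] //=; rewrite ?andbF // => _; rewrite /X /= ?scale_unit ?c1 ?c2.
Qed.

(** The three brackets of generators lie in the plane [A^2] and satisfy a linear relation. Bivectors
    in three variables are decomposable, so for suitable generators the relation is a single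
    vanishing bracket. *)
Lemma class_two_five : \dim (derived A) = 2%N -> \dim {:A} = 5%N -> lie_iso A (L5_8 k).
Proof.
move=> d2 n5; have [Y [Ys]] := complement_seq (subvf (derived A)).
rewrite d2 n5 in Ys => /esym; case: Y Ys => [|u1 [|u2 [|u3 [|]]]] // _ UA.
have [w1 [w2 [c1 [c2 [_ _ cE _ _]]]]] := derived2_coord d2.
have [p [q [r [pqr rel]]]] : exists p q r, (p, q, r) != (0, 0, 0) :> k * k * k /\
    p *: ⁅u2, u3⁆ + q *: ⁅u3, u1⁆ + r *: ⁅u1, u2⁆ = 0.
  pose M : 'M[k]_(3, 2) := \matrix_(i, j) (if j == 0 :> nat then c1 else c2)
     (if i == 0 :> nat then ⁅u2, u3⁆ else if i == 1%N :> nat then ⁅u3, u1⁆ else ⁅u1, u2⁆).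
  have : kermx M != 0.
    rewrite kermx_eq0 /row_free neq_ltn; apply/orP; left.
    exact: leq_ltn_trans (rank_leq_col M) _.
  case/rowV0Pn=> c /sub_kermxP cM c0; exists (c 0 ord0), (c 0 (lift ord0 ord0)), (c 0 (lift ord0
    (lift ord0 ord0))); split.
    apply: contra_neq c0 => -[p0 q0 r0]; apply/rowP => -[[|[|[|i]]] hi] //; rewrite mxE.
    - by rewrite -[RHS]p0; congr (c 0 _); apply: val_inj.
    - by rewrite -[RHS]q0; congr (c 0 _); apply: val_inj.
    - by rewrite -[RHS]r0; congr (c 0 _); apply: val_inj.
  have mE j : (c *m M) 0 j = 0 by rewrite cM mxE.
  have := mE ord0; have := mE (lift ord0 ord0).
  rewrite !mxE !big_ord_recl !big_ord0 !mxE /= !addr0 !addrA => e2 e1.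
  rewrite [LHS]cE ?memvD ?memvZ ?mem_derived // !linearD !linearZ /=.
  by rewrite e1 e2 !scale0r addr0.
(* The bracket of the two new generators is the given relation divided by [a]. *)
have key v1 v2 v3 a b c : (<<[:: v1; v2; v3]>> + derived A)%VS = fullv -> a != 0 ->
    a *: ⁅v2, v3⁆ + b *: ⁅v3, v1⁆ + c *: ⁅v1, v2⁆ = 0 -> lie_iso A (L5_8 k).
  move=> VA a0 vrel; apply: (@class_two_rank_three v1 (v2 - (b / a) *: v1) (v3 - (c / a) *: v1)) => //.
    apply: (gen_change VA) => u; rewrite !inE => /or3P[] /eqP ->.
    - by apply: mem_gen; rewrite mem_head.
    - rewrite -[X in X \in _](subrK ((b / a) *: v1)) memvD ?memvZ //; apply: mem_gen;
      rewrite !inE ?eqxx ?orbT //.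
    - rewrite -[X in X \in _](subrK ((c / a) *: v1)) memvD ?memvZ //; apply: mem_gen;
      rewrite !inE ?eqxx ?orbT //.
  apply: (scalerI a0); rewrite scaler0 -[RHS]vrel.
  rewrite !(lie_brDl, lie_brDr, lie_brNl, lie_brNr, lie_brZl, lie_brZr) lie_brxx.
  rewrite !scaler0 oppr0 subr0 [⁅v2, v1⁆]lie_brC [⁅v1, v3⁆]lie_brC.
  rewrite !scalerN !opprK !scalerDr !scalerA ![a * _]mulrC !divfK //.
  by rewrite addrAC.
have perm3 v1 v2 v3 : (<<[:: v1; v2; v3]>> + derived A)%VS = fullv ->
   (<<[:: v2; v3; v1]>> + derived A)%VS = fullv.
  move=> VA; apply: (gen_change VA) => u uV; apply: mem_gen; move: uV; rewrite !inE.
  by case/or3P=> ->; rewrite ?orbT.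
have [p0|p0] := eqVneq p 0; last exact: key UA p0 rel.
have [q0|q0] := eqVneq q 0; last first.
  by apply: (key _ _ _ _ r p (perm3 _ _ _ UA) q0); rewrite addrC addrA.
have [r0|r0] := eqVneq r 0; first by rewrite p0 q0 r0 eqxx in pqr.
by apply: (key _ _ _ _ p q (perm3 _ _ _ (perm3 _ _ _ UA)) r0); rewrite -addrA addrC.
Qed.

End ClassTwoSmall.

Lemma dimv_add_vline (k : fieldType) (V : vectType k) (U : {vspace V}) v :
  v \notin U -> \dim (<[v]> + U) = (\dim U).+1.
Proof.
move=> vU; rewrite dimv_disjoint_sum ?dim_vline; last first.
  apply/eqP; rewrite -subv0; apply/subvP => x /memv_capP[/vlineP[a ->]].
  have [->|a0] := eqVneq a 0; first by rewrite scale0r => _; apply: mem0v.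
  by move/(memvZ a^-1); rewrite scalerA mulVf // scale1r (negPf vU).
by case: eqP vU => [->|_]; rewrite ?mem0v.
Qed.

Lemma quadratic_root (k : closedFieldType) (b c : k) : exists t, t * t = b * t + c.
Proof.
have [t tE] := @solve_monicpoly k 2 (fun i => if i == 0 :> nat then c else b) isT.
by exists t; move: tE; rewrite !big_ord_recl big_ord0 /= expr0 expr1 mulr1 addr0 addrC expr2.
Qed.

(** * Class two in dimension six *)

Section ClassTwoSix.
Variables (k : closedFieldType) (A : finLieType k).
Hypotheses (char_k : 2%N \notin [pchar k]) (stA : lie_stem A).
Hypothesis dc : forall x, x \in derived A -> lie_central x.
Hypotheses (d2 : \dim (derived A) = 2%N) (n6 : \dim {:A} = 6%N).

Lemma two_vectors_line (w1 w2 : A) a b c d : a * d = b * c ->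
  exists w, a *: w1 + b *: w2 \in <[w]>%VS /\ c *: w1 + d *: w2 \in <[w]>%VS.
Proof.
move=> adbc; have [a0|a0] := eqVneq a 0; last first.
  exists (a *: w1 + b *: w2); rewrite memv_line; split=> //; apply/vlineP; exists (c / a).
  rewrite scalerDr !scalerA divfK //; congr (_ + _ *: _).
  by rewrite mulrAC -[c * b]mulrC -adbc mulrC mulKf.
have [b0|b0] := eqVneq b 0; last first.
  exists (a *: w1 + b *: w2); rewrite memv_line; split=> //; apply/vlineP; exists (d / b).
  rewrite scalerDr !scalerA divfK // a0 mulr0.
  by move: adbc; rewrite a0 mul0r => /esym/eqP; rewrite mulf_eq0 (negPf b0) /= => /eqP ->.
exists (c *: w1 + d *: w2); rewrite memv_line; split=> //.
by rewrite a0 b0 !scale0r addr0 mem0v.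
Qed.

(* An element of small rank: the pencil of 2-forms contains a degenerate one because
   a 2 x 2 matrix over an algebraically closed field has an eigenvalue. *)
Lemma class_two_line : exists e w, e \notin derived A /\ forall x, ⁅e, x⁆ \in <[w]>%VS.
Proof.
have [Y [Ys YA]] := complement_seq (subvf (derived A)).
rewrite d2 n6 in Ys; case: Y Ys YA => // u Y [Ys] /esym YA.
have uD : u \notin derived A.
  apply/negP => uD; have : (<<Y>> + derived A)%VS = fullv.
    apply: (gen_change YA) => v; rewrite inE => /orP[/eqP ->|vY]; last exact: mem_gen.
    exact: subvP (addvSr _ _) _ uD.
  move/(congr1 (fun V => \dim V)); have := dimv_add_leqif <<Y>>%VS (derived A).
  have := dim_span Y; rewrite Ys d2 => le1 [le2 _] dE; move: le2; rewrite dE n6; lia.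
have [w1 [w2 [c1 [c2 [w1A w2A cE [c11 c12] [c21 c22]]]]]] := derived2_coord d2.
have brE x y : ⁅x, y⁆ = c1 ⁅x, y⁆ *: w1 + c2 ⁅x, y⁆ *: w2 by rewrite -cE ?mem_derived.
(* If bracketing with [u] does not reach all of [A^2], then [u] itself has its brackets on a
   line. *)
case: (classic (exists y1 y2, ⁅u, y1⁆ = w1 /\ ⁅u, y2⁆ = w2)) => [[y1 [y2 [uy1 uy2]]]|H]; last first.
  pose f (i : 'I_2) x := if i == 0 :> nat then c1 ⁅u, x⁆ else c2 ⁅u, x⁆.
  have lf i : flin (f i).
    by move=> a x y; rewrite /f; case: ifP => _; rewrite lie_brDZr linearP.
  case: (classic (forall c : 'I_2 -> k, (forall x, \sum_i c i * f i x = 0) -> forall i, c i = 0)) => [fi|].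
    have [y1 y1E] := joint_surj lf fi (fun i => (i == 0 :> nat)%:R).
    have [y2 y2E] := joint_surj lf fi (fun i => (i == 1%N :> nat)%:R).
    have y11 : c1 ⁅u, y1⁆ = 1 := y1E ord0; have y12 : c2 ⁅u, y1⁆ = 0 := y1E (lift ord0 ord0).
    have y21 : c1 ⁅u, y2⁆ = 0 := y2E ord0; have y22 : c2 ⁅u, y2⁆ = 1 := y2E (lift ord0 ord0).
    case: H; exists y1, y2; split; rewrite [LHS]brE ?y11 ?y12 ?y21 ?y22.
      by rewrite scale0r scale1r addr0.
    by rewrite scale0r scale1r add0r.
  move=> nf; exists u; apply: NNPP => nw; apply: nf => c c0.
  have c0' x : c ord0 * c1 ⁅u, x⁆ + c (lift ord0 ord0) * c2 ⁅u, x⁆ = 0.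
    by rewrite -[RHS](c0 x) !big_ord_recl big_ord0 addr0.
  have ca : c ord0 = 0.
    apply: NNPP => /eqP ca; apply: nw; exists (c (lift ord0 ord0) *: w1 - c ord0 *: w2); split=> // x.
    apply/vlineP; exists (- c2 ⁅u, x⁆ / c ord0); rewrite [LHS]brE scalerBr !scalerA.
    rewrite divfK // scaleNr opprK; congr (_ *: _ + _); apply: (mulfI ca).
    transitivity (- (c (lift ord0 ord0) * c2 ⁅u, x⁆)); last by field.
    by apply/eqP; rewrite -addr_eq0 c0'.
  have cb : c (lift ord0 ord0) = 0.
    apply: NNPP => /eqP cb; apply: nw; exists w1; split=> // x; apply/vlineP; exists (c1 ⁅u, x⁆).
    rewrite [LHS]brE; have := c0' x; rewrite ca mul0r add0r => /eqP; rewrite mulf_eq0 (negPf cb) /=.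
    by move=> /eqP ->; rewrite scale0r addr0.
  by case=> [[|[|i]] hi] //; [rewrite -[RHS]ca | rewrite -[RHS]cb]; congr c; apply: val_inj.
pose ker x := x - c1 ⁅u, x⁆ *: y1 - c2 ⁅u, x⁆ *: y2.
have ukerE x : ⁅u, ker x⁆ = 0.
  rewrite !lie_brDr !lie_brNr !lie_brZr uy1 uy2 {1}brE addrAC addrK subrr //.
(* The centralizer of [u] has dimension [6 - 2 = 4], one more than the span of [u] and [A^2]. *)
have [v vu vD] : exists2 v, ⁅u, v⁆ = 0 & v \notin (<<[:: u]>> + derived A)%VS.
  apply: NNPP => H; have kU x : ker x \in (<<[:: u]>> + derived A)%VS.
    by apply: contraT => xU; case: H; exists (ker x).
  have AE : (<<[:: u; y1; y2]>> + derived A)%VS = fullv.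
    apply/eqP; rewrite eqEsubv subvf /=; apply/subvP => x _.
    have -> : x = ker x + c2 ⁅u, x⁆ *: y2 + c1 ⁅u, x⁆ *: y1 by rewrite /ker !subrK.
    apply: memvD; [apply: memvD|]; try by apply/memvZ/mem_gen; rewrite !inE eqxx ?orbT.
    apply: subvP (kU x); apply: addvS (subvv _); apply: sub_span => x'; rewrite !inE => /eqP ->.
    by rewrite eqxx.
  move/(congr1 (fun V => \dim V)): AE; have := dimv_add_leqif <<[:: u; y1; y2]>>%VS (derived A).
  have := dim_span [:: u; y1; y2]; rewrite d2 => le1 [le2 _] dE; move: le2; rewrite dE n6;
    move: le1 => /=; lia.
have AE : (<<[:: u; v; y1; y2]>> + derived A)%VS = fullv.
  have [ad adE] : exists g : {linear A -> A}, forall x, g x = ⁅u, x⁆.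
    by apply: linear_ex => a x y; rewrite lie_brDZr.
  have dK : (\dim (lker (linfun ad)) <= 4)%N.
    have := limg_ker_dim (linfun ad) fullv; rewrite capfv.
    have : (derived A <= limg (linfun ad))%VS.
      apply/subvP => x /cE ->; rewrite -uy1 -uy2 -!adE -!(lfunE ad).
      by rewrite memvD ?memvZ ?memv_img ?memvf.
    by move/dimvS; rewrite d2 n6; lia.
  have UK : lker (linfun ad) = (<<[:: u; v]>> + derived A)%VS.
    apply/esym/eqP; rewrite eqEdim; apply/andP; split.
      rewrite subv_add; apply/andP; split.
        by apply/span_subvP => x; rewrite !inE memv_ker lfunE /= adE => /orP[] /eqP ->;
          rewrite ?lie_brxx ?vu.
      by apply/subvP => x /dc xc; rewrite memv_ker lfunE /= adE (lie_centralr xc).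
    apply: leq_trans dK _; rewrite (_ : (<<[:: u; v]>> + derived A = <[v]> + (<<[:: u]>> + derived A))%VS).
      by rewrite dimv_add_vline // span_seq1 dimv_add_vline // d2.
    by rewrite span_cons !span_seq1 [(<[u]> + _)%VS]addvC addvA.
  apply/eqP; rewrite eqEsubv subvf /=; apply/subvP => x _.
  have -> : x = ker x + c2 ⁅u, x⁆ *: y2 + c1 ⁅u, x⁆ *: y1 by rewrite /ker !subrK.
  apply: memvD; [apply: memvD|]; try by apply/memvZ/mem_gen; rewrite !inE eqxx ?orbT.
  have : ker x \in lker (linfun ad) by rewrite memv_ker lfunE /= adE ukerE.
  rewrite UK; apply: subvP; apply: addvS (subvv _); apply: sub_span => x'; rewrite !inE => /orP[] ->.
    by [].
  by rewrite orbT.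
(* [t] is an eigenvalue of the matrix of [ad v] on [y1, y2], written in [w1 = [u, y1]] and [w2 =
   [u, y2]]; hence [ad (v - t u)] has rank at most one. *)
have [t tE] := quadratic_root (c1 ⁅v, y1⁆ + c2 ⁅v, y2⁆) (c2 ⁅v, y1⁆ * c1 ⁅v, y2⁆ - c1 ⁅v, y1⁆ * c2 ⁅v, y2⁆).
have [|w [wy1 wy2]] := @two_vectors_line w1 w2 (c1 ⁅v, y1⁆ - t) (c2 ⁅v, y1⁆) (c1 ⁅v, y2⁆) (c2 ⁅v, y2⁆ - t).
  apply/eqP; rewrite -subr_eq0.
  have -> : (c1 ⁅v, y1⁆ - t) * (c2 ⁅v, y2⁆ - t) - c2 ⁅v, y1⁆ * c1 ⁅v, y2⁆ =
    t * t - ((c1 ⁅v, y1⁆ + c2 ⁅v, y2⁆) * t + (c2 ⁅v, y1⁆ * c1 ⁅v, y2⁆ - c1 ⁅v, y1⁆ * c2 ⁅v, y2⁆)) by ring.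
  by rewrite tE subrr.
exists (v - t *: u), w; split.
  apply: contra vD => vD; rewrite -[v](subrK (t *: u)) addrC memv_add ?memvZ //.
  by rewrite memv_span // mem_head.
move=> x; have : x \in (<<[:: u; v; y1; y2]>> + derived A)%VS by rewrite AE memvf.
case/memv_addP=> x1 x1U [x2 /dc x2c ->]; rewrite lie_brDr (lie_centralr x2c) addr0.
apply: (@br_span _ _ [:: v - t *: u] [:: u; v; y1; y2]) => //; last by rewrite memv_span // mem_head.
move=> a b; rewrite inE => /eqP ->; rewrite lie_brDl lie_brNl lie_brZl !inE => /or4P[] /eqP ->.
- by rewrite lie_brxx [⁅v, u⁆]lie_brC vu !scaler0 !subr0 oppr0 mem0v.
- by rewrite lie_brxx vu !scaler0 subr0 mem0v.
- by rewrite uy1 brE addrAC -scalerBl.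
- by rewrite uy2 brE -addrA -scalerBl.
Qed.

(** This is the direct sum of two copies of [H(1)] with centers spanned by [w] and [w']. Sums and
    differences bring it to the form with [eps = 1]; recovering the original generators divides by
    2, hence [char_k]. *)
Lemma class_two_L6_22_split (e f p q : A) : (<<[:: e; f; p; q]>> + derived A)%VS = fullv ->
  ⁅e, p⁆ = 0 -> ⁅e, q⁆ = 0 -> ⁅f, p⁆ = 0 -> ⁅f, q⁆ = 0 -> lie_iso A (L6_22 (1 : k)).
Proof.
move=> UA ep eq fp fq; pose w := ⁅e, f⁆; pose w' := ⁅p, q⁆.
pose X := [:: e + p; f + q; f - q; p - e; w + w'; w - w'].
have n2 : 2%:R != 0 :> k by move: char_k; rewrite inE /=.
have cw x : ⁅x, w⁆ = 0 by apply/lie_centralr/dc/mem_derived.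
have cw' x : ⁅x, w'⁆ = 0 by apply/lie_centralr/dc/mem_derived.
have half (x y : A) : x + y \in <<X>>%VS -> x - y \in <<X>>%VS -> x \in <<X>>%VS /\ y \in <<X>>%VS.
  move=> xy1 xy2; split.
    have -> : x = 2%:R^-1 *: ((x + y) + (x - y)).
      by rewrite addrACA subrr addr0 -mulr2n -scaler_nat scalerA mulVf // scale1r.
    by rewrite memvZ // memvD.
  have -> : y = 2%:R^-1 *: ((x + y) - (x - y)).
    by rewrite opprD opprK addrACA subrr add0r -mulr2n -scaler_nat scalerA mulVf // scale1r.
  by rewrite memvZ // memvB.
have mX i : (i < 6)%N -> X`_i \in <<X>>%VS by move=> i6; rewrite memv_span // mem_nth.
have [pX eX] : p \in <<X>>%VS /\ e \in <<X>>%VS.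
  by apply: half; [rewrite addrC; exact: (mX 0%N)|exact: (mX 3%N)].
have [fX qX] : f \in <<X>>%VS /\ q \in <<X>>%VS.
  by apply: half; [exact: (mX 1%N)|exact: (mX 2%N)].
have [wX w'X] : w \in <<X>>%VS /\ w' \in <<X>>%VS.
  by apply: half; [exact: (mX 4%N)|exact: (mX 5%N)].
have Xs : <<X>>%VS = fullv.
  apply/eqP; rewrite eqEsubv subvf -UA subv_add /=; apply/andP; split.
    by apply/span_subvP => x; rewrite !inE => /or4P[] /eqP ->.
  apply: (derived_gen UA dc) => x y; rewrite !inE => /or4P[] /eqP -> /or4P[] /eqP ->;
    rewrite ?lie_brxx ?ep ?eq ?fp ?fq ?mem0v // lie_brC memvN ?ep ?eq ?fp ?fq ?mem0v //.
apply: (@nat_table_iso _ 5 (LieTable (@L6_22_jacobi k 1)) _ _ X erefl) => //.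
have pe : ⁅p, e⁆ = 0 by rewrite lie_brC ep oppr0.
have qe : ⁅q, e⁆ = 0 by rewrite lie_brC eq oppr0.
have pf : ⁅p, f⁆ = 0 by rewrite lie_brC fp oppr0.
have qf : ⁅q, f⁆ = 0 by rewrite lie_brC fq oppr0.
have fe : ⁅f, e⁆ = - w by rewrite lie_brC.
have qp : ⁅q, p⁆ = - w' by rewrite lie_brC.
by case=> [|[|[|[|[|[|i]]]]]] [|[|[|[|[|[|j]]]]]] //=; rewrite ?andbF // => _; rewrite /X /= ?scale_unit
  ?(lie_brDl, lie_brDr, lie_brNl, lie_brNr, lie_brxx, ep, eq, fp, fq, pe, qe, pf, qf, fe, qp, cw, cw')
  -?/w -?/w' ?(oppr0, addr0, add0r, opprK) // addrC.
Qed.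

(** Here [w] is the value of two disjoint brackets and [w'] of a single one, the pattern of
    [eps = 0]; the factor [b] is absorbed into [q]. *)
Lemma class_two_L6_22_0 (e f p q : A) b : (<<[:: e; f; p; q]>> + derived A)%VS = fullv ->
  ⁅e, p⁆ = 0 -> ⁅e, q⁆ = 0 -> ⁅f, q⁆ = 0 -> b != 0 -> ⁅p, q⁆ = b *: ⁅e, f⁆ -> lie_iso A (L6_22 (0 : k)).
Proof.
move=> UA ep eq fq b0 pq; pose w := ⁅e, f⁆; pose w' := ⁅f, p⁆.
pose X := [:: f; - e; p; b^-1 *: q; w; w'].
have cw x : ⁅x, w⁆ = 0 by apply/lie_centralr/dc/mem_derived.
have cw' x : ⁅x, w'⁆ = 0 by apply/lie_centralr/dc/mem_derived.
have mX i : (i < 6)%N -> X`_i \in <<X>>%VS by move=> i6; rewrite memv_span // mem_nth.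
have eX : e \in <<X>>%VS by rewrite -memvN; exact: (mX 1%N).
have qX : q \in <<X>>%VS.
  by have := memvZ b (mX 3%N isT); rewrite /= scalerA mulfV // scale1r.
have fX := mX 0%N isT; have pX := mX 2%N isT; have wX := mX 4%N isT; have w'X := mX 5%N isT.
have Xs : <<X>>%VS = fullv.
  apply/eqP; rewrite eqEsubv subvf -UA subv_add /=; apply/andP; split.
    by apply/span_subvP => x; rewrite !inE => /or4P[] /eqP ->.
  apply: (derived_gen UA dc) => x y; rewrite !inE => /or4P[] /eqP -> /or4P[] /eqP ->;
    rewrite ?lie_brxx ?ep ?eq ?fq ?pq ?mem0v ?memvZ // lie_brC memvN ?ep ?eq ?fq ?pq ?mem0v ?memvZ //.
apply: (@nat_table_iso _ 5 (LieTable (@L6_22_jacobi k 0)) _ _ X erefl) => //.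
have qw : ⁅p, b^-1 *: q⁆ = w by rewrite lie_brZr pq scalerA mulVf // scale1r.
have fe : ⁅f, e⁆ = - w by rewrite lie_brC.
by case=> [|[|[|[|[|[|i]]]]]] [|[|[|[|[|[|j]]]]]] //=; rewrite ?andbF // => _; rewrite /X /= ?scale_unit ?qw
  ?(lie_brNl, lie_brNr, lie_brZr, lie_brxx, ep, eq, fq, fe, cw, cw') -?/w' ?(oppr0, addr0, add0r,
    opprK, scaler0, scale0r).
Qed.

(** All brackets of [e] lie on [<w>], and the functional [c] reads the remaining brackets modulo
    [w]. If [c [p, q]] is nonzero, the algebra splits into two copies of [H(1)]; otherwise it has
    the form with [eps = 0]. *)
Lemma class_two_six : exists eps : k, lie_iso A (L6_22 eps).
Proof.
have [e [w [eD ew]]] := class_two_line.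
have [f0 ef0] : exists f, ⁅e, f⁆ != 0.
  apply: NNPP => H; case/negP: eD; apply: stA => x; apply/eqP; apply: contra_notT H => ex; by exists x.
have [a aE] : exists a, ⁅e, f0⁆ = a *: w by have /vlineP := ew f0.
have w0 : w != 0 by apply: contra_neq ef0 => w0; rewrite aE w0 scaler0.
have a0 : a != 0 by apply: contra_neq ef0 => a0; rewrite aE a0 scale0r.
have [f ef] : exists f, ⁅e, f⁆ = w.
  by exists (a^-1 *: f0); rewrite lie_brZr aE scalerA mulVf // scale1r.
have wA : w \in derived A by rewrite -ef mem_derived.
have [ad adE] : exists g : {linear A -> A}, forall x, g x = ⁅e, x⁆.
  by apply: linear_ex => b x y; rewrite lie_brDZr.
pose C := lker (linfun ad).
have CE x : (x \in C) = (⁅e, x⁆ == 0) by rewrite memv_ker lfunE /= adE.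
have dC : \dim C = 5%N.
  have := limg_ker_dim (linfun ad) fullv; rewrite capfv -/C n6.
  have -> : limg (linfun ad) = <[w]>%VS.
    apply/eqP; rewrite eqEsubv -memvE -ef -adE -(lfunE ad) memv_img ?memvf // andbT lfunE /= adE ef.
    by apply/subvP => _ /memv_imgP[x _ ->]; rewrite lfunE /= adE.
  by rewrite dim_vline w0 addn1 => -[].
have eDC : (<<[:: e]>> + derived A <= C)%VS.
  rewrite subv_add; apply/andP; split.
    by apply/span_subvP => x; rewrite inE CE => /eqP ->; rewrite lie_brxx.
  by apply/subvP => x /dc xc; rewrite CE (lie_centralr xc).
have [Y [Ys YC]] := complement_seq eDC; rewrite span_seq1 dimv_add_vline // d2 dC in Ys.
case: Y Ys YC => [|p [|q [|]]] // _ YC.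
have AE : (<<[:: e; f; p; q]>> + derived A)%VS = fullv.
  apply/eqP; rewrite eqEsubv subvf /=; apply/subvP => x _.
  have /vlineP[b xE] := ew x.
  have : x - b *: f \in C by rewrite CE lie_brDr lie_brNr lie_brZr ef xE subrr.
  rewrite -[X in _ -> X \in _](subrK (b *: f)) => xC; apply: memvD; last first.
    by apply/memvZ/mem_gen; rewrite !inE eqxx ?orbT.
  apply: subvP xC; rewrite YC addvA -span_cat; apply: addvS (subvv _); apply: sub_span => y.
  by rewrite !inE => /or3P[] ->; rewrite ?orbT.
have pC : ⁅e, p⁆ = 0.
  by apply/eqP; rewrite -CE YC; apply: mem_gen; rewrite !inE eqxx.
have qC : ⁅e, q⁆ = 0.
  by apply/eqP; rewrite -CE YC; apply: mem_gen; rewrite !inE eqxx orbT.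
have [c cw ck] : exists2 c : {scalar A}, c w = 0 & forall x, x \in derived A -> c x = 0 -> x \in <[w]>%VS.
  have [w1 [w2 [c1 [c2 [w1A w2A cE [c11 c12] [c21 c22]]]]]] := derived2_coord d2.
  have [|g gE] := @linear_ex _ A k^o (fun x => c2 w * c1 x - c1 w * c2 x).
    move=> b x y; rewrite (linearP c1) (linearP c2) /=.
    rewrite -[RHS]/(b * (c2 w * c1 x - c1 w * c2 x) + (c2 w * c1 y - c1 w * c2 y)); ring.
  exists g => [|x xA]; rewrite gE; first by ring.
  move/eqP; rewrite subr_eq0 => /eqP xE; rewrite (cE x xA).
  have wE := cE w wA; have [c2w|c2w] := eqVneq (c2 w) 0; last first.
    apply/vlineP; exists (c2 x / c2 w); rewrite [X in _ = _ *: X]wE scalerDr !scalerA divfK //.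
    by congr (_ *: _ + _); apply: (mulfI c2w); rewrite xE; field.
  have c1w : c1 w != 0.
    by apply: contra_neq w0 => c1w; rewrite wE c1w c2w !scale0r addr0.
  move/eqP: xE; rewrite c2w mul0r eq_sym mulf_eq0 (negPf c1w) /= => /eqP ->.
  apply/vlineP; exists (c1 x / c1 w); rewrite [X in _ = _ *: X]wE c2w !scale0r !addr0 scalerA divfK //.
have line x y : c ⁅x, y⁆ = 0 -> exists b, ⁅x, y⁆ = b *: w.
  by move=> cxy; apply/vlineP; apply: ck => //; apply: mem_derived.
(* When [c [p, q]] is nonzero, multiples of [p] and [q] correct [f] until it commutes with both
   modulo [w]; multiples of [e] added to [p] and [q] remove the rest. *)
have [cpq|cpq] := eqVneq (c ⁅p, q⁆) 0; last first.
  pose f' := f + (c ⁅f, p⁆ / c ⁅p, q⁆) *: q - (c ⁅f, q⁆ / c ⁅p, q⁆) *: p.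
  have ef' : ⁅e, f'⁆ = w by rewrite !(lie_brDr, lie_brNr, lie_brZr) pC qC !scaler0 subr0 addr0 ef.
  have [|b1 f'p] := line f' p.
    rewrite !(lie_brDl, lie_brNl, lie_brZl) lie_brxx scaler0 subr0 [⁅q, p⁆]lie_brC.
    by rewrite linearD linearZ linearN /= mulrN divfK // subrr.
  have [|b2 f'q] := line f' q.
    rewrite !(lie_brDl, lie_brNl, lie_brZl) lie_brxx scaler0 addr0.
    by rewrite linearB linearZ /= divfK // subrr.
  exists 1; pose p' := p + b1 *: e; pose q' := q + b2 *: e.
  apply: (@class_two_L6_22_split e f' p' q').
  - apply: (gen_change AE) => x; rewrite !inE.
    have me : e \in (<<[:: e; f'; p'; q']>> + derived A)%VS.
      by apply: mem_gen; rewrite !inE eqxx.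
    have mp : p \in (<<[:: e; f'; p'; q']>> + derived A)%VS.
      rewrite -[X in X \in _](addrK (b1 *: e)) memvB ?memvZ //; apply: mem_gen; rewrite !inE eqxx ?orbT //.
    have mq : q \in (<<[:: e; f'; p'; q']>> + derived A)%VS.
      rewrite -[X in X \in _](addrK (b2 *: e)) memvB ?memvZ //; apply: mem_gen; rewrite !inE eqxx ?orbT //.
    case/or4P=> /eqP -> //.
    have mf' : f' \in (<<[:: e; f'; p'; q']>> + derived A)%VS.
      by apply: mem_gen; rewrite !inE eqxx ?orbT.
    rewrite -[X in X \in _](addrK ((c ⁅f, p⁆ / c ⁅p, q⁆) *: q)) memvB ?memvZ //.
    by rewrite -[X in X \in _](subrK ((c ⁅f, q⁆ / c ⁅p, q⁆) *: p)) memvD ?memvZ.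
  - by rewrite lie_brDr lie_brZr lie_brxx scaler0 addr0.
  - by rewrite lie_brDr lie_brZr lie_brxx scaler0 addr0.
  - by rewrite lie_brDr lie_brZr f'p [⁅f', e⁆]lie_brC ef' scalerN subrr.
  - by rewrite lie_brDr lie_brZr f'q [⁅f', e⁆]lie_brC ef' scalerN subrr.
have main p' q' : (<<[:: e; f; p'; q']>> + derived A)%VS = fullv -> ⁅e, p'⁆ = 0 -> ⁅e, q'⁆ = 0 ->
    c ⁅p', q'⁆ = 0 -> c ⁅f, p'⁆ != 0 -> lie_iso A (L6_22 (0 : k)).
  move=> AE' ep eq cpq' cfp; have [b1 pq'] := line _ _ cpq'.
  have [|b2 fq'] := line f (q' - (c ⁅f, q'⁆ / c ⁅f, p'⁆) *: p').
    by rewrite lie_brDr lie_brNr lie_brZr linearB linearZ /= divfK // subrr.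
  pose q'' := q' - (c ⁅f, q'⁆ / c ⁅f, p'⁆) *: p' + b2 *: e.
  have AE'' : (<<[:: e; f; p'; q'']>> + derived A)%VS = fullv.
    apply: (gen_change AE') => x; rewrite !inE.
    have mem y : y \in [:: e; f; p'; q''] -> y \in (<<[:: e; f; p';
      q'']>> + derived A)%VS by exact: mem_gen.
    case/or4P=> /eqP ->; try by apply: mem; rewrite !inE eqxx ?orbT.
    have mq : q'' - b2 *: e + (c ⁅f, q'⁆ / c ⁅f, p'⁆) *: p' \in (<<[:: e; f; p'; q'']>> + derived A)%VS.
      by apply: memvD; [apply: memvB; [|apply/memvZ]|apply/memvZ]; apply: mem; rewrite !inE eqxx ?orbT.
    by rewrite addrK subrK in mq.
  have eq'' : ⁅e, q''⁆ = 0.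
    by rewrite !(lie_brDr, lie_brNr, lie_brZr) ep eq lie_brxx !scaler0 subr0 addr0.
  have fq'' : ⁅f, q''⁆ = 0.
    by rewrite lie_brDr fq' lie_brZr [⁅f, e⁆]lie_brC ef scalerN subrr.
  have pq'' : ⁅p', q''⁆ = b1 *: w.
    by rewrite !(lie_brDr, lie_brNr, lie_brZr) lie_brxx [⁅p', e⁆]lie_brC ep oppr0 !scaler0 subr0 addr0.
  (* Otherwise [q''] commutes with all generators, hence lies in [A^2], and three generators would
     span the four-dimensional [A/A^2]. *)
  have b10 : b1 != 0.
    apply/negP => /eqP b10; have q''c : lie_central q''.
      apply: (central_gen AE'' dc) => x; rewrite !inE => /or4P[] /eqP ->; rewrite ?lie_brxx // lie_brC.
      - by rewrite eq'' oppr0.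
      - by rewrite fq'' oppr0.
      - by rewrite pq'' b10 scale0r oppr0.
    have q''D := stA q''c.
    have : (<<[:: e; f; p']>> + derived A)%VS = fullv.
      apply: (gen_change AE'') => x; rewrite !inE => /or4P[] /eqP ->;
        try by apply: mem_gen; rewrite !inE eqxx ?orbT.
      exact: subvP (addvSr _ _) _ q''D.
    move/(congr1 (fun V => \dim V)); have := dimv_add_leqif <<[:: e; f; p']>>%VS (derived A).
    have := dim_span [:: e; f; p']; rewrite d2 => le1 [le2 _] dE; move: le2; rewrite dE n6.
    by move: le1 => /=; lia.
  by apply: (class_two_L6_22_0 AE'' ep eq'' fq'' b10); rewrite pq'' ef.
exists 0; have [cfp|cfp] := eqVneq (c ⁅f, p⁆) 0; last exact: (main p q).
have [cfq|cfq] := eqVneq (c ⁅f, q⁆) 0; last first.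
  apply: (main q p) => //; last by rewrite lie_brC linearN cpq oppr0.
  by apply: (gen_change AE) => x; rewrite !inE => /or4P[] /eqP ->; apply: mem_gen;
     rewrite !inE eqxx ?orbT.
(* In the remaining case [c] kills all brackets of generators, so [A^2] would be the line [<w>]. *)
have : (derived A <= <[w]>)%VS.
  have efw : ⁅e, f⁆ \in <[w]>%VS by rewrite ef memv_line.
  have fpw : ⁅f, p⁆ \in <[w]>%VS by apply: ck => //; apply: mem_derived.
  have fqw : ⁅f, q⁆ \in <[w]>%VS by apply: ck => //; apply: mem_derived.
  have pqw : ⁅p, q⁆ \in <[w]>%VS by apply: ck => //; apply: mem_derived.
  apply: (derived_gen AE dc) => x y; rewrite !inE => /or4P[] /eqP -> /or4P[] /eqP ->;
    by rewrite ?lie_brxx ?pC ?qC ?mem0v // lie_brC memvN ?pC ?qC ?mem0v.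
by move/dimvS; rewrite d2 dim_vline w0.
Qed.

End ClassTwoSix.

(** * Class three with derived subalgebra of dimension two *)

Lemma nilpotent_derived_proper (k : fieldType) (A : finLieType k) :
  lie_nilpotent A -> derived A != 0%VS -> brv (derived A) fullv != derived A.
Proof.
move=> [c c0] A0; apply/eqP => DE; case/negP: A0; apply/eqP.
suff DC n : lower_central A n.+1 = derived A.
  by rewrite -(DC c); apply/eqP; rewrite -subv0 -c0; apply: lower_centralS.
by elim: n => [|n IH] //; rewrite -[RHS]DE -IH.
Qed.

(** [[A^2, A]] is a line [<z>], so [y |-> [y, c]] amounts to a functional; [x1] is taken outside its
    kernel and [x2] inside it. *)
Lemma class_three_elements (k : fieldType) (A : finLieType k) :
  lie_nilpotent A -> \dim (derived A) = 2%N -> (exists2 x, x \in derived A & ~ lie_central x) ->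
  exists x1 x2 c z : A, [/\ ⁅x1, x2⁆ = c, ⁅x1, c⁆ = z, ⁅x2, c⁆ = 0, z != 0 & lie_central z] /\
    [/\ derived A = (<[c]> + <[z]>)%VS, forall y, ⁅y, c⁆ \in <[z]>%VS &
        forall y y', ⁅y, c⁆ = 0 -> ⁅y', c⁆ = 0 -> ⁅y, y'⁆ \in <[z]>%VS].
Proof.
move=> nA d2 [d dD dnc]; have A0 : derived A != 0%VS by rewrite -dimv_eq0 d2.
have [z [z0 zc zD]] := nilpotent_central nA A0; case=> [dc|zB]; first by case: dnc; apply: dc.
pose B := brv (derived A) fullv.
have BD : (B <= derived A)%VS by apply: brv_sub => x y _ _; apply: mem_derived.
have dB : \dim B = 1%N.
  have := nilpotent_derived_proper nA A0; rewrite -/B eqEdim BD /= d2 => dB.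
  have : \dim <[z]> = 1%N by rewrite dim_vline z0.
  have : (<[z]> <= B)%VS by rewrite -memvE.
  by move/dimvS => + dz; rewrite dz => le1; apply/eqP; rewrite eqn_leq le1 leqNgt dB.
have Bz : B = <[z]>%VS by apply/esym/eqP; rewrite eqEdim dB dim_vline z0 -memvE zB.
have Dz x y : x \in derived A -> ⁅y, x⁆ \in <[z]>%VS.
  by move=> xD; rewrite lie_brC memvN -Bz mem_brv ?memvf.
have [c0 [x1 [c0D xc0]]] : exists c0 x1, c0 \in derived A /\ ⁅x1, c0⁆ = z.
  have [y dy] : exists y, ⁅d, y⁆ <> 0 by apply: NNPP => H; apply: dnc => y; apply: NNPP => dy;
    apply: H; exists y.
  have /vlineP[a yd] := Dz d y dD.
  have a0 : a != 0.
    by apply/eqP => a0; apply: dy; rewrite lie_brC yd a0 scale0r oppr0.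
  by exists d, (a^-1 *: y); rewrite lie_brZl yd scalerA mulVf // scale1r.
have c0z : c0 \notin <[z]>%VS.
  apply/negP => /vlineP[a c0E]; move: xc0; rewrite c0E lie_brZr (lie_centralr zc) scaler0 => z00.
  by rewrite -z00 eqxx in z0.
have DE : derived A = (<[c0]> + <[z]>)%VS.
  apply/esym/eqP; rewrite eqEdim d2 dimv_add_vline // dim_vline z0 andbT subv_add -!memvE c0D.
  by rewrite zD.
have brD x y : exists a b, ⁅x, y⁆ = a *: c0 + b *: z.
  have := mem_derived x y; rewrite DE => /memv_addP[_ /vlineP[a ->] [_ /vlineP[b ->] ->]].
  by exists a, b.
(* In the Jacobi identity for [x1, y, y'] only the [c0]-coefficient of [[y, y']] survives,
   multiplied by [z]. *)
have ker y y' : ⁅y, c0⁆ = 0 -> ⁅y', c0⁆ = 0 -> ⁅y, y'⁆ \in <[z]>%VS.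
  move=> yc y'c; have := lie_jacobi x1 y y'.
  have [a [b ->]] := brD y y'; have [a' [b' ->]] := brD y' x1; have [a'' [b'' ->]] := brD x1 y.
  rewrite !lie_brDr !lie_brZr !(lie_centralr zc) yc y'c xc0 !scaler0 !addr0 => /eqP.
  by rewrite scaler_eq0 (negPf z0) orbF => /eqP ->; rewrite scale0r add0r memvZ ?memv_line.
(* If [x1] bracketed the centralizer of [c0] into [<z>], then by [ker] all brackets would lie in
   [<z>]. *)
have [x2 x2c x12] : exists2 x2, ⁅x2, c0⁆ = 0 & ⁅x1, x2⁆ \notin <[z]>%VS.
  apply: NNPP => H; have x1z y : ⁅y, c0⁆ = 0 -> ⁅x1, y⁆ \in <[z]>%VS.
    by move=> yc; apply: contraT => yz; case: H; exists y.
  have : (derived A <= <[z]>)%VS.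
    apply: derived_sub => x y; have /vlineP[a xE] := Dz _ x c0D; have /vlineP[b yE] := Dz _ y c0D.
    have xk : ⁅x - a *: x1, c0⁆ = 0 by rewrite lie_brDl lie_brNl lie_brZl xc0 xE subrr.
    have yk : ⁅y - b *: x1, c0⁆ = 0 by rewrite lie_brDl lie_brNl lie_brZl xc0 yE subrr.
    rewrite -[x](subrK (a *: x1)) -[y](subrK (b *: x1)); move: (x - _) (y - _) xk yk => x' y' xk yk.
    rewrite lie_brDl !lie_brDr !lie_brZl !lie_brZr lie_brxx.
    rewrite !scaler0 addr0; apply: memvD; [apply: memvD|]; first exact: ker.
      by apply: memvZ; rewrite lie_brC memvN; apply: x1z.
    by apply: memvZ; apply: x1z.
  by move/dimvS; rewrite d2 dim_vline z0.
have [a [b cE]] := brD x1 x2.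
have a0 : a != 0.
  by apply: contraNneq x12 => a0; rewrite cE a0 scale0r add0r memvZ ?memv_line.
have az0 : a *: z != 0 by rewrite scaler_eq0 negb_or a0.
have azc : lie_central (a *: z) by move=> y; rewrite lie_brZl zc scaler0.
have lineE : <[a *: z]>%VS = <[z]>%VS.
  apply/eqP; rewrite eqEdim !dim_vline az0 z0 andbT; apply/subvP => _ /vlineP[e ->].
  by rewrite !memvZ ?memv_line.
have brc y : ⁅y, ⁅x1, x2⁆⁆ = a *: ⁅y, c0⁆.
  by rewrite cE lie_brDr !lie_brZr (lie_centralr zc) scaler0 addr0.
exists x1, x2, ⁅x1, x2⁆, (a *: z); split; split; rewrite ?lineE //.
- by rewrite brc xc0.
- by rewrite brc x2c scaler0.
- by apply/esym/eqP; rewrite eqEdim subv_add -!memvE zD mem_derived /= dimv_add_vline // dim_vline z0 d2.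
- by move=> y; rewrite brc memvZ // Dz.
- move=> y y'; rewrite !brc => /eqP; rewrite scaler_eq0 (negPf a0) /= => /eqP yc /eqP.
  by rewrite scaler_eq0 (negPf a0) /= => /eqP; apply: ker.
Qed.

Section ClassThree.
Variables (k : fieldType) (A : finLieType k).
Hypotheses (nA : lie_nilpotent A) (stA : lie_stem A) (d2 : \dim (derived A) = 2%N).
Variables (x1 x2 c z : A).
Hypotheses (x12 : ⁅x1, x2⁆ = c) (x1c : ⁅x1, c⁆ = z) (x2c : ⁅x2, c⁆ = 0) (z0 : z != 0)
  (zc : lie_central z) (DE : derived A = (<[c]> + <[z]>)%VS) (cz : forall y, ⁅y, c⁆ \in <[z]>%VS)
  (kerz : forall y y', ⁅y, c⁆ = 0 -> ⁅y', c⁆ = 0 -> ⁅y, y'⁆ \in <[z]>%VS).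

(** Multiples of [x1], then of [x2] and [c], bring any element into the common centralizer [Y] of
    [c] and [x1]. As [Ys] completes [z] to a basis of [Y], the dimension exceeds its size by 4. *)
Lemma class_three_split : exists Ys : seq A, exists Y : {vspace A},
  [/\ forall y, y \in Y <-> ⁅y, c⁆ = 0 /\ ⁅x1, y⁆ = 0, Y = <<Ys ++ [:: z]>>%VS, free (Ys ++ [:: z]),
      (<<[:: x1; x2; c]>> + Y)%VS = fullv & \dim {:A} = (size Ys + 4)%N].
Proof.
have [||Y YE] := @vspace_of_prop k A (fun y => ⁅y, c⁆ = 0 /\ ⁅x1, y⁆ = 0).
- by rewrite lie_br0l lie_br0r.
- move=> a x y [xc xx] [yc yx]; rewrite lie_brDZl lie_brDZr xc xx yc yx scaler0.
  by rewrite addr0.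
have zY : z \in Y by apply/YE; rewrite (lie_centralr zc) zc.
have [Ys [Yss YsE]] := complement_seq (zY : (<[z]> <= Y)%VS).
have dz : \dim <[z]> = 1%N by rewrite dim_vline z0.
have dY : (1 <= \dim Y)%N by rewrite -dz dimvS.
have A3 : (<<[:: x1; x2; c]>> + Y)%VS = fullv.
  apply/eqP; rewrite eqEsubv subvf /=; apply/subvP => x _; have /vlineP[a xE] := cz x.
  have [u uc ->] : exists2 u, ⁅u, c⁆ = 0 & x = u + a *: x1.
    by exists (x - a *: x1); rewrite ?subrK // lie_brDl lie_brNl lie_brZl x1c xE subrr.
  have := mem_derived x1 u; rewrite DE => /memv_addP[_ /vlineP[b ->] [_ /vlineP[d ->] ue]].
  have vY : u - b *: x2 - d *: c \in Y.
    apply/YE; split.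
      by rewrite !(lie_brDl, lie_brNl, lie_brZl) uc x2c lie_brxx !scaler0 !subr0.
    by rewrite !(lie_brDr, lie_brNr, lie_brZr) ue x12 x1c addrAC addrK subrr.
  have uE : u = u - b *: x2 - d *: c + d *: c + b *: x2 by rewrite !subrK.
  rewrite uE.
  do 3 (apply: memvD; last by apply/memvZ/mem_gen; rewrite !inE eqxx ?orbT).
  exact: subvP (addvSr _ _) _ vY.
have YsY : Y = <<Ys ++ [:: z]>>%VS by rewrite span_cat span_seq1.
have Yb : basis_of Y (Ys ++ [:: z]).
  by rewrite basisEdim -YsY subvv size_cat Yss dz /= subnK.
have killc x : x \in (<[x2]> + (<[c]> + Y))%VS -> ⁅x, c⁆ = 0.
  case/memv_addP=> _ /vlineP[a ->] [_ /memv_addP[_ /vlineP[b ->] [y /YE[yc _] ->]] ->].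
  by rewrite !lie_brDl !lie_brZl x2c lie_brxx yc !scaler0 !addr0.
exists Ys, Y; split=> //; first exact: basis_free Yb.
rewrite -A3 !span_cons span_nil addv0 -!addvA dimv_add_vline; last first.
  by apply/negP => /killc; rewrite x1c => z00; case/eqP: z0.
rewrite dimv_add_vline; last first.
  apply/negP => /memv_addP[_ /vlineP[a ->] [y /YE[yc yx] x2E]].
  have cE : c = a *: z by rewrite -x12 x2E lie_brDr lie_brZr x1c yx addr0.
  by move: x1c; rewrite cE lie_brZr (lie_centralr zc) scaler0 => z00; case/eqP: z0.
rewrite dimv_add_vline; last first.
  by apply/negP => /YE[_]; rewrite x1c => z00; case/eqP: z0.
have -> : \dim Y = (size Ys + 1)%N by rewrite -dz Yss subnK // dimvS.
by rewrite addn1 !addnS addn0.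
Qed.

Lemma class_three_mem y : y \in derived A -> ⁅x1, y⁆ = 0 -> exists a, y = a *: z.
Proof.
rewrite DE => /memv_addP[_ /vlineP[p ->] [_ /vlineP[q ->] ->]].
rewrite lie_brDr !lie_brZr (lie_centralr zc) x1c scaler0 addr0 => /eqP.
by rewrite scaler_eq0 (negPf z0) orbF => /eqP ->; exists q; rewrite scale0r add0r.
Qed.

Section Split.
Variables (Ys : seq A) (Y : {vspace A}).
Hypotheses (YE : forall y, y \in Y <-> ⁅y, c⁆ = 0 /\ ⁅x1, y⁆ = 0) (YsE : Y = <<Ys ++ [:: z]>>%VS)
  (Yf : free (Ys ++ [:: z])) (A3 : (<<[:: x1; x2; c]>> + Y)%VS = fullv)
  (nE : \dim {:A} = (size Ys + 4)%N).

(** Commuting with [x1], [x2], [c] and [Y] means being central, hence lying in [A^2] by [stA]; there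
    the kernel of [ad x1] is [<z>]. *)
Lemma class_three_central y : y \in Y -> ⁅x2, y⁆ = 0 -> (forall u, u \in Y -> ⁅y, u⁆ = 0) ->
  exists a, y = a *: z.
Proof.
move=> yY x2y yu; have /YE[yc x1y] := yY; apply: class_three_mem => //.
apply: stA => x; have : x \in (<<[:: x1; x2; c]>> + Y)%VS by rewrite A3 memvf.
case/memv_addP=> x' xU [u /yu uy ->]; rewrite lie_brDr uy addr0.
apply/eqP; rewrite -memv0; apply: (@br_span _ _ [:: y] [:: x1; x2; c]) xU => [v w|]; last first.
  by rewrite memv_span // mem_head.
rewrite !inE => /eqP -> /or3P[] /eqP ->; rewrite ?yc ?mem0v // lie_brC memvN ?x1y ?x2y mem0v //.
Qed.

(** The only possibly nonzero bracket left on such elements is with [x2], a functional with values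
    in [<z>]. Two elements independent modulo [z] have a nontrivial combination that it kills, and
    this is central. *)
Lemma class_three_pair y y' : y \in Y -> y' \in Y ->
  (forall u, u \in Y -> ⁅y, u⁆ = 0) -> (forall u, u \in Y -> ⁅y', u⁆ = 0) ->
  (forall a b d, a *: y + b *: y' = d *: z -> a = 0 /\ b = 0) -> False.
Proof.
move=> yY y'Y yu y'u ind.
have /YE[yc _] := yY; have /YE[y'c _] := y'Y.
have /vlineP[b bE] := kerz x2c yc; have /vlineP[b' b'E] := kerz x2c y'c.
have [b0|b0] := eqVneq b 0.
  have [|d yE] := class_three_central yY _ yu; first by rewrite bE b0 scale0r.
  by have [|/eqP] := ind 1 0 d; rewrite ?oner_eq0 // scale1r scale0r addr0.
have [||u uY|d yE] := @class_three_central (b' *: y - b *: y').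
- by rewrite memvB ?memvZ.
- by rewrite lie_brDr lie_brNr !lie_brZr bE b'E !scalerA mulrC subrr.
- by rewrite lie_brDl lie_brNl !lie_brZl yu // y'u // !scaler0 subrr.
have [|_ /eqP] := ind b' (- b) d; first by rewrite scaleNr.
by rewrite oppr_eq0 (negPf b0).
Qed.

Lemma class_three_memY y : y \in Ys -> y \in Y.
Proof. by move=> yY; rewrite YsE memv_span // mem_cat yY. Qed.

(** For [y] commuting with [c], the cocycle identity at [x1, c, y] gives [f (y, z) = - f ([x1, y],
    c)], which is 0 for [x2] and on [Y]. Hence [e <= 1] and [s >= n - 2]. The remaining case
    [n = 7], [e = 1] is excluded because a cocycle with [f (x1, z)] nonzero makes [Y] abelian. *)
Lemma class_three_large s : (7 <= \dim {:A})%N -> lie_s A s -> (6 <= s)%N.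
Proof.
move=> n7 As; have cD : c \in derived A by rewrite -x12 mem_derived.
have zD : z \in derived A by rewrite -x1c mem_derived.
have [Q [p pq]] := central_quotient_ex zc; have [pm ps pk] := pq.
have dQ := dim_derived_central_quotient pq z0; rewrite zD d2 in dQ.
have Q0 : derived Q != 0%VS by rewrite -dimv_eq0; apply/eqP => e0; rewrite e0 in dQ.
have [t Qt _] := lie_s_ex (nilpotent_surj pm ps nA) Q0.
have [e Ge] := central_slice_dim_ex z.
have sE := lie_s_central z0 zc zD pq Ge As Qt.
have slice0 f : lie_cocycle f -> f (x2, z) = 0 /\ forall y, y \in Y -> f (y, z) = 0.
  move=> cf; have key y : ⁅y, c⁆ = 0 -> f (⁅x1, y⁆, c) = - f (y, z).
    move=> yc; have := cocycle_jacobi cf x1 c y.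
    rewrite x1c [⁅c, y⁆]lie_brC yc oppr0 (cocycle0l cf) addr0 [⁅y, x1⁆]lie_brC (cocycleNl cf).
    by rewrite (cocycleC cf z) => /eqP; rewrite subr_eq0 => /eqP <-.
  split; first by have := key _ x2c; rewrite x12 (cocycle_alt cf) => /eqP; rewrite eq_sym oppr_eq0 => /eqP.
  move=> y /YE[yc yx]; have := key _ yc; rewrite yx (cocycle0l cf) => /eqP.
  by rewrite eq_sym oppr_eq0 => /eqP.
have slice1 f : lie_cocycle f -> f (x1, z) = 0 -> forall x, f (x, z) = 0.
  move=> cf fx1 x; have [fx2 fY] := slice0 f cf.
  have fs : central_slice z (fun x => f (x, z)) by exists f.
  have fc : f (c, z) = 0 := central_slice_derived zc fs cD.
  have : x \in (<<[:: x1; x2; c]>> + Y)%VS by rewrite A3 memvf.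
  case/memv_addP=> x' xU [y yY ->]; rewrite (cocycleDl cf) (fY y yY) addr0.
  move: xU; rewrite !span_cons span_nil addv0.
  case/memv_addP=> _ /vlineP[a1 ->] [_ /memv_addP[_ /vlineP[a2 ->] [_ /vlineP[a3 ->] ->]] ->].
  by rewrite !(cocycleDl cf) !(cocycleZl cf) fx1 fx2 fc !mulr0 !addr0.
have e1 : (e <= 1)%N.
  apply: (fdim_le_points (t := fun i : 'I_1 => x1) (central_slice_closed z) Ge).
  by move=> g [f cf gE] /(_ ord0); rewrite gE => /slice1 g0 x; rewrite gE g0.
rewrite leqNgt; apply/negP => s5.
have n7' : \dim {:A} = 7%N by lia.
have e1' : e = 1%N by lia.
have e0 : (0 < e)%N by rewrite e1'.
have [g [[f cf gE] [x gx] _]] := fdim_vanish (fun i : 'I_0 => 0 : A) (central_slice_closed z) Ge e0.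
have fx1 : f (x1, z) != 0.
  by apply: contra_neq gx => fx1; rewrite gE slice1.
have YY u v : u \in Y -> v \in Y -> ⁅u, v⁆ = 0.
  move=> /YE[uc ux] /YE[vc vx]; have /vlineP[a uvE] := kerz uc vc.
  have := cocycle_jacobi cf x1 u v.
  rewrite ux [⁅v, x1⁆]lie_brC vx oppr0 !(cocycle0l cf) add0r addr0 uvE (cocycleZl cf) (cocycleC cf).
  by move=> /eqP; rewrite mulf_eq0 oppr_eq0 (negPf fx1) orbF => /eqP ->; rewrite scale0r.
have Y3 : size Ys = 3%N by lia.
case: Ys Y3 YsE Yf class_three_memY => [|y [|y' [|y'' [|]]]] // _ YsE' Yf' memY.
have yY : y \in Y by apply: memY; rewrite mem_head.
have y'Y : y' \in Y by apply: memY; rewrite !inE eqxx orbT.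
apply: (@class_three_pair y y') => // [u uY|u uY|a b d abd]; try exact: YY.
move: Yf'; rewrite !free_cons => /and3P[yn y'n _].
have a0 : a = 0.
  apply: contraNeq yn => a0; rewrite -[y](scalerK a0) memvZ //.
  have -> : a *: y = d *: z - b *: y' by rewrite -abd addrK.
  by rewrite memvB ?memvZ ?memv_span // !inE eqxx ?orbT.
split=> //; apply: contraNeq y'n => b0; rewrite -[y'](scalerK b0) memvZ //.
move: abd; rewrite a0 scale0r add0r => ->.
by rewrite memvZ ?memv_span // !inE eqxx ?orbT.
Qed.

(** The three algebras have 0, 1 and 2 elements in [Ys]; [class_three_central] and
    [class_three_pair] make the structure constants that must be inverted nonzero. *)
Lemma class_three_small : (\dim {:A} <= 6)%N ->
  [\/ lie_iso A (L4_3 k), lie_iso A (L5_5 k) | lie_iso A (L6_10 k)].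
Proof.
move=> n6; have zr x := lie_centralr zc x.
have cx1 : ⁅c, x1⁆ = - z by rewrite lie_brC x1c.
have x21 : ⁅x2, x1⁆ = - c by rewrite lie_brC x12.
have cx2 : ⁅c, x2⁆ = 0 by rewrite lie_brC x2c oppr0.
have span4 U : {subset [:: x1; x2; c] <= U} -> {subset Ys ++ [:: z] <= <<U>>%VS} -> <<U>>%VS = fullv.
  move=> sU sY; apply/eqP; rewrite eqEsubv subvf -A3 subv_add YsE /= (sub_span sU) /=.
  by apply/span_subvP.
case: Ys nE YsE Yf class_three_memY span4 => [|y [|y' [|]]] /= nE' YsE' Yf' memY span4; last by lia.
- apply: Or31; pose X := [:: x1; x2; c; z].
  have Xs : <<X>>%VS = fullv.
    apply: span4 => u; rewrite !inE; first by case/or3P=> ->; rewrite ?orbT.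
    by move/eqP ->; rewrite memv_span // !inE eqxx ?orbT.
  apply: (@nat_table_iso _ 3 (LieTable (@L4_3_jacobi k)) _ _ X erefl) => //.
  by case=> [|[|[|[|i]]]] [|[|[|[|j]]]] //=; rewrite ?andbF // => _;
    rewrite /X /= ?scale_unit ?x12 ?x1c ?x2c ?zr.
- apply: Or32; have yY : y \in Y by apply: memY; rewrite mem_head.
  have /YE[yc x1y] := yY; have /vlineP[b bE] := kerz x2c yc.
  have b0 : b != 0.
    apply/negP => /eqP b0; have [|u|a yE] := class_three_central yY _ _.
    - by rewrite bE b0 scale0r.
    - rewrite YsE' => uY; apply/eqP; rewrite -memv0.
      apply: (@br_span _ _ [:: y] [:: y; z]) uY => [v w|]; last by rewrite memv_span // mem_head.
      by rewrite !inE => /eqP -> /orP[] /eqP ->; rewrite ?lie_brxx ?zr mem0v.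
    - by move: Yf'; rewrite free_cons span_seq1 yE memvZ ?memv_line.
  pose X := [:: x1; x2; c; b^-1 *: y; z].
  have Xs : <<X>>%VS = fullv.
    apply: span4 => u; rewrite !inE; first by case/or3P=> ->; rewrite ?orbT.
    case/orP=> /eqP ->; last by rewrite memv_span // !inE eqxx ?orbT.
    by rewrite -(scalerKV b0 y) memvZ // memv_span // !inE eqxx ?orbT.
  have x2y : ⁅x2, b^-1 *: y⁆ = z by rewrite lie_brZr bE scalerA mulVf // scale1r.
  have cy : ⁅c, y⁆ = 0 by rewrite lie_brC yc oppr0.
  apply: (@nat_table_iso _ 4 (LieTable (@L5_5_jacobi k)) _ _ X erefl) => //.
  by case=> [|[|[|[|[|i]]]]] [|[|[|[|[|j]]]]] //=; rewrite ?andbF // => _;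
    rewrite /X /= ?scale_unit ?x12 ?x1c ?x2c ?zr ?x2y ?lie_brZr ?x1y ?cy ?scaler0.
- apply: Or33; have yY : y \in Y by apply: memY; rewrite mem_head.
  have y'Y : y' \in Y by apply: memY; rewrite !inE eqxx orbT.
  have /YE[yc x1y] := yY; have /YE[y'c x1y'] := y'Y.
  have /vlineP[b bE] := kerz x2c yc; have /vlineP[b' b'E] := kerz x2c y'c.
  have /vlineP[t tE] := kerz yc y'c.
  have y'y : ⁅y', y⁆ = - (t *: z) by rewrite lie_brC tE.
  have t0 : t != 0.
    apply/negP => /eqP t0; apply: (@class_three_pair y y') => // [u|u|a d e ade].
    - rewrite YsE' => uY; apply/eqP; rewrite -memv0.
      apply: (@br_span _ _ [:: y] [:: y; y'; z]) uY => [v w|]; last by rewrite memv_span // mem_head.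
      by rewrite !inE => /eqP -> /or3P[] /eqP ->; rewrite ?lie_brxx ?zr ?tE ?t0 ?scale0r mem0v.
    - rewrite YsE' => uY; apply/eqP; rewrite -memv0.
      apply: (@br_span _ _ [:: y'] [:: y; y'; z]) uY => [v w|]; last by rewrite memv_span // mem_head.
      by rewrite !inE => /eqP -> /or3P[] /eqP ->; rewrite ?lie_brxx ?zr ?y'y ?t0 ?scale0r ?oppr0 mem0v.
    - move: Yf'; rewrite !free_cons => /and3P[yn y'n _].
      have a0 : a = 0.
        apply: contraNeq yn => a0; rewrite -[y](scalerK a0) memvZ //.
        have -> : a *: y = e *: z - d *: y' by rewrite -ade addrK.
        by rewrite memvB ?memvZ ?memv_span // !inE eqxx ?orbT.
      split=> //; apply: contraNeq y'n => d0; rewrite -[y'](scalerK d0) memvZ //.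
      move: ade; rewrite a0 scale0r add0r => ->.
      by rewrite memvZ ?memv_span // !inE eqxx ?orbT.
  (* The correction makes [v] commute with [y] and [y']; it exists because [[y, y'] = t z] with [t]
     nonzero. *)
  pose v := x2 + ((b / t) *: y' - (b' / t) *: y).
  pose X := [:: x1; v; c; y; t^-1 *: y'; z].
  have yX : y \in <<X>>%VS by rewrite memv_span // !inE eqxx ?orbT.
  have y'X : y' \in <<X>>%VS by rewrite -(scalerKV t0 y') memvZ // memv_span // !inE eqxx ?orbT.
  have x2X : x2 \in <<X>>%VS.
    rewrite -[x2](addrK ((b / t) *: y' - (b' / t) *: y)) memvB ?memvB ?memvZ //.
    by rewrite memv_span // !inE eqxx ?orbT.
  have Xs : <<X>>%VS = fullv.
    apply/eqP; rewrite eqEsubv subvf -A3 subv_add YsE' /=; apply/andP; split; apply/span_subvP => u;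
      rewrite !inE => /or3P[] /eqP -> //; by rewrite memv_span // !inE eqxx ?orbT.
  have x1v : ⁅x1, v⁆ = c.
    by rewrite /v lie_brDr lie_brDr lie_brNr !lie_brZr x12 x1y x1y' !scaler0 subrr addr0.
  have vc : ⁅v, c⁆ = 0.
    by rewrite /v lie_brDl lie_brDl lie_brNl !lie_brZl x2c yc y'c !scaler0 subrr addr0.
  have vy : ⁅v, y⁆ = 0.
    rewrite /v lie_brDl lie_brDl lie_brNl !lie_brZl bE y'y lie_brxx !scaler0 subr0.
    by rewrite scalerN scalerA divfK // subrr.
  have vy' : ⁅v, y'⁆ = 0.
    rewrite /v lie_brDl lie_brDl lie_brNl !lie_brZl b'E tE lie_brxx !scaler0 add0r.
    by rewrite scalerA divfK // subrr.
  have cy : ⁅c, y⁆ = 0 by rewrite lie_brC yc oppr0.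
  have cy' : ⁅c, y'⁆ = 0 by rewrite lie_brC y'c oppr0.
  have yty : ⁅y, t^-1 *: y'⁆ = z by rewrite lie_brZr tE scalerA mulVf // scale1r.
  apply: (@nat_table_iso _ 5 (LieTable (@L6_10_jacobi k)) _ _ X erefl) => //.
  by case=> [|[|[|[|[|[|i]]]]]] [|[|[|[|[|[|j]]]]]] //=; rewrite ?andbF // => _;
    rewrite /X /= ?scale_unit ?x1v ?x1c ?vc ?zr ?vy ?yty ?lie_brZr ?x1y ?x1y' ?vy' ?cy ?cy' ?scaler0.
Qed.
End Split.
End ClassThree.

Lemma derived_two_stem (k : closedFieldType) (A : finLieType k) s :
  2%N \notin [pchar k] -> lie_nilpotent A -> lie_stem A -> \dim (derived A) = 2%N ->
  lie_s A s -> (s <= 5)%N ->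
  [\/ lie_iso A (L5_8 k), lie_iso A (L4_3 k), lie_iso A (L5_5 k) |
      lie_iso A (L6_10 k) \/ exists eps : k, lie_iso A (L6_22 eps)].
Proof.
move=> char_k nA stA d2 As s5.
case: (classic (exists2 x, x \in derived A & ~ lie_central x)) => [c3|nc3].
  have [x1 [x2 [c [z [[x12 x1c x2c z0 zc] [DE cz kerz]]]]]] := class_three_elements nA d2 c3.
  have [Ys [Y [YE YsE Yf A3 nE]]] := class_three_split x12 x1c x2c z0 zc DE cz.
  have [n7|n6] := leqP 7 (\dim {:A}).
    have := class_three_large nA stA d2 x12 x1c x2c z0 zc DE kerz YE YsE Yf A3 nE n7 As.
    by rewrite leqNgt ltnS s5.
  have [] := class_three_small stA d2 x12 x1c x2c z0 zc DE kerz YE YsE Yf A3 nE n6 => h.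
  - exact: Or42.
  - exact: Or43.
  - by apply: Or44; left.
have dc x : x \in derived A -> lie_central x.
  by move=> xD; apply: NNPP => xc; apply: nc3; exists x.
have [n7|n6] := leqP 7 (\dim {:A}).
  by have := class_two_stem_large stA dc d2 n7 As; rewrite leqNgt ltnS s5.
have [n5|n5] := leqP 5 (\dim {:A}).
  have [n6'|n6'] := eqVneq (\dim {:A}) 6%N.
    by apply: Or44; right; apply: class_two_six.
  by apply: Or41; apply: class_two_five => //; lia.
(* In dimension at most 4 two generators modulo [A^2] suffice, and their bracket alone would span
   [A^2]. *)
have [Y [Ys /esym YA]] := complement_seq (subvf (derived A)); rewrite d2 in Ys.
have [u [v uvY]] : exists u v, {subset Y <= [:: u; v]}.
  case: Y Ys {YA} => [|u [|v [|w Y]]] /= Ys; last by lia.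
  - by exists 0, 0.
  - by exists u, u => x; rewrite !inE => ->.
  - by exists u, v.
have UA : (<<[:: u; v]>> + derived A)%VS = fullv.
  by apply: (gen_change YA) => x /uvY; apply: mem_gen.
have : (derived A <= <[⁅u, v⁆]>)%VS.
  apply: (derived_gen UA dc) => x y; rewrite !inE => /orP[] /eqP -> /orP[] /eqP ->;
    rewrite ?lie_brxx ?mem0v ?memv_line // lie_brC memvN memv_line //.
by move/dimvS; rewrite d2 dim_vline; case: (_ != 0).
Qed.

(** * Derived subalgebra of dimension three *)

Section Elements.
Variables (k : fieldType).

Lemma dsum_Ab_basis (T : finLieType k) (X : seq T) j (Q : finLieType k) :
  lie_iso Q (T ⊕ Ab k j) -> <<X>>%VS = fullv ->
  exists (h : {linear T -> Q}) (R : seq Q), [/\ lie_morphism h, injective h, size R = j,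
    forall x r, r \in R -> ⁅x, r⁆ = 0 & <<map h X ++ R>>%VS = fullv].
Proof.
move=> /lie_iso_sym[f fm [f' fK f'K]] Xs.
have [ia [ib [pa [pb [[iam ibm _ _] [iaE ibE _ _]]]]]] := dsum_maps T (Ab k j).
exists (f \o ia : {linear T -> Q}), [seq f (ib r) | r <- vbasis {: Ab k j}]; split.
- by move=> x y /=; rewrite iam fm.
- by move=> x y /= /(can_inj fK); rewrite !iaE => -[].
- by rewrite size_map size_tuple dim_Ab.
- move=> x _ /mapP[r _ ->]; rewrite -[x]f'K -fm (_ : ⁅f' x, ib r⁆ = 0) ?linear0 // ibE.
  congr pair; rewrite /= ?lie_br0r //; apply/eqP; rewrite -memv0.
  have /eqP <- : derived (Ab k j) == 0%VS by rewrite -dimv_eq0 dim_derived_Ab.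
  exact: mem_derived.
- apply/eqP; rewrite eqEsubv subvf /=; apply/subvP => y _; rewrite -[y]f'K span_cat.
  have -> : f' y = ia (f' y).1 + ib (f' y).2.
    by rewrite iaE ibE; case: (f' y) => u v; congr pair; rewrite /= ?addr0 ?add0r.
  rewrite linearD memv_add //.
    have : (f' y).1 \in <<X>>%VS by rewrite Xs memvf.
    rewrite -[X]in_tupleE => /coord_span ->; rewrite !linear_sum memv_suml // => i _.
    rewrite !linearZ memvZ // memv_span //.
    by apply/mapP; exists X`_i => //; apply: mem_nth.
  rewrite (coord_vbasis (memvf (f' y).2)) !linear_sum memv_suml // => i _.
  rewrite !linearZ memvZ // memv_span //.
  by apply/mapP; exists (vbasis {: Ab k j})`_i => //; apply: mem_nth; rewrite size_tuple.
Qed.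

Lemma L5_8_elements (Q : finLieType k) j : lie_iso Q (L5_8 k ⊕ Ab k j) ->
  exists (q1 q2 q3 : Q) (R : seq Q), [/\ size R = j, ⁅q2, q3⁆ = 0,
    forall x r, r \in R -> ⁅x, r⁆ = 0, forall x y t : Q, ⁅x, ⁅y, t⁆⁆ = 0 &
    (<<[:: q1, q2, q3 & R]>> + derived Q)%VS = fullv].
Proof.
move=> QT; have := @table_basis k 4 (LieTable (@L5_8_jacobi k)) _ erefl isT.
set X := map _ _ => -[Xsz Xs _ brE].
have [h [R [hm hi Rj Rc Qs]]] := dsum_Ab_basis QT Xs.
have b01 : ⁅X`_0, X`_1⁆ = X`_3 := etrans (brE 0%N 1%N isT) (scale_unit _).
have b02 : ⁅X`_0, X`_2⁆ = X`_4 := etrans (brE 0%N 2%N isT) (scale_unit _).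
have b12 : ⁅X`_1, X`_2⁆ = 0 := brE 1%N 2%N isT.
have xc i x : (i \in [:: 3; 4])%N -> ⁅x, h X`_i⁆ = 0.
  move=> i34; have : x \in <<map h X ++ R>>%VS by rewrite Qs memvf.
  have xi : h X`_i \in <<[:: h X`_i]>>%VS by rewrite memv_span // mem_head.
  move=> xX; apply/eqP; rewrite -memv0; apply: (br_span _ xX xi) => u v.
  rewrite mem_cat mem_seq1 => /orP[/mapP[y yX ->]|uR] /eqP ->; last first.
    by rewrite lie_brC Rc // oppr0 mem0v.
  rewrite -hm; have /(nthP 0)[l lX <-] := yX; rewrite Xsz in lX.
  suff -> : ⁅X`_l, X`_i⁆ = 0 by rewrite linear0 mem0v.
  move: i34; rewrite !inE => /orP[] /eqP ->.
    have [l3|l3|->] := ltngtP l 3%N; last by rewrite lie_brxx.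
      by rewrite brE ?l3 //; case: l l3 {lX} => [|[|[|]]].
    by rewrite lie_brC brE ?l3 ?oppr0 //; lia.
  have [l4|l4|->] := ltngtP l 4%N; last by rewrite lie_brxx.
    by rewrite brE ?l4 //; case: l l4 {lX} => [|[|[|[|]]]].
  by lia.
have D34 : (derived Q <= <<[:: h X`_3; h X`_4]>>)%VS.
  apply: derived_sub => x y.
  have : x \in <<map h X ++ R>>%VS by rewrite Qs memvf.
  have : y \in <<map h X ++ R>>%VS by rewrite Qs memvf.
  move=> yX xX; apply: (br_span _ xX yX) => u v; rewrite !mem_cat.
  case/orP=> [/mapP[a aX ->]|uR]; last by move=> _; rewrite lie_brC Rc // oppr0 mem0v.
  case/orP=> [/mapP[b bX ->]|vR]; last by rewrite Rc // mem0v.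
  rewrite -hm; have /(nthP 0)[l lX <-] := aX; have /(nthP 0)[m mX <-] := bX; rewrite Xsz in lX mX.
  have key l' m' : (l' < m' <= 4)%N -> h ⁅X`_l', X`_m'⁆ \in <<[:: h X`_3; h X`_4]>>%VS.
    move=> lm; rewrite brE //; case: l' m' lm => [|[|[|[|[|l']]]]] [|[|[|[|[|m']]]]] //= _;
     by rewrite ?scale_unit ?linear0 ?mem0v // memv_span // !inE eqxx ?orbT.
  have [lm|ml|->] := ltngtP l m; last by rewrite lie_brxx linear0 mem0v.
    by apply: key; rewrite lm.
  by rewrite lie_brC linearN memvN key // ml.
exists (h X`_0), (h X`_1), (h X`_2), R; split=> //.
- by rewrite -hm b12 linear0.
- move=> x y t; have : ⁅y, t⁆ \in <<[:: h X`_3; h X`_4]>>%VS by apply: subvP D34 _ _; apply: mem_derived.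
  rewrite span_cons span_seq1 => /memv_addP[_ /vlineP[a ->] [_ /vlineP[b ->] ->]].
  by rewrite lie_brDr !lie_brZr !xc // !scaler0 addr0.
- apply/eqP; rewrite eqEsubv subvf -Qs andTb; apply/span_subvP => u; rewrite mem_cat.
  case/orP=> [/mapP[y yX ->]|uR]; last by apply: mem_gen; rewrite !inE uR !orbT.
  have /(nthP 0)[l lX <-] := yX; rewrite Xsz in lX.
  case: l lX => [|[|[|[|[|l]]]]] // _; try by apply: mem_gen; rewrite !inE eqxx ?orbT.
    by rewrite -b01 hm; apply: subvP (addvSr _ _) _ _; apply: mem_derived.
  by rewrite -b02 hm; apply: subvP (addvSr _ _) _ _; apply: mem_derived.
Qed.

Lemma L4_3_elements (Q : finLieType k) : lie_iso Q (L4_3 k ⊕ Ab k 0) ->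
  exists q1 q2 : Q, [/\ ⁅q2, ⁅q1, q2⁆⁆ = 0, forall x, ⁅x, ⁅q1, ⁅q1, q2⁆⁆⁆ = 0 &
    <<[:: q1; q2; ⁅q1, q2⁆; ⁅q1, ⁅q1, q2⁆⁆]>>%VS = fullv].
Proof.
move=> QT; have := @table_basis k 3 (LieTable (@L4_3_jacobi k)) _ erefl isT.
set X := map _ _ => -[Xsz Xs _ brE].
have [h [R [hm hi Rj Rc Qs]]] := dsum_Ab_basis QT Xs.
have b01 : ⁅X`_0, X`_1⁆ = X`_2 := etrans (brE 0%N 1%N isT) (scale_unit _).
have b02 : ⁅X`_0, X`_2⁆ = X`_3 := etrans (brE 0%N 2%N isT) (scale_unit _).
have b12 : ⁅X`_1, X`_2⁆ = 0 := brE 1%N 2%N isT.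
have b03 : ⁅X`_0, X`_3⁆ = 0 := brE 0%N 3%N isT.
have b13 : ⁅X`_1, X`_3⁆ = 0 := brE 1%N 3%N isT.
have b23 : ⁅X`_2, X`_3⁆ = 0 := brE 2%N 3%N isT.
have {Rj Rc} R0 : R = [::] by case: R Rj {Rc Qs}.
rewrite R0 cats0 in Qs.
have XE : map h X = [:: h X`_0; h X`_1; h X`_2; h X`_3] by [].
exists (h X`_0), (h X`_1); rewrite -hm b01 -!hm b02 b12 linear0 -XE; split=> // x.
have : x \in <<map h X>>%VS by rewrite Qs memvf.
have xi : h X`_3 \in <<[:: h X`_3]>>%VS by rewrite memv_span // mem_head.
move=> xX; apply/eqP; rewrite -memv0; apply: (br_span _ xX xi) => u v.
rewrite XE !inE => /or4P[] /eqP -> /eqP ->; rewrite -hm ?b03 ?b13 ?b23 ?lie_brxx linear0 mem0v //.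
Qed.

End Elements.

(* An extension of L_{5,8} + A(j) by a central line <z>, seen in lifts of a basis. *)
Section ExtensionL58.
Variables (k : fieldType) (A : finLieType k) (z e1 e2 e3 : A) (R : seq A) (zeta : {scalar A}).
Let w1 := ⁅e1, e2⁆.
Let w2 := ⁅e1, e3⁆.
Hypotheses (zc : lie_central z) (zetaz : zeta z = 1)
  (w1z : forall x, ⁅x, w1⁆ \in <[z]>%VS) (w2z : forall x, ⁅x, w2⁆ \in <[z]>%VS)
  (e23 : ⁅e2, e3⁆ \in <[z]>%VS) (Rz : forall x r, r \in R -> ⁅x, r⁆ \in <[z]>%VS)
  (DE : derived A = <<[:: w1; w2; z]>>%VS)
  (AE : (<<[:: e1, e2, e3 & R]>> + derived A)%VS = fullv).

Lemma zetaE x : x \in <[z]>%VS -> x = zeta x *: z.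
Proof. by case/vlineP=> a ->; rewrite linearZ /= zetaz mulr1. Qed.

(* A second slice dimension forces class two: f(y, z) is governed by y |-> [y, w_j]. *)
Lemma extension_L58_class_two e : fdim (central_slice z) e -> (2 <= e)%N ->
  forall x, x \in derived A -> lie_central x.
Proof.
move=> Ge e2'; pose l1 x := zeta ⁅x, w1⁆; pose l2 x := zeta ⁅x, w2⁆.
have w1A : w1 \in derived A by exact: mem_derived.
have w2A : w2 \in derived A by exact: mem_derived.
(* No single value [f (t, z)] determines the slice, as that would give [e <= 1]. Below, each nonzero
   value of [l1] or [l2] on a generator would produce such a [t]. *)
have noP t : ~ (forall f, lie_cocycle f -> f (t, z) = 0 ->
   forall x, x \in [:: e1, e2, e3 & R] -> f (x, z) = 0).
  move=> H; suff : (e <= 1)%N by rewrite leqNgt e2'.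
  apply: (fdim_le_points (t := fun i : 'I_1 => t) (central_slice_closed z) Ge) => g gs /(_ ord0) gt x.
  have [f cf gE] := gs; rewrite gE in gt.
  have : x \in (<<[:: e1, e2, e3 & R]>> + derived A)%VS by rewrite AE memvf.
  case/memv_addP=> u uU [d dD ->].
  rewrite (flinD (central_slice_lin gs)) (central_slice_derived zc gs dD) addr0.
  move: uU; rewrite -[[:: e1, e2, e3 & R]]in_tupleE => /coord_span ->.
  rewrite (flin_sum _ _ _ (central_slice_lin gs)) big1 // => i _.
  by rewrite gE (H f cf gt) ?mulr0 //; apply: mem_nth.
(* The cocycle identity at [y, y', w1], in which the brackets with [w1] are multiples of [z]. *)
have D1 f y y' : lie_cocycle f -> l1 y * f (y', z) - l1 y' * f (y, z) = - f (⁅y, y'⁆, w1).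
  move=> cf; have := cocycle_jacobi cf y y' w1.
  rewrite (zetaE (w1z y')) [⁅w1, y⁆]lie_brC (zetaE (w1z y)) -scaleNr !(cocycleZl cf) !(cocycleC cf z) => e0.
  by apply/eqP; rewrite -addr_eq0 -[X in _ == X]e0 -/(l1 y) -/(l1 y'); apply/eqP; ring.
have D2 f y y' : lie_cocycle f -> l2 y * f (y', z) - l2 y' * f (y, z) = - f (⁅y, y'⁆, w2).
  move=> cf; have := cocycle_jacobi cf y y' w2.
  rewrite (zetaE (w2z y')) [⁅w2, y⁆]lie_brC (zetaE (w2z y)) -scaleNr !(cocycleZl cf) !(cocycleC cf z) => e0.
  by apply/eqP; rewrite -addr_eq0 -[X in _ == X]e0 -/(l2 y) -/(l2 y'); apply/eqP; ring.
have fz f w : lie_cocycle f -> w \in derived A -> forall x, x \in <[z]>%VS -> f (x, w) = 0.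
  move=> cf wA _ /vlineP[a ->]; rewrite (cocycleZl cf) (cocycleC cf).
  have sl : central_slice z (fun x => f (x, z)) by exists f.
  by rewrite (central_slice_derived zc sl wA) oppr0 mulr0.
have D1z f y y' : lie_cocycle f -> ⁅y, y'⁆ \in <[z]>%VS -> l1 y * f (y', z) = l1 y' * f (y, z).
  by move=> cf yz; apply/eqP; rewrite -subr_eq0 D1 // (fz f w1 cf w1A _ yz) oppr0.
have D2z f y y' : lie_cocycle f -> ⁅y, y'⁆ \in <[z]>%VS -> l2 y * f (y', z) = l2 y' * f (y, z).
  by move=> cf yz; apply/eqP; rewrite -subr_eq0 D2 // (fz f w2 cf w2A _ yz) oppr0.
have D1_12 f : lie_cocycle f -> l1 e1 * f (e2, z) = l1 e2 * f (e1, z).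
  by move=> cf; apply/eqP; rewrite -subr_eq0 D1 // (cocycle_alt cf) oppr0.
have D2_13 f : lie_cocycle f -> l2 e1 * f (e3, z) = l2 e3 * f (e1, z).
  by move=> cf; apply/eqP; rewrite -subr_eq0 D2 // (cocycle_alt cf) oppr0.
have Rz' r x : r \in R -> ⁅r, x⁆ \in <[z]>%VS by move=> rR; rewrite lie_brC memvN Rz.
have lz x w : x \in <[z]>%VS -> ⁅x, w⁆ = 0 by case/vlineP=> a ->; rewrite lie_brZl zc scaler0.
have lzr x w : x \in <[z]>%VS -> ⁅w, x⁆ = 0 by move=> xz; rewrite lie_brC lz ?oppr0.
have l12 : l1 e3 = l2 e2.
  have := lie_jacobi e1 e2 e3; rewrite (lzr _ _ e23) add0r [⁅e3, e1⁆]lie_brC lie_brNr -/w1 -/w2.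
  by move/(congr1 zeta); rewrite linear0 linearD linearN /= addrC => /eqP; rewrite subr_eq0 => /eqP.
have cancel0 a b : a != 0 -> a * b = 0 -> b = 0 :> k.
  by move=> a0 /eqP; rewrite mulf_eq0 (negPf a0) => /eqP.
have P1 : l1 e2 = 0.
  apply: NNPP => /eqP ne; apply: (noP e2) => f cf f2.
  have f1 : f (e1, z) = 0 by apply: (cancel0 _ _ ne); rewrite -D1_12 // f2 mulr0.
  have f3 : f (e3, z) = 0 by apply: (cancel0 _ _ ne); rewrite D1z // f2 mulr0.
  move=> x; rewrite !inE => /or4P[/eqP ->|/eqP ->|/eqP ->|xR] //.
  by apply: (cancel0 _ _ ne); rewrite D1z ?f2 ?mulr0 // Rz.
have P2 : l2 e3 = 0.
  apply: NNPP => /eqP ne; apply: (noP e3) => f cf f3.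
  have f1 : f (e1, z) = 0 by apply: (cancel0 _ _ ne); rewrite -D2_13 // f3 mulr0.
  have f2 : f (e2, z) = 0 by apply: (cancel0 _ _ ne); rewrite -D2z // f3 mulr0.
  move=> x; rewrite !inE => /or4P[/eqP ->|/eqP ->|/eqP ->|xR] //.
  by apply: (cancel0 _ _ ne); rewrite D2z ?f3 ?mulr0 // Rz.
have P3 : l1 e3 = 0.
  apply: NNPP => /eqP ne; apply: (noP e1) => f cf f1.
  have f2 : f (e2, z) = 0 by apply: (cancel0 _ _ ne); rewrite -D1z // P1 mul0r.
  have f3 : f (e3, z) = 0 by apply: (cancel0 _ _ ne); rewrite l12 D2z // P2 mul0r.
  move=> x; rewrite !inE => /or4P[/eqP ->|/eqP ->|/eqP ->|xR] //.
  by apply: (cancel0 _ _ ne); rewrite D1z ?f3 ?mulr0 // Rz.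
have P4 : l2 e2 = 0 by rewrite -l12.
have P5 r : r \in R -> l1 r = 0.
  move=> rR; apply: NNPP => /eqP ne; apply: (noP r) => f cf fr.
  have fy y : f (y, z) = 0 by apply: (cancel0 _ _ ne); rewrite D1z ?fr ?mulr0 // Rz'.
  by move=> x _.
have P6 r : r \in R -> l2 r = 0.
  move=> rR; apply: NNPP => /eqP ne; apply: (noP r) => f cf fr.
  have fy y : f (y, z) = 0 by apply: (cancel0 _ _ ne); rewrite D2z ?fr ?mulr0 // Rz'.
  by move=> x _.
have D2_12 f : lie_cocycle f -> l2 e1 * f (e2, z) = - f (w1, w2).
  by move=> cf; rewrite -D2 // P4 mul0r subr0.
have D1_13 f : lie_cocycle f -> l1 e1 * f (e3, z) = f (w1, w2).
  by move=> cf; rewrite (cocycleC cf w1) -[RHS]D1 // P3 mul0r subr0.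
have P7 : l1 e1 = 0.
  apply: NNPP => /eqP ne; apply: (noP e1) => f cf f1.
  have f2 : f (e2, z) = 0 by apply: (cancel0 _ _ ne); rewrite D1_12 // P1 mul0r.
  have P0 : f (w1, w2) = 0 by rewrite -[LHS]opprK -D2_12 // f2 mulr0 oppr0.
  have f3 : f (e3, z) = 0 by apply: (cancel0 _ _ ne); rewrite D1_13.
  move=> x; rewrite !inE => /or4P[/eqP ->|/eqP ->|/eqP ->|xR] //.
  by apply: (cancel0 _ _ ne); rewrite D1z ?f1 ?mulr0 // Rz.
have P8 : l2 e1 = 0.
  apply: NNPP => /eqP ne; apply: (noP e1) => f cf f1.
  have f3 : f (e3, z) = 0 by apply: (cancel0 _ _ ne); rewrite D2_13 // P2 mul0r.
  have P0 : f (w1, w2) = 0 by rewrite -D1_13 // f3 mulr0.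
  have f2 : f (e2, z) = 0 by apply: (cancel0 _ _ ne); rewrite D2_12 // P0 oppr0.
  move=> x; rewrite !inE => /or4P[/eqP ->|/eqP ->|/eqP ->|xR] //.
  by apply: (cancel0 _ _ ne); rewrite D2z ?f1 ?mulr0 // Rz.
have ww : ⁅w1, w2⁆ = 0.
  have := lie_jacobi w1 e1 e3; rewrite -/w2 (lzr ⁅e3, w1⁆) ?w1z // (lzr ⁅w1, e1⁆) ?addr0 //.
  by rewrite lie_brC memvN.
have w1c x : ⁅x, w1⁆ = 0.
  have : x \in (<<[:: e1, e2, e3 & R]>> + derived A)%VS by rewrite AE memvf.
  case/memv_addP=> u uU [d dD ->]; rewrite lie_brDl.
  have -> : ⁅u, w1⁆ = 0.
    apply/eqP; rewrite -memv0; apply: (br_span _ uU (memv_span1 w1)) => a b.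
    rewrite mem_seq1 => + /eqP ->; rewrite !inE => /or4P[/eqP ->|/eqP ->|/eqP ->|aR];
      rewrite (zetaE (w1z _)) -/(l1 _) ?P7 ?P1 ?P3 ?P5 // scale0r mem0v //.
  rewrite add0r; apply/eqP; rewrite -memv0; rewrite DE in dD.
  apply: (br_span _ dD (memv_span1 w1)) => a b; rewrite mem_seq1 => + /eqP ->.
  rewrite !inE => /or3P[] /eqP ->; rewrite ?lie_brxx ?zc ?mem0v //.
  by rewrite lie_brC ww oppr0 mem0v.
have w2c x : ⁅x, w2⁆ = 0.
  have : x \in (<<[:: e1, e2, e3 & R]>> + derived A)%VS by rewrite AE memvf.
  case/memv_addP=> u uU [d dD ->]; rewrite lie_brDl.
  have -> : ⁅u, w2⁆ = 0.
    apply/eqP; rewrite -memv0; apply: (br_span _ uU (memv_span1 w2)) => a b.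
    rewrite mem_seq1 => + /eqP ->; rewrite !inE => /or4P[/eqP ->|/eqP ->|/eqP ->|aR];
      rewrite (zetaE (w2z _)) -/(l2 _) ?P8 ?P4 ?P2 ?P6 // scale0r mem0v //.
  rewrite add0r; apply/eqP; rewrite -memv0; rewrite DE in dD.
  apply: (br_span _ dD (memv_span1 w2)) => a b; rewrite mem_seq1 => + /eqP ->.
  by rewrite !inE => /or3P[] /eqP ->; rewrite ?lie_brxx ?zc ?ww ?mem0v.
move=> d dD y; rewrite lie_brC; apply/eqP; rewrite oppr_eq0 -memv0; rewrite DE in dD.
apply: (br_span _ (memv_span1 y) dD) => a b; rewrite mem_seq1 => /eqP ->.
by rewrite !inE => /or3P[] /eqP ->; rewrite ?w1c ?w2c ?(lie_centralr zc) mem0v.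
Qed.

(** In class two, three generators with [A^2] of dimension three satisfy no further relation, so [A]
    is the free algebra with [s = 3]. *)
Lemma extension_L58_rank_three e : R = [::] -> fdim (central_slice z) e -> (2 <= e)%N ->
  \dim (derived A) = 3%N -> \dim {:A} = 6%N -> lie_s A 3.
Proof.
move=> R0 Ge e2' d3 n6; have dc := extension_L58_class_two Ge e2'.
have AE' := AE; rewrite R0 in AE'; pose X := [:: e1; e2; e3; w1; w2; ⁅e2, e3⁆].
have DX : (derived A <= <<X>>)%VS.
  have m1 : w1 \in <<X>>%VS by rewrite memv_span // !inE eqxx ?orbT.
  have m2 : w2 \in <<X>>%VS by rewrite memv_span // !inE eqxx ?orbT.
  have m3 : ⁅e2, e3⁆ \in <<X>>%VS by rewrite memv_span // !inE eqxx ?orbT.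
  apply: (derived_gen AE' dc) => u v; rewrite !inE => /or3P[] /eqP -> /or3P[] /eqP ->;
   by rewrite ?lie_brxx ?mem0v // lie_brC memvN.
have Xs : <<X>>%VS = fullv.
  by apply: (gen_span AE' _ DX) => u; rewrite !inE => /or3P[] ->; rewrite ?orbT.
have cD (u v x : A) : ⁅x, ⁅u, v⁆⁆ = 0 by rewrite (lie_centralr (dc _ (mem_derived u v))).
have [] // := @free_class2_rank3_s k A X; split=> //.
by case=> [|[|[|[|[|[|i]]]]]] [|[|[|[|[|[|j]]]]]] //=; rewrite ?andbF // => _;
  rewrite /X /= ?scale_unit ?/w1 ?/w2 ?cD.
Qed.

(** A slice of dimension 4 takes arbitrary values at [e1, e2, e3, r]. The cocycle identity at
    [e2, e3, r] is a linear relation between them, so its coefficients vanish and [e2, e3, r]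
    commute. The element [e1] becomes the second basis vector of [37A]. *)
Lemma extension_L58_37A r : R = [:: r] -> fdim (central_slice z) 4 ->
  \dim (derived A) = 3%N -> \dim {:A} = 7%N -> lie_iso A (L37A k).
Proof.
move=> R1 Ge d3 n7; have dc := extension_L58_class_two Ge isT.
have rR : r \in R by rewrite R1 mem_head.
have AE' := AE; rewrite R1 in AE'.
have z0 : z != 0 by apply: contra_eq_neq zetaz => ->; rewrite linear0 eq_sym oner_eq0.
have rel f : lie_cocycle f ->
   zeta ⁅e2, e3⁆ * f (r, z) + zeta ⁅e3, r⁆ * f (e2, z) + zeta ⁅r, e2⁆ * f (e3, z) = 0.
  move=> cf; have := cocycle_jacobi cf e2 e3 r.
  have re2 : ⁅r, e2⁆ \in <[z]>%VS by rewrite lie_brC memvN Rz.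
  rewrite (zetaE e23) (zetaE (Rz e3 rR)) (zetaE re2) !(cocycleZl cf) !(cocycleC cf z) => e0.
  by apply/eqP; rewrite -oppr_eq0 -[X in _ == X]e0 !linearZ /= zetaz; apply/eqP; ring.
have slice0 f : lie_cocycle f -> f (e1, z) = 0 -> f (e2, z) = 0 -> f (e3, z) = 0 -> f (r, z) = 0 ->
    forall x, f (x, z) = 0.
  move=> cf f1 f2 f3 fr x; have sl : central_slice z (fun x => f (x, z)) by exists f.
  have : x \in (<<[:: e1; e2; e3; r]>> + derived A)%VS by rewrite AE' memvf.
  case/memv_addP=> u uU [d dD ->].
  rewrite (cocycleDl cf) (central_slice_derived zc sl dD) addr0.
  move: uU; rewrite !span_cons span_nil addv0.
  case/memv_addP=> _ /vlineP[a1 ->] [_ /memv_addP[_ /vlineP[a2 ->] [_ /memv_addP[_ /vlineP[a3 ->]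
    [_ /vlineP[a4 ->] ->]] ->]] ->].
  by rewrite !(cocycleDl cf) !(cocycleZl cf) f1 f2 f3 fr !mulr0 !addr0.
have zero (a b : A) (t1 t2 t3 : A) : ⁅a, b⁆ \in <[z]>%VS ->
    (forall f, lie_cocycle f -> f (t1, z) = 0 -> f (t2, z) = 0 -> f (t3, z) = 0 ->
       zeta ⁅a, b⁆ != 0 -> forall x, f (x, z) = 0) -> ⁅a, b⁆ = 0.
  move=> abz H; rewrite (zetaE abz); have [->|ne] := eqVneq (zeta ⁅a, b⁆) 0; first by rewrite scale0r.
  suff : (4 <= 3)%N by [].
  apply: (fdim_le_points (t := fun i : 'I_3 =>
    if i == 0 :> nat then t1 else if i == 1%N :> nat then t2 else t3)
    (central_slice_closed z) Ge) => g [f cf gE] g0 x; rewrite gE.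
  apply: H => //; rewrite -gE.
  - exact: (g0 (@Ordinal 3 0 isT)).
  - exact: (g0 (@Ordinal 3 1 isT)).
  - exact: (g0 (@Ordinal 3 2 isT)).
have cancel0 a b : a != 0 -> a * b = 0 -> b = 0 :> k.
  by move=> a0 /eqP; rewrite mulf_eq0 (negPf a0) => /eqP.
have E23 : ⁅e2, e3⁆ = 0.
  apply: (zero _ _ e1 e2 e3 e23) => f cf f1 f2 f3 ne; apply: slice0 => //.
  by apply: (cancel0 _ _ ne); have := rel f cf; rewrite f2 f3 !mulr0 !addr0.
have E3r : ⁅e3, r⁆ = 0.
  apply: (zero _ _ e1 e3 r (Rz e3 rR)) => f cf f1 f3 fr ne; apply: slice0 => //.
  by apply: (cancel0 _ _ ne); have := rel f cf; rewrite f3 fr !mulr0 !addr0 add0r.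
have Er2 : ⁅r, e2⁆ = 0.
  have re2 : ⁅r, e2⁆ \in <[z]>%VS by rewrite lie_brC memvN Rz.
  apply: (zero _ _ e1 e2 r re2) => f cf f1 f2 fr ne; apply: slice0 => //.
  by apply: (cancel0 _ _ ne); have := rel f cf; rewrite f2 fr !mulr0 !add0r.
pose X := [:: e2; e1; e3; r; - w1; w2; ⁅e1, r⁆].
have DX : (derived A <= <<X>>)%VS.
  have m1 : w1 \in <<X>>%VS by rewrite -memvN memv_span // !inE eqxx ?orbT.
  have m2 : w2 \in <<X>>%VS by rewrite memv_span // !inE eqxx ?orbT.
  have m3 : ⁅e1, r⁆ \in <<X>>%VS by rewrite memv_span // !inE eqxx ?orbT.
  apply: (derived_gen AE' dc) => u v; rewrite !inE => /or4P[] /eqP -> /or4P[] /eqP ->;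
   by rewrite ?lie_brxx ?E23 ?E3r ?Er2 ?mem0v // lie_brC memvN ?E23 ?E3r ?Er2 ?mem0v.
have Xs : <<X>>%VS = fullv.
  by apply: (gen_span AE' _ DX) => u; rewrite !inE => /or4P[] ->; rewrite ?orbT.
have cD (u v x : A) : ⁅x, ⁅u, v⁆⁆ = 0 by rewrite (lie_centralr (dc _ (mem_derived u v))).
have E2r : ⁅e2, r⁆ = 0 by rewrite lie_brC Er2 oppr0.
have E21 : ⁅e2, e1⁆ = - w1 by rewrite lie_brC.
apply: (@nat_table_iso _ 6 (LieTable (@L37A_jacobi k)) _ _ X erefl) => //.
by case=> [|[|[|[|[|[|[|i]]]]]]] [|[|[|[|[|[|[|j]]]]]]] //=; rewrite ?andbF // => _;
  rewrite /X /= ?scale_unit ?lie_brNr ?/w1 ?/w2 ?cD ?oppr0 ?E23 ?E3r ?E2r ?E21.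
Qed.
End ExtensionL58.

Lemma lie_s_stem_split (k : fieldType) (A : finLieType k) s :
  lie_nilpotent A -> derived A != 0%VS -> lie_s A s ->
  exists (B : finLieType k) (i t : nat), [/\ lie_iso A (B ⊕ Ab k i), lie_nilpotent B, lie_stem B &
    [/\ \dim (derived B) = \dim (derived A), lie_s B t, s = (t + (\dim (derived A) - 1) * i)%N &
      \dim {:A} = (\dim {:B} + i)%N]].
Proof.
move=> nA A0 sA; have [B [i [AB Bs]]] := lie_stem_split A.
have dB : \dim (derived B) = \dim (derived A).
  by rewrite (dim_derived_iso AB) dim_derived_dsum dim_derived_Ab addn0.
have B0 : derived B != 0%VS by rewrite -dimv_eq0 dB dimv_eq0.
have nB : lie_nilpotent B.
  have [f fm [f' _ f'K]] := AB.
  have nAB : lie_nilpotent (B ⊕ Ab k i).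
    by apply: (nilpotent_surj fm) nA => y; exists (f' y).
  have [ia [ib [pa [pb [[_ _ pam _] [_ _ paE _]]]]]] := dsum_maps B (Ab k i).
  apply: (nilpotent_surj pam) nAB => y; exists (y, 0); by rewrite paE.
have [t tB _] := lie_s_ex nB B0.
exists B, i, t; split=> //; split=> //.
  by rewrite -dB; apply: (lie_s_unique sA); apply: (lie_s_iso (lie_iso_sym AB)); apply: lie_s_dsum_Ab.
by rewrite (dim_iso AB) dim_dsum dim_Ab.
Qed.

Lemma lie_iso_refl (k : fieldType) (A : finLieType k) : lie_iso A A.
Proof. by exists idfun => //; exists id. Qed.

Lemma lie_iso_dsum_Ab (k : fieldType) (Q A B : finLieType k) i :
  lie_iso A B -> lie_iso Q (A ⊕ Ab k i) -> lie_iso Q (B ⊕ Ab k i).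
Proof.
move=> AB QA; apply: (lie_iso_trans QA).
have pi : pair_iso (summand1 A (Ab k i)) (summand1 A (Ab k i)).
  by exists idfun; split=> //; exists id.
by have [h [hm hb _]] := pair_iso_dsum AB (lie_iso_refl _) pi; exists h.
Qed.

Section CentralExtension.
Variables (k : fieldType) (A Q : finLieType k) (z : A) (p : {linear A -> Q}).
Hypothesis zp : central_quotient z p.

Lemma central_quotient_sub (U V : {vspace A}) : z \in U ->
  (forall x, x \in V -> p x \in (linfun p @: U)%VS) -> (V <= U)%VS.
Proof.
case: zp => _ _ pk zU H; apply/subvP => x /H /memv_imgP[y yU]; rewrite lfunE /= => /eqP.
rewrite -subr_eq0 -linearB => /eqP/pk/vlineP[a /eqP]; rewrite subr_eq => /eqP ->.
by rewrite memvD // memvZ.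
Qed.

(** The elements are arbitrary lifts from [Q]: an identity in [Q] becomes an identity modulo [z],
    and [zeta] reads the coefficient of [z]. *)
Lemma central_extension_L58 (j : nat) : z != 0 -> lie_central z -> z \in derived A ->
  lie_iso Q (L5_8 k ⊕ Ab k j) ->
  exists (e1 e2 e3 : A) (R : seq A) (zeta : {scalar A}),
  [/\ size R = j, zeta z = 1, forall x, ⁅x, ⁅e1, e2⁆⁆ \in <[z]>%VS,
     forall x, ⁅x, ⁅e1, e3⁆⁆ \in <[z]>%VS & ⁅e2, e3⁆ \in <[z]>%VS] /\
  [/\ forall x r, r \in R -> ⁅x, r⁆ \in <[z]>%VS,
     derived A = <<[:: ⁅e1, e2⁆; ⁅e1, e3⁆; z]>>%VS &
     (<<[:: e1, e2, e3 & R]>> + derived A)%VS = fullv].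
Proof.
move=> z0 zc zA QL; have [pm ps pk] := zp.
have [q1 [q2 [q3 [R [Rj q23 Rc Q2 Qs]]]]] := L5_8_elements QL.
pose s y := proj1_sig (constructive_indefinite_description _ (ps y)).
have sK y : p (s y) = y by exact: proj2_sig (constructive_indefinite_description _ (ps y)).
have [g _ gz] : exists2 g : {scalar A}, forall u, u \in 0%VS -> g u = 0 & g z != 0.
  by apply: functional_separates; rewrite memv0.
exists (s q1), (s q2), (s q3), (map s R).
have [|h hE] := @linear_ex _ A k^o (fun x => (g z)^-1 * g x).
  by move=> a x y; rewrite linearP mulrDr mulrCA.
exists h; split; split.
- by rewrite size_map.
- by rewrite hE mulVf.
- by move=> x; apply/pk; rewrite !pm Q2.
- by move=> x; apply/pk; rewrite !pm Q2.
- by apply/pk; rewrite pm !sK.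
- by move=> x _ /mapP[r rR ->]; apply/pk; rewrite pm sK Rc.
- apply/eqP; rewrite eqEsubv; apply/andP; split; last first.
    by apply/span_subvP => x; rewrite !inE => /or3P[] /eqP -> //; exact: mem_derived.
  apply: central_quotient_sub; first by rewrite memv_span // !inE eqxx !orbT.
  move=> x /(derived_morph pm); apply: (subvP _).
  have Qc x0 : x0 \in derived Q -> lie_central x0.
    move=> x0Q y; rewrite lie_brC; apply/eqP; rewrite oppr_eq0.
    have [|ad adE] := @linear_ex _ Q Q (fun t => ⁅y, t⁆); first by move=> a u v; rewrite lie_brDZr.
    have : x0 \in lker (linfun ad).
      by apply: (subvP (derived_sub _)) x0Q => u v; rewrite memv_ker lfunE /= adE Q2.
    by rewrite memv_ker lfunE /= adE.
  rewrite limg_span /= !lfunE /= !pm !sK (_ : p z = 0); last by apply/pk; exact: memv_line.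
  set D := (X in (_ <= X)%VS).
  have m1 : ⁅q1, q2⁆ \in D by rewrite memv_span // mem_head.
  have m2 : ⁅q1, q3⁆ \in D by rewrite memv_span // !inE eqxx orbT.
  have Rc' r x0 : r \in R -> ⁅r, x0⁆ = 0 by move=> rR; rewrite lie_brC Rc ?oppr0.
  apply: (derived_gen Qs Qc) => u v.
  rewrite !inE => /or4P[/eqP ->|/eqP ->|/eqP ->|uR] /or4P[/eqP ->|/eqP ->|/eqP ->|vR];
    by rewrite ?(Rc _ _ vR) ?(Rc' _ _ uR) ?lie_brxx ?q23 ?mem0v // lie_brC memvN ?q23 ?mem0v.
- apply/eqP; rewrite eqEsubv subvf /=; apply: central_quotient_sub.
    by rewrite (subvP (addvSr _ _)).
  move=> x _; rewrite limgD derived_surj // limg_span /= !lfunE /= !sK -map_comp.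
  rewrite (_ : map _ R = R) ?Qs ?memvf //.
  by rewrite -[RHS]map_id; apply: eq_map => r /=; rewrite lfunE /= sK.
Qed.

(** For lifts [e1, e2] only two structure constants are open, [[e2, c] = l z] and [[e1, u] = a z];
    the Jacobi identity kills the others. They are not both 0 because [A^2] has dimension 3, and
    their zeros select the algebra. *)
Lemma central_extension_L43 : z != 0 -> lie_central z -> \dim (derived A) = 3%N ->
  \dim {:A} = 5%N -> lie_iso Q (L4_3 k ⊕ Ab k 0) ->
  [\/ lie_iso A (L5_6 k), lie_iso A (L5_7 k) | lie_iso A (L5_9 k)].
Proof.
move=> z0 zc d3 n5 QL; have [pm ps pk] := zp.
have [q1 [q2 [q2c qu Qs]]] := L4_3_elements QL.
have [e1 p1] := ps q1; have [e2 p2] := ps q2.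
have [c cE] : exists c, c = ⁅e1, e2⁆ by exists ⁅e1, e2⁆.
have [u uE] : exists u, u = ⁅e1, c⁆ by exists ⁅e1, c⁆.
have pc : p c = ⁅q1, q2⁆ by rewrite cE pm p1 p2.
have pu : p u = ⁅q1, ⁅q1, q2⁆⁆ by rewrite uE pm pc p1.
have As : <<[:: e1; e2; c; u; z]>>%VS = fullv.
  apply/eqP; rewrite eqEsubv subvf /=; apply: central_quotient_sub.
    by rewrite memv_span // !inE eqxx !orbT.
  move=> x _; rewrite limg_span /= !lfunE /= p1 p2 pc pu.
  have : p x \in fullv by exact: memvf.
  by rewrite -Qs; apply/subvP/sub_span => y; rewrite !inE => /or4P[] ->; rewrite ?orbT.
have [l e2c] : exists l, ⁅e2, c⁆ = l *: z.
  by apply/vlineP/pk; rewrite pm p2 pc q2c.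
have [a e1u] : exists a, ⁅e1, u⁆ = a *: z by apply/vlineP/pk; rewrite pm pu.
have zr x : ⁅x, z⁆ = 0 by exact: lie_centralr.
have e2u : ⁅e2, u⁆ = 0.
  have := lie_jacobi e1 e2 c; rewrite e2c lie_brZr zr scaler0 add0r -cE lie_brxx addr0.
  by rewrite [⁅c, e1⁆]lie_brC -uE lie_brNr => /eqP; rewrite oppr_eq0 => /eqP.
have cu : ⁅c, u⁆ = 0.
  have := lie_jacobi e1 e2 u; rewrite e2u lie_br0r add0r -cE [⁅u, e1⁆]lie_brC e1u lie_brNr lie_brZr.
  by rewrite zr scaler0 oppr0 add0r lie_brC => /eqP; rewrite oppr_eq0 => /eqP.
have spanX t b : t != 0 -> b != 0 ->
    <<[:: e1; t *: e2; t *: c; t *: u; b *: z]>>%VS = fullv.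
  move=> t0 b0; have line (v : A) d : d != 0 -> <[d *: v]>%VS = <[v]>%VS.
    move=> d0; apply/eqP; rewrite eqEsubv -!memvE memvZ ?memv_line //=.
    by rewrite -[X in X \in _](scalerK d0) memvZ // memv_line.
  by rewrite -As !span_cons span_nil !line.
have [l0|l0] := eqVneq l 0; have [a0|a0] := eqVneq a 0.
- suff /dimvS : (derived A <= <<[:: c; u]>>)%VS.
    by rewrite d3 => /leq_trans/(_ (dim_span _)).
  apply: derived_sub => x y; have := memvf x; have := memvf y; rewrite -As => yA xA.
  apply: (br_span _ xA yA) => v w.
  have mc : c \in <<[:: c; u]>>%VS by rewrite memv_span // mem_head.
  have mu : u \in <<[:: c; u]>>%VS by rewrite memv_span // !inE eqxx orbT.
  rewrite l0 scale0r in e2c; rewrite a0 scale0r in e1u.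
  rewrite !inE => /or4P[/eqP ->|/eqP ->|/eqP ->|/orP[] /eqP ->] /or4P[/eqP ->|/eqP ->|/eqP
    ->|/orP[] /eqP ->];
    rewrite ?zr ?zc -?cE -?uE ?e2c ?e1u ?e2u ?cu ?lie_brxx ?mem0v //;
    by rewrite lie_brC memvN -?cE -?uE ?e2c ?e1u ?e2u ?cu ?mem0v.
- constructor 2; apply: (@nat_table_iso _ 4 (LieTable (@L5_7_jacobi k)) _ _ [:: e1; 1 *: e2;
  1 *: c; 1 *: u; a *: z] erefl) => //.
    by apply: spanX => //; exact: oner_neq0.
  by case=> [|[|[|[|[|i]]]]] [|[|[|[|[|j]]]]] //=; rewrite ?andbF // => _;
    rewrite ?scale1r ?addr0 -?cE -?uE ?e2c ?e1u ?e2u ?cu ?lie_brZr ?zr ?l0 ?scale0r ?scaler0.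
- constructor 3; apply: (@nat_table_iso _ 4 (LieTable (@L5_9_jacobi k)) _ _ [:: e1; 1 *: e2;
  1 *: c; 1 *: u; l *: z] erefl) => //.
    by apply: spanX => //; exact: oner_neq0.
  by case=> [|[|[|[|[|i]]]]] [|[|[|[|[|j]]]]] //=; rewrite ?andbF // => _;
    rewrite ?scale1r ?addr0 -?cE -?uE ?e2c ?e1u ?e2u ?cu ?lie_brZr ?zr ?a0 ?scale0r ?scaler0.
(* Scaling [e2] by [t] multiplies [l] by [t^2] and [a] by [t], so [t = a / l] makes the two
   constants equal. *)
- constructor 1; pose t := a / l; have t0 : t != 0 by rewrite mulf_neq0 ?invr_eq0.
  have ta0 : t * a != 0 by rewrite mulf_neq0.
  apply: (@nat_table_iso _ 4 (LieTable (@L5_6_jacobi k)) _ _ [:: e1; t *: e2; t *: c; t *: u;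
    (t * a) *: z] erefl) => //.
    exact: spanX.
  have tt : t * t * l = t * a by rewrite -mulrA [t * l]divfK.
  by case=> [|[|[|[|[|i]]]]] [|[|[|[|[|j]]]]] //=; rewrite ?andbF // => _;
    rewrite ?scale1r ?addr0 ?(lie_brZl, lie_brZr) -?cE -?uE ?e2c ?e1u ?e2u ?cu ?zr ?scaler0 ?scalerA ?tt.
Qed.

End CentralExtension.

(** From [s(A) = 4] and [e <= n - 3], the quotient has [s <= 2]; so it is [L_{5,8} + A(j)] with
    [j <= 1], or [L_{4,3}]. For [j = 0] the slice has dimension 2, and [A] would be the free algebra
    with [s = 3]; for [j = 1] it has dimension 4. *)
Lemma derived_three (k : closedFieldType) (A : finLieType k) :
  2%N \notin [pchar k] -> lie_nilpotent A -> \dim (derived A) = 3%N -> lie_s A 4 ->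
  [\/ lie_iso A (L5_6 k), lie_iso A (L5_7 k), lie_iso A (L5_9 k) | lie_iso A (L37A k)].
Proof.
move=> ch nA d3 sA; have A0 : derived A != 0%VS by rewrite -dimv_eq0 d3.
have [z [z0 zc zA _]] := nilpotent_central nA A0.
have [Q [p pq]] := central_quotient_ex zc; have [pm ps pk] := pq.
have nQ := nilpotent_surj pm ps nA.
have := dim_derived_central_quotient pq z0; rewrite zA d3 addn1 => -[dQ].
have Q0 : derived Q != 0%VS by rewrite -dimv_eq0 dQ.
have [t tQ _] := lie_s_ex nQ Q0; have [e Ge] := central_slice_dim_ex z.
have := lie_s_central z0 zc zA pq Ge sA tQ; have := central_slice_dim_le zc Ge; rewrite d3 => en teq.
have nQA := dim_central_quotient pq z0.
have [B [j [t' [QB nB sB [dB tB tj QBj]]]]] := lie_s_stem_split nQ Q0 tQ.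
rewrite dQ in dB tj.
have L58 : lie_iso B (L5_8 k) -> lie_iso A (L37A k).
  move=> BL; have QL : lie_iso Q (L5_8 k ⊕ Ab k j) by exact: lie_iso_dsum_Ab QB.
  have t1 : t' = 1%N by apply: (lie_s_unique tB); apply: (lie_s_iso (lie_iso_sym BL)); case: (L5_8_s k).
  have B5 : \dim {:B} = 5%N by rewrite (dim_iso BL) dim_table.
  have [e1 [e2 [e3 [R [zeta [[Rj zz w1 w2 e23] [Rz DE AE]]]]]]] := central_extension_L58 pq z0 zc zA QL.
  have [j0|[j1|]] : j = 0%N \/ j = 1%N \/ (2 <= j)%N by lia.
  - have R0 : R = [::] by apply/eqP; rewrite -size_eq0 Rj j0.
    have s3 : lie_s A 3.
      apply: (extension_L58_rank_three zc zz w1 w2 e23 Rz DE AE R0 Ge) => //; lia.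
    by have := lie_s_unique s3 sA.
  - have [r Rr] : exists r, R = [:: r].
      by case: (R) Rj => [|r [|? ?]]; rewrite j1 // => _; exists r.
    have e4 : e = 4%N by lia.
    rewrite e4 in Ge; apply: (extension_L58_37A zc zz w1 w2 e23 Rz DE AE Rr Ge) => //; lia.
  - lia.
have t5 : (t' <= 5)%N by lia.
case: (derived_two_stem ch nB sB dB tB t5) => [BL|BL|BL|[BL|[eps BL]]].
- by constructor 4; apply: L58.
- have t2 : t' = 2%N by apply: (lie_s_unique tB); apply: (lie_s_iso (lie_iso_sym BL)); case: (L4_3_s k).
  have B4 : \dim {:B} = 4%N by rewrite (dim_iso BL) dim_table.
  have QL : lie_iso Q (L4_3 k ⊕ Ab k 0).
    by have <- : j = 0%N; [lia | exact: lie_iso_dsum_Ab QB].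
  have A5 : \dim {:A} = 5%N by lia.
  by case: (central_extension_L43 pq z0 zc d3 A5 QL) => H; [constructor 1|constructor 2|constructor 3].
- have : t' = 3%N by apply: (lie_s_unique tB); apply: (lie_s_iso (lie_iso_sym BL)); case: (L5_5_s k).
  lia.
- have : t' = 5%N by apply: (lie_s_unique tB); apply: (lie_s_iso (lie_iso_sym BL)); case: (L6_10_s k).
  lia.
- have : t' = 3%N by apply: (lie_s_unique tB); apply: (lie_s_iso (lie_iso_sym BL)); case: (L6_22_s eps).
  lia.
Qed.

(** * The value of [s] for Heisenberg algebras *)

Section Heisenberg.
Variables (k : fieldType) (r : nat).
Let z : Heis k r := delta_mx 0 ord0.
Let d (l : 'I_(2 * r).+1) : Heis k r := delta_mx 0 l.

Let br_heis (u v : Heis k r) : ⁅u, v⁆ =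
  (\sum_(i <- iota 1 r) ((u : 'rV_(2 * r).+1) 0 (inord (2 * i).-1) * (v : 'rV_(2 * r).+1) 0 (inord (2 * i))
   - (u : 'rV_(2 * r).+1) 0 (inord (2 * i)) * (v : 'rV_(2 * r).+1) 0 (inord (2 * i).-1))) *: z.
Proof.
rewrite /lie_br /= /table_br /= big_map scaler_suml.
by apply: eq_bigr => i _; rewrite mul1r.
Qed.

Let zn0 : z != 0.
Proof.
apply/eqP => /matrixP/(_ 0 ord0); rewrite !mxE !eqxx /= => /eqP.
by rewrite oner_eq0.
Qed.

Let br_pairl i v : (0 < i <= r)%N ->
  ⁅d (inord (2 * i).-1), v⁆ = (v : 'rV_(2 * r).+1) 0 (inord (2 * i)) *: z.
Proof.
move=> ir; rewrite br_heis (bigD1_seq i) ?iota_uniq ?mem_iota //=.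
rewrite !mxE !eqxx mul1r -!val_eqE /= !inordK //; try lia.
have E0 : (2 * i == (2 * i).-1)%N = false by lia.
rewrite E0 mul0r subr0.
rewrite big1_seq ?addr0 // => j /andP[ji]; rewrite mem_iota => jr.
rewrite !mxE !eqxx -!val_eqE /= !inordK; try lia.
have E1 : ((2 * j).-1 == (2 * i).-1)%N = false by lia.
have E2 : (2 * j == (2 * i).-1)%N = false by lia.
by rewrite E1 E2 !mul0r subr0.
Qed.

Let br_pairr i v : (0 < i <= r)%N ->
  ⁅d (inord (2 * i)), v⁆ = - (v : 'rV_(2 * r).+1) 0 (inord (2 * i).-1) *: z.
Proof.
move=> ir; rewrite br_heis (bigD1_seq i) ?iota_uniq ?mem_iota //=.
rewrite !mxE !eqxx mul1r -!val_eqE /= !inordK //; try lia.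
have E0 : ((2 * i).-1 == 2 * i)%N = false by lia.
rewrite E0 mul0r sub0r.
rewrite big1_seq ?addr0 // => j /andP[ji]; rewrite mem_iota => jr.
rewrite !mxE !eqxx -!val_eqE /= !inordK; try lia.
have E1 : ((2 * j).-1 == 2 * i)%N = false by lia.
have E2 : (2 * j == 2 * i)%N = false by lia.
by rewrite E1 E2 !mul0r subr0.
Qed.

Let heis_central : lie_central z.
Proof.
move=> v; rewrite br_heis big1_seq ?scale0r // => j /andP[_]; rewrite mem_iota => jr.
rewrite !mxE !eqxx -!val_eqE /= !inordK; try lia.
have E1 : ((2 * j).-1 == 0)%N = false by lia.
have E2 : (2 * j == 0)%N = false by lia.
by rewrite E1 E2 !mul0r subr0.
Qed.

Let z_derived : (0 < r)%N -> z \in derived (Heis k r).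
Proof.
move=> r0; have <- : ⁅d (inord (2 * 1).-1), d (inord (2 * 1))⁆ = z.
  by rewrite br_pairl ?r0 // !mxE !eqxx scale1r.
exact: mem_derived.
Qed.

Lemma dim_derived_heis : (0 < r)%N -> \dim (derived (Heis k r)) = 1%N.
Proof.
move=> r0; have -> : derived (Heis k r) = <[z]>%VS; last by rewrite dim_vline zn0.
apply/eqP; rewrite eqEsubv; apply/andP; split; last by rewrite -memvE z_derived.
by apply: derived_sub => u v; rewrite br_heis memvZ // memv_line.
Qed.

(** If [w] is orthogonal to one symplectic pair, the cocycle identity for this pair and [w] gives
    [f (w, z) = 0]. With two pairs every element is a sum of two such [w], so the slice at the
    center is 0 and [s = 2]. *)
Lemma heis_s : (2 <= r)%N -> lie_s (Heis k r) 2.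
Proof.
move=> r2; have r0 : (0 < r)%N by lia.
have [e Ge] := central_slice_dim_ex z.
have [e2 sH] := lie_s_dim1 (dim_derived_heis r0) (z_derived r0) zn0 heis_central Ge.
suff e0 : (e <= 0)%N by move: sH; rewrite (_ : e = 0%N) ?subn0 //; lia.
apply: (fdim_le_points (t := fun i : 'I_0 => 0) (central_slice_closed z) Ge) => g [f cf gE] _ v.
have pairz i (w : Heis k r) : (0 < i <= r)%N -> (w : 'rV_(2 * r).+1) 0 (inord (2 * i)) = 0 ->
    (w : 'rV_(2 * r).+1) 0 (inord (2 * i).-1) = 0 -> f (w, z) = 0.
  move=> ir w1 w2.
  have := cocycle_jacobi cf (d (inord (2 * i).-1)) (d (inord (2 * i))) w.
  rewrite br_pairl // br_pairr // w2 oppr0 scale0r (cocycle0l cf) addr0.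
  rewrite mxE !eqxx scale1r.
  rewrite [⁅w, _⁆]lie_brC br_pairl // w1 scale0r oppr0 (cocycle0l cf) addr0 (cocycleC cf).
  by move/eqP; rewrite oppr_eq0 => /eqP.
pose w1 : Heis k r := (v : 'rV_(2 * r).+1) 0 (inord 1) *: d (inord 1) + (v : 'rV_(2 * r).+1) 0
  (inord 2) *: d (inord 2).
rewrite gE -[v](subrK w1) (cocycleDl cf) (pairz 1%N (v - w1)) ?r0 ?(pairz 2 w1) ?addr0 //.
- by rewrite !mxE -!val_eqE /= !inordK ?mulr0 ?addr0 //; lia.
- by rewrite !mxE -!val_eqE /= !inordK ?mulr0 ?addr0 //; lia.
- by rewrite !mxE -!val_eqE /= !inordK ?mulr0 ?mulr1 ?add0r ?subrr //; lia.
- by rewrite !mxE -!val_eqE /= !inordK ?mulr0 ?mulr1 ?addr0 ?subrr //; lia.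
Qed.
End Heisenberg.

Lemma derived_one (k : fieldType) (A : finLieType k) : lie_nilpotent A ->
  \dim (derived A) = 1%N -> exists r i : nat,
    [/\ (0 < r)%N, lie_iso A (Heis k r ⊕ Ab k i) & \dim {:A} = (2 * r + 1 + i)%N].
Proof.
move=> nA d1; have A0 : derived A != 0%VS by rewrite -dimv_eq0 d1.
have [s sA _] := lie_s_ex nA A0.
have [B [i [t [AB nB sB [dB _ _ dimA]]]]] := lie_s_stem_split nA A0 sA.
rewrite d1 in dB; have [r [r0 BH dimB]] := heis_stem nB sB dB.
by exists r, i; split=> //; [exact: lie_iso_dsum_Ab AB | rewrite dimA dimB addn1].
Qed.

Lemma pair_dim_arith (a b n m : nat) : (0 < a)%N -> (a <= n)%N -> (b <= m)%N ->
  ((n - a) * (m - b) + (a - 1) * m + b * (n - a) = n.-1 * m)%N.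
Proof.
move=> + /subnKC <- /subnKC <-; case: a => // a _; move: (n - _)%N (m - b)%N => x y.
by rewrite addSn !subSS subn0 /= addKn !mulnDl !mulnDr; lia.
Qed.

(** With the multiplier dimension eliminated, the rational equation becomes one of natural numbers.
    The upper bound on [q] says that this dimension, obtained by subtraction, is not negative. *)
Lemma pair_sE (k : fieldType) (L : finLieType k) (N : {vspace L}) (A B : finLieType k)
    (F : lieType k) (pi : {linear F -> L}) s q :
  pair_iso N (summand1 A B) -> free_presentation pi -> derived A != 0%VS -> lie_s A s ->
  let a := \dim (derived A) in let n := \dim {:A} in let m := \dim {:B} in
  pair_s pi N m q%:R <->
  (s + (a - 1) * m + \dim (derived B) * (n - a) = q)%N /\ (q <= 'C(n.-1, 2) + 1 + n.-1 * m)%N.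
Proof.
move=> NAB pres A0 [d0 cA sE] a n m.
have a0 : (0 < a)%N by rewrite lt0n dimv_eq0.
have an : (a <= n)%N by exact: dimvS (subvf _).
have bm : (\dim (derived B) <= m)%N by exact: dimvS (subvf _).
set b := \dim (derived B) in bm *.
have key e : (e%:R = 2^-1 * (n%:R - 1) * (n%:R - 2) + 1 + (n%:R - 1) * m%:R - q%:R :> rat) <->
    (e + q = 'C(n.-1, 2) + 1 + n.-1 * m)%N.
  have -> : 2^-1 * (n%:R - 1) * (n%:R - 2) = 'C(n.-1, 2)%:R :> rat.
    case: n an => [|n'] an; first by lia.
    have -> : n'.+1%:R - 1 = n'%:R :> rat by rewrite -natr1 addrK.
    have -> : n'.+1%:R - 2 = n'%:R - 1 :> rat by rewrite -natr1; ring.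
    have : (n' * n'.-1 = 2 * 'C(n', 2))%N by rewrite -mul_bin_diag bin1.
    move/(congr1 (fun i => i%:R : rat)); rewrite !natrM.
    have -> : n'%:R * n'.-1%:R = n'%:R * (n'%:R - 1) :> rat.
      by case: (n') => [|n2] /=; rewrite ?mul0r // -[n2.+1%:R]natr1 addrK.
    by move=> E; rewrite -mulrA E mulrA mulVf ?mul1r.
  have -> : n%:R - 1 = n.-1%:R :> rat by rewrite -{1}(prednK (leq_trans a0 an)) -natr1 addrK.
  rewrite -natrM -(natrD _ _ 1) -natrD; split=> [/eqP|eE].
    by rewrite -subr_eq opprK -natrD Num.Theory.eqr_nat => /eqP.
  by rewrite -eE natrD addrK.
have mE : ((n - a) * (m - b) + (a - 1) * m + b * (n - a) = n.-1 * m)%N.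
  exact: pair_dim_arith.
have nE : 'C(n, 2) = ('C(n.-1, 2) + n.-1)%N.
  by rewrite -{1}(prednK (leq_trans a0 an)) binS bin1.
split.
  case=> e Me; rewrite (proj1 (pair_iso_dim NAB)) -/n => /key eE.
  have := (multiplier_dim_pair e NAB pres cA).1 Me.
  move: sE mE eE; rewrite -/a -/n -/m -/b; lia.
case=> sq qle; pose e := ('C(n.-1, 2) + 1 + n.-1 * m - q)%N.
exists e; last first.
  by rewrite (proj1 (pair_iso_dim NAB)) -/n; apply/key; rewrite /e; lia.
apply/(multiplier_dim_pair e NAB pres cA); rewrite -/a -/n -/m -/b.
by move: sE mE sq qle; rewrite /e -/a -/n -/m -/b; lia.
Qed.

(** * The classification *)

Lemma pair_s_six (k : fieldType) (L : finLieType k) (N : {vspace L}) (A B : finLieType k)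
    (F : lieType k) (pi : {linear F -> L}) s a b n m :
  pair_iso N (summand1 A B) -> free_presentation pi -> lie_s A s ->
  \dim (derived A) = a -> \dim (derived B) = b -> \dim {:A} = n -> \dim {:B} = m ->
  (0 < a)%N -> (s + (a - 1) * m + b * (n - a) = 6)%N -> (6 <= 'C(n.-1, 2) + 1 + n.-1 * m)%N ->
  pair_s pi N m 6.
Proof.
move=> NAB pres sA da db dn dm a0 E1 E2; have A0 : derived A != 0%VS by rewrite -dimv_eq0 da -lt0n.
have := pair_sE 6 NAB pres A0 sA; rewrite da db dn dm => H.
by apply/H.
Qed.

Theorem theorem2p2 (k : closedFieldType) (char_k : 2%N \notin [pchar k])
    (L : finLieType k) (nilL : lie_nilpotent L)
    (N : {vspace L}) (idN : lie_ideal N) (nabN : ~ lie_abelian N)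
    (K : {vspace L}) (idK : lie_ideal K) (nzK : K <> 0%VS)
    (sumNK : (N + K)%VS = fullv) (dirNK : directv (N + K))
    (F : lieType k) (pi : {linear F -> L}) (presL : free_presentation pi) :
  let m := \dim K in
  pair_s pi N m 6
  <->
     (exists r : nat, (1 <= r)%N /\ (2 * r + 1 <= m)%N /\
        pair_iso N (summand1 (Heis k 1 ⊕ Ab k 4)
                             (Heis k r ⊕ Ab k (m - 2 * r - 1)%N)))
  \/ (exists K' : finLieType k, lie_nilpotent K' /\ \dim (derived K') = 2%N /\
        pair_iso N (summand1 (Heis k 1 ⊕ Ab k 1) K'))
  \/ (exists K' : finLieType k, lie_nilpotent K' /\ \dim (derived K') = 3%N /\
        pair_iso N (summand1 (Heis k 1) K'))
  \/ (exists r : nat, (1 <= r)%N /\ (2 * r + 1 <= m)%N /\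
        pair_iso N (summand1 (Heis k 2) (Heis k r ⊕ Ab k (m - 2 * r - 1)%N)))
  \/ (exists i : nat, (i <= 4)%N /\
        pair_iso N (summand1 (L5_8 k ⊕ Ab k i) (Ab k (5 - i)%N)))
  \/ (exists i : nat, (i <= 3)%N /\
        pair_iso N (summand1 (L4_3 k ⊕ Ab k i) (Ab k (4 - i)%N)))
  \/ (exists i : nat, (i <= 2)%N /\
        pair_iso N (summand1 (L5_5 k ⊕ Ab k i) (Ab k (3 - i)%N)))
  \/ (exists (i : nat) (eps : k), (i <= 2)%N /\
        pair_iso N (summand1 (L6_22 eps ⊕ Ab k i) (Ab k (3 - i)%N)))
  \/ pair_iso N (summand1 (L5_6 k) (Ab k 1))
  \/ pair_iso N (summand1 (L5_7 k) (Ab k 1))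
  \/ pair_iso N (summand1 (L5_9 k) (Ab k 1))
  \/ pair_iso N (summand1 (L37A k) (Ab k 1))
  \/ pair_iso N (summand1 (L6_10 k) (Ab k 1)).
Proof.
have [m mK] : exists m : nat, \dim K = m by eexists.
rewrite mK /=; have m0 : (0 < m)%N by rewrite -mK lt0n dimv_eq0; apply/eqP.
have mE (A B : finLieType k) : pair_iso N (summand1 A B) -> \dim {:B} = m.
  move=> /pair_iso_dim[nE]; rewrite -mK -sumNK (directvP dirNK) /= nE => /eqP.
  by rewrite eqn_add2l => /eqP.
split.
- have [A [B NAB]] := pair_iso_ex idN idK sumNK dirNK.
  have [nA nB] := pair_iso_nilpotent NAB nilL; have dB := mE _ _ NAB.
  have A0 : derived A != 0%VS.
    apply/eqP => D0; apply: nabN => x y xN yN; have [f [fm [g fK gK] fN]] := NAB.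
    have x2 : (f x).2 = 0 by apply/eqP; rewrite -mem_summand1 fN.
    have y2 : (f y).2 = 0 by apply/eqP; rewrite -mem_summand1 fN.
    apply: (can_inj fK); rewrite fm linear0; congr pair; rewrite /= ?x2 ?lie_br0l //.
    by apply/eqP; rewrite -memv0 -D0; exact: mem_derived.
  have [s sA sle] := lie_s_ex nA A0.
  have := pair_sE 6 NAB presL A0 sA; rewrite dB => H /H[E _] {H}.
  have bm : (\dim (derived B) <= m)%N by rewrite -dB; exact: dimvS (subvf _).
  have an : (\dim (derived A) <= \dim {:A})%N by exact: dimvS (subvf _).
  have Bab : \dim (derived B) = 0%N -> lie_iso B (Ab k m).
    by move=> b0; rewrite -dB; apply: abelian_iso; apply/eqP; rewrite -dimv_eq0 b0.
  have Bheis : \dim (derived B) = 1%N -> exists r, [/\ (1 <= r)%N, (2 * r + 1 <= m)%N &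
      lie_iso B (Heis k r ⊕ Ab k (m - 2 * r - 1))].
    move=> b1; have [r [i [r0 BH dimB]]] := derived_one nB b1.
    exists r; split=> //; first by rewrite -dB dimB leq_addr.
    by rewrite -dB dimB (_ : (_ - _ - 1 = i)%N); last by lia.
  (* This excludes [b = 1] in the cases [a = 2] and [a = 3], where it makes [m] too large. *)
  have m3 : \dim (derived B) = 1%N -> (3 <= m)%N by move=> /Bheis[r [r1 rm _]]; lia.
  have strip0 (C X : finLieType k) : lie_iso A (C ⊕ Ab k 0) -> lie_iso C X -> lie_iso A X.
    by move=> H CX; apply: lie_iso_trans H (lie_iso_trans (dsum_Ab0 _) CX).
  have a0 : (0 < \dim (derived A))%N by rewrite lt0n dimv_eq0.
  have [a da] : exists a : nat, \dim (derived A) = a by eexists.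
  have [b db] : exists b : nat, \dim (derived B) = b by eexists.
  have [n dn] : exists n : nat, \dim {:A} = n by eexists.
  rewrite dn in an E; rewrite da in a0 sle an; rewrite db in bm Bab Bheis m3; rewrite da db in E.
  have [a1|[a2|[a3|a4]]] : a = 1%N \/ a = 2%N \/ a = 3%N \/ (4 <= a)%N by lia.
  + have [r [i [r0 AH dimA]]] := derived_one nA (etrans da a1).
    have sH t : lie_s (Heis k r) t -> s = t.
      move=> tH; apply: (lie_s_unique sA); apply: (lie_s_iso (lie_iso_sym AH)).
      have := lie_s_dsum_Ab i _ tH; rewrite -dimv_eq0 dim_derived_heis // subnn mul0n addn0.
      exact.
    rewrite a1 subnn mul0n addn0 -dn dimA in E.
    have [r1|r2] : r = 1%N \/ (2 <= r)%N by lia.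
    * have s0 : s = 0%N by apply: sH; rewrite r1; case: (Heis1_s k).
      rewrite s0 r1 in E; rewrite r1 in AH.
      (* The equation is [b (i + 2) = 6], so [b] is 1, 2 or 3 respectively. *)
      have [i4|[i1|i0]] : i = 4%N \/ i = 1%N \/ i = 0%N.
        have b0 : (0 < b)%N by case: (b) E.
        have : (2 * 1 + 1 + i - 1 <= 6)%N by rewrite -E add0n leq_pmull.
        by clear - E; case: i E => [|[|[|[|[|i]]]]] //; lia.
      -- rewrite i4 in AH E; have [r' [r'0 r'm Br]] := Bheis ltac:(lia).
         by left; exists r'; split=> //; split=> //; apply: (pair_iso_dsum AH Br NAB).
      -- rewrite i1 in AH E; right; left; exists B; split=> //; split; first by lia.
         exact: (pair_iso_dsum AH (lie_iso_refl _) NAB).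
      -- rewrite i0 in AH E; do 2 right; left; exists B; split=> //; split; first by lia.
         exact: (pair_iso_dsum (strip0 _ _ AH (lie_iso_refl _)) (lie_iso_refl _) NAB).
    * have s2 : s = 2%N by apply: sH; exact: heis_s.
      rewrite s2 in E.
      (* The equation is [b (2 r + i) = 4] with [r >= 2]. *)
      have [b1 r2' i0] : [/\ b = 1, r = 2 & i = 0]%N.
        have b0 : (0 < b)%N by case: (b) E => //; lia.
        have : (2 * r + 1 + i - 1 <= 4)%N.
          have : (b * (2 * r + 1 + i - 1) = 4)%N by lia.
          by move=> <-; rewrite leq_pmull.
        move=> le4; have [rr ii] : r = 2%N /\ i = 0%N by lia.
        have b4 : (b * 4 = 4)%N by move: E; rewrite rr ii (_ : 2 * 2 + 1 + 0 - 1 = 4)%N //; lia.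
        by split=> //; clear - b4; lia.
      rewrite r2' i0 in AH; have [r' [r'0 r'm Br]] := Bheis b1.
      do 3 right; left; exists r'; split=> //; split=> //.
      exact: (pair_iso_dsum (strip0 _ _ AH (lie_iso_refl _)) Br NAB).
  + have [C [i [t [AC' nC stC [dC tC st dimA]]]]] := lie_s_stem_split nA A0 sA.
    have [c cE] : exists c : nat, \dim {:C} = c by eexists.
    rewrite da a2 in dC st; rewrite a2 -dn dimA cE in E.
    rewrite !mul1n in st E.
    have val (X : finLieType k) t' c' : lie_iso C X -> lie_s X t' -> \dim {:X} = c' ->
        t = t' /\ c = c'.
      by move=> CX tX <-; split; [apply: (lie_s_unique tC (lie_s_iso (lie_iso_sym CX) tX)) |
        rewrite -cE; exact: dim_iso].
    (* For [a = 2] the equation is [t + i + m + b (c + i - 2) = 6]; a nonabelian complement makes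
       the left side too large. *)
    have tl : (4 <= c)%N -> (2 <= t)%N || (5 <= c)%N -> (1 <= t)%N ->
        b = 0%N /\ (t + i + m = 6)%N.
      move=> c4 tc t1.
      suff b0 : b = 0%N by split=> //; rewrite b0 in E; lia.
      have [//|[b1|b2]] : b = 0%N \/ b = 1%N \/ (2 <= b)%N by lia.
        by have := m3 b1; rewrite b1 in E; lia.
      have : (2 * (c + i - 2) <= b * (c + i - 2))%N by rewrite leq_mul2r b2 orbT.
      by lia.
    have t5 : (t <= 5)%N.
      have : (s + m <= 6)%N by rewrite -[X in (_ <= X)%N]E leq_addr.
      by lia.
    case: (derived_two_stem char_k nC stC dC tC t5) => [CX|CX|CX|[CX|[eps CX]]].
    * have [tE cE'] := val _ _ 5%N CX (proj1 (L5_8_s k)) (dim_table _).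
      have [b0 mm] : b = 0%N /\ (t + i + m = 6)%N by apply: tl; rewrite ?tE ?cE'.
      do 4 right; left; exists i; split; first by lia.
      by apply: (pair_iso_dsum (lie_iso_dsum_Ab CX AC') _ NAB); rewrite (_ : 5 - i = m)%N;
        [exact: Bab | lia].
    * have [tE cE'] := val _ _ 4%N CX (proj1 (L4_3_s k)) (dim_table _).
      have [b0 mm] : b = 0%N /\ (t + i + m = 6)%N by apply: tl; rewrite ?tE ?cE'.
      do 5 right; left; exists i; split; first by lia.
      by apply: (pair_iso_dsum (lie_iso_dsum_Ab CX AC') _ NAB); rewrite (_ : 4 - i = m)%N;
        [exact: Bab | lia].
    * have [tE cE'] := val _ _ 5%N CX (proj1 (L5_5_s k)) (dim_table _).
      have [b0 mm] : b = 0%N /\ (t + i + m = 6)%N by apply: tl; rewrite ?tE ?cE'.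
      do 6 right; left; exists i; split; first by lia.
      by apply: (pair_iso_dsum (lie_iso_dsum_Ab CX AC') _ NAB); rewrite (_ : 3 - i = m)%N;
        [exact: Bab | lia].
    * have [tE cE'] := val _ _ 6%N CX (proj1 (L6_10_s k)) (dim_table _).
      have [b0 mm] : b = 0%N /\ (t + i + m = 6)%N by apply: tl; rewrite ?tE ?cE'.
      do 12 right; have [i0 m1] : i = 0%N /\ m = 1%N by lia.
      rewrite i0 in AC'; have B1 := Bab b0; rewrite m1 in B1.
      exact: (pair_iso_dsum (strip0 _ _ AC' CX) B1 NAB).
    * have [tE cE'] := val _ _ 6%N CX (proj1 (L6_22_s eps)) (dim_table _).
      have [b0 mm] : b = 0%N /\ (t + i + m = 6)%N by apply: tl; rewrite ?tE ?cE'.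
      do 7 right; left; exists i, eps; split; first by lia.
      by apply: (pair_iso_dsum (lie_iso_dsum_Ab CX AC') _ NAB); rewrite (_ : 3 - i = m)%N;
        [exact: Bab | lia].
  (* For [a = 3] the equation is [s + 2 m + b (n - 3) = 6] with [s >= 3], which leaves [b = 0],
     [m = 1], [s = 4]. *)
  + have s3 : (3 <= s)%N by rewrite a3 in sle.
    rewrite a3 in E; have s6 : (s + 2 * m <= 6)%N by rewrite -E leq_addr.
    have b0 : b = 0%N.
      have [//|[/m3 m3'|b2]] : b = 0%N \/ b = 1%N \/ (2 <= b)%N by clear; lia.
        by lia.
      by lia.
    have [m1 s4] : m = 1%N /\ s = 4%N by move: E; rewrite b0; lia.
    have B1 := Bab b0; rewrite m1 in B1; rewrite s4 in sA.
    by case: (derived_three char_k nA (etrans da a3) sA) => AX; have H := pair_iso_dsum AX B1 NAB; tauto.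
  (* For [a >= 4] already [s >= 6], and [(a - 1) m >= 3] is added. *)
  + have : ('C(4, 2) <= 'C(a, 2))%N by apply: leq_bin2l.
    have : (s + (a - 1) * m <= 6)%N by rewrite -[X in (_ <= X)%N]E leq_addr.
    have : (a - 1 <= (a - 1) * m)%N by rewrite leq_pmulr.
    by rewrite (_ : 'C(4, 2) = 6%N) //; lia.
- case=> [[r [r1 [rm H]]]|[[K' [_ [dK' H]]]|[[K' [_ [dK' H]]]|[[r [r1 [rm H]]]|]]]].
  + have [tH dH] := Heis1_s k; have H0 : derived (Heis k 1) != 0%VS by rewrite -dimv_eq0 dH.
    apply: (pair_s_six (a := 1%N) (b := 1%N) (n := 7%N) H presL (lie_s_dsum_Ab 4 H0 tH)) => //.
    * by rewrite dim_derived_dsum dH dim_derived_Ab.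
    * by rewrite dim_derived_dsum dim_derived_heis // dim_derived_Ab.
    * by rewrite dim_dsum dim_table dim_Ab.
    * exact: mE H.
    * by rewrite dH.
  + have [tH dH] := Heis1_s k; have H0 : derived (Heis k 1) != 0%VS by rewrite -dimv_eq0 dH.
    apply: (pair_s_six (a := 1%N) (b := 2%N) (n := 4%N) H presL (lie_s_dsum_Ab 1 H0 tH)) => //.
    * by rewrite dim_derived_dsum dH dim_derived_Ab.
    * by rewrite dim_dsum dim_table dim_Ab.
    * exact: mE H.
    * by rewrite dH.
    * by rewrite (_ : 'C(4.-1, 2) = 3)%N //; lia.
  + have [tH dH] := Heis1_s k.
    apply: (pair_s_six (a := 1%N) (b := 3%N) (n := 3%N) H presL tH) => //.
    * by rewrite dim_table.
    * exact: mE H.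
    * have : (3 <= m)%N by rewrite -(mE _ _ H) -dK'; exact: dimvS (subvf _).
      by rewrite (_ : 'C(3.-1, 2) = 1)%N //; lia.
  + have tH := heis_s k (isT : (2 <= 2)%N).
    apply: (pair_s_six (a := 1%N) (b := 1%N) (n := 5%N) H presL tH) => //.
    * by rewrite dim_derived_heis.
    * by rewrite dim_derived_dsum dim_derived_heis // dim_derived_Ab.
    * by rewrite dim_table.
    * exact: mE H.
  (* For [a = 2] an abelian dimension contributes 1 whether it lies in [N] or in the complement, so
     only the total [j + 1 = 6 - t] matters. *)
  have ab2 (X : finLieType k) t c i j : lie_s X t -> \dim (derived X) = 2%N -> \dim {:X} = c ->
      (4 <= c)%N -> (i <= j)%N -> (t + j.+1 = 6)%N ->
      pair_iso N (summand1 (X ⊕ Ab k i) (Ab k (j.+1 - i))) -> pair_s pi N m 6.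
    move=> tX dX cX c4 ij tj H; have X0 : derived X != 0%VS by rewrite -dimv_eq0 dX.
    have := mE _ _ H; rewrite dim_Ab => jm.
    apply: (pair_s_six (a := 2%N) (b := 0%N) (n := (c + i)%N) H presL (lie_s_dsum_Ab i X0 tX)) => //.
    * by rewrite dim_derived_dsum dX dim_derived_Ab.
    * by rewrite dim_derived_Ab.
    * by rewrite dim_dsum dim_Ab cX.
    * exact: mE H.
    * by rewrite dX; lia.
    * have : ('C(3, 2) <= 'C((c + i).-1, 2))%N by apply: leq_bin2l; lia.
      rewrite (_ : 'C(3, 2) = 3%N) //; have : (3 * 1 <= (c + i).-1 * m)%N by apply: leq_mul; lia.
      by lia.
  (* A complement of dimension one contributes [a - 1], so the condition is [t + a - 1 = 6]. *)
  have ab1 (X : finLieType k) t a c : lie_s X t -> \dim (derived X) = a -> \dim {:X} = c ->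
      (5 <= c)%N -> (0 < a)%N -> (t + a = 7)%N ->
      pair_iso N (summand1 X (Ab k 1)) -> pair_s pi N m 6.
    move=> tX dX cX c4 a0 ta H; have := mE _ _ H; rewrite dim_Ab => m1.
    apply: (pair_s_six (b := 0%N) (n := c) H presL tX dX) => //.
    * by rewrite dim_derived_Ab.
    * exact: mE H.
    * by rewrite -m1; lia.
    * have : ('C(4, 2) <= 'C(c.-1, 2))%N by apply: leq_bin2l; lia.
      by rewrite (_ : 'C(4, 2) = 6%N) //; lia.
  case=> [[i [i4 H]]|[[i [i3 H]]|[[i [i2 H]]|[[i [eps [i2 H]]]|[H|[H|[H|[H|H]]]]]]]].
  + by have [tX dX] := L5_8_s k; exact: (ab2 _ 1%N _ _ 4%N tX dX (dim_table _) isT i4 erefl H).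
  + by have [tX dX] := L4_3_s k; exact: (ab2 _ 2%N _ _ 3%N tX dX (dim_table _) isT i3 erefl H).
  + by have [tX dX] := L5_5_s k; exact: (ab2 _ 3%N _ _ 2%N tX dX (dim_table _) isT i2 erefl H).
  + by have [tX dX] := L6_22_s eps; exact: (ab2 _ 3%N _ _ 2%N tX dX (dim_table _) isT i2 erefl H).
  + by have [tX dX] := L5_6_s k; exact: (ab1 _ _ _ _ tX dX (dim_table _) isT isT erefl H).
  + by have [tX dX] := L5_7_s k; exact: (ab1 _ _ _ _ tX dX (dim_table _) isT isT erefl H).
  + by have [tX dX] := L5_9_s k; exact: (ab1 _ _ _ _ tX dX (dim_table _) isT isT erefl H).
  + by have [tX dX] := L37A_s k; exact: (ab1 _ _ _ _ tX dX (dim_table _) isT isT erefl H).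
  + by have [tX dX] := L6_10_s k; exact: (ab1 _ _ _ _ tX dX (dim_table _) isT isT erefl H).
Qed.
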